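(* In the setting described in the context (with $I_{\mathrm{ra}}\neq\emptyset$), let $\hat\omega$ be the $2$-form on $\widehat{\mathcal M}_{\boldsymbol t_{\mathrm{ra}}}\times T_{\boldsymbol\theta}$ defined in the context by residues. For $i\in I_{\mathrm{un}}$ and $0\le l\le n_i-2$, one has $\hat\omega(\delta^{\mathrm{IMD}}_{\theta^\pm_{l,t_i}},\hat\delta)=0$ for any vector field $\hat\delta$ on $\widehat{\mathcal M}_{\boldsymbol t_{\mathrm{ra}}}\times T_{\boldsymbol\theta}$. Moreover, for $i\in\{3,4,\dots,\nu\}\cap(I_{\mathrm{reg}}\cup I_{\mathrm{un}})$, one has $\hat\omega(\delta^{\mathrm{IMD}}_{t_i},\hat\delta)=0$ for any vector field $\hat\delta$ on $\widehat{\mathcal M}_{\boldsymbol t_{\mathrm{ra}}}\times T_{\boldsymbol\theta}$.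
   Context: **Setting.** Let $\nu\ge2$, $I=\{1,\dots,\nu,\infty\}$, $t_1=0$, $t_2=1$, $t_\infty=\infty\in\mathbb P^1$. Let $n_i\ge1$ ($i\in I$) be integers, $n=\sum_{i\in I}n_i$, and $I=I_{\mathrm{reg}}\sqcup I_{\mathrm{un}}\sqcup I_{\mathrm{ra}}$ with $n_i=1$ for $i\in I_{\mathrm{reg}}$, $n_i>1$ for $i\in I_{\mathrm{un}}\cup I_{\mathrm{ra}}$; assume $I_{\mathrm{ra}}\ne\emptyset$. Let $x$ be the affine coordinate on $U_0=\mathbb P^1\setminus\{\infty\}$, $w=1/x$ the coordinate on $U_\infty=\mathbb P^1\setminus\{0\}$; $x_{t_i}=x-t_i$ ($i\ne\infty$), $x_{t_\infty}=w$. Fix $\boldsymbol t_{\mathrm{ra}}=(t_i)_{i\in\{3,\dots,\nu\}\cap I_{\mathrm{ra}}}$, pairwise distinct and $\notin\{0,1\}$. $(T_{\boldsymbol t})_{\boldsymbol t_{\mathrm{ra}}}$ is the set of $\boldsymbol t=(t_3,\dots,t_\nu)$ with pairwise distinct entries $\notin\{0,1\}$ whose entries with index in $I_{\mathrm{ra}}$ are the prescribed ones. $T_{\boldsymbol\theta}$ is the set of tuples $\boldsymbol\theta$ of complex numbers $\theta^\pm_{l,t_i}$ ($i\in I_{\mathrm{un}},0\le l\le n_i-2$), $\theta_{l',t_i}$ ($i\in I_{\mathrm{ra}},0\le l'\le 2n_i-3$) with $\theta^+_{0,t_i}\neq\theta^-_{0,t_i}$ ($i\in I_{\mathrm{un}}$),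 $\theta_{1,t_i}\ne0$ ($i\in I_{\mathrm{ra}}$). Fix constants $\boldsymbol\theta_0=((\theta^\pm_{n_i-1,t_i})_{i\in I_{\mathrm{reg}}\cup I_{\mathrm{un}}},(\theta_{2n_i-2,t_i})_{i\in I_{\mathrm{ra}}})$ with $\sum_{i\in I_{\mathrm{reg}}\cup I_{\mathrm{un}}}(\theta^+_{n_i-1,t_i}+\theta^-_{n_i-1,t_i})+\sum_{i\in I_{\mathrm{ra}}}(\theta_{2n_i-2,t_i}-\frac12)=-1$ and $\theta^+_{0,t_i}-\theta^-_{0,t_i}\notin\mathbb Z$ for $i\in I_{\mathrm{reg}}$. $\widehat{\mathcal M}_{\boldsymbol t_{\mathrm{ra}}}$ is the set of $(\{(q_1,p_1),\dots,(q_{n-3},p_{n-3})\},\boldsymbol t)\in\mathrm{Sym}^{(n-3)}(\mathbb C^2)\times(T_{\boldsymbol t})_{\boldsymbol t_{\mathrm{ra}}}$ with the $q_j$ pairwise distinct and $q_j\notin\{0,1,t_3,\dots,t_\nu,\infty\}$. $P(x)=\prod_{i=1}^\nu(x-t_i)^{n_i}$. **Bundles, local data.** $E_k=\mathcal O_{\mathbb P^1}\oplus\mathcal O_{\mathbb P^1}(k)$ is given by trivializations on $U_0,U_\infty$ with transition matrix $G_k=\mathrm{diag}(1,x^k)$ from $U_\infty$ to $U_0$; a connection $d+\Omega$ on $U_0$ reads $d+G_k^{-1}dG_k+G_k^{-1}\Omega G_k$ on $U_\infty$. Local formal data at $t_i$ of a connection matrix $\Omega$ (the one on $U_\infty$ if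 $i=\infty$): for $i\in I_{\mathrm{reg}}\cup I_{\mathrm{un}}$, $(\theta^\pm_{l,t_i})_{0\le l\le n_i-1}$ if some $M\in GL_2(\mathbb C[[x_{t_i}]])$ gives $M^{-1}dM+M^{-1}\Omega M=\sum_{l=0}^{n_i-1}\mathrm{diag}(\theta^+_{l,t_i},\theta^-_{l,t_i})x_{t_i}^{-n_i+l}dx_{t_i}$; for $i\in I_{\mathrm{ra}}$, $(\theta_{l',t_i})_{0\le l'\le2n_i-2}$ if some such $M$ gives $M^{-1}dM+M^{-1}\Omega M=\begin{pmatrix}\alpha&\beta\\ x_{t_i}\beta&\alpha-\frac{dx_{t_i}}{2x_{t_i}}\end{pmatrix}$ with $\alpha=\sum_{l=0}^{n_i-1}\frac{\theta_{2l,t_i}}2x_{t_i}^{-n_i+l}dx_{t_i}$, $\beta=\sum_{l=0}^{n_i-2}\frac{\theta_{2l+1,t_i}}2x_{t_i}^{-n_i+l}dx_{t_i}$. **Normal form (Diarra–Loray).** For each point of $\widehat{\mathcal M}_{\boldsymbol t_{\mathrm{ra}}}\times T_{\boldsymbol\theta}$ there is a unique connection $d+\widehat\Omega^{(n-2)}$ on $E_{n-2}$, with $\widehat\Omega^{(n-2)}=\begin{pmatrix}0&1/P(x)\\ c_0(x)&d_0(x)\end{pmatrix}dx$ on $U_0$, $$c_0=\sum_{i=1}^\nu\frac{C_i(x)}{(x-t_i)^{n_i}}+\sum_{j=1}^{n-3}\frac{p_j}{x-q_j}+\tilde C(x)+x^{n-3}C_\infty(x),\qquad d_0=\sum_{i=1}^\nu\frac{D_i(x)}{(x-t_i)^{n_i}}-\sum_{j=1}^{n-3}\frac1{x-q_j}+D_\infty(x),$$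 polynomials $C_i,D_i,C_\infty,D_\infty,\tilde C$ with $\deg C_i,\deg D_i\le n_i-1$ ($i\le\nu$), $\deg C_\infty\le n_\infty-1$, $\deg D_\infty\le n_\infty-2$, $\deg\tilde C\le n-4$, such that (a) each $q_j$ is an apparent singularity, i.e. with $\tilde\Phi_{q_j}=\begin{pmatrix}1&0\\ p_j&x-q_j\end{pmatrix}$ the matrix $\tilde\Phi_{q_j}^{-1}d\tilde\Phi_{q_j}+\tilde\Phi_{q_j}^{-1}\widehat\Omega^{(n-2)}\tilde\Phi_{q_j}$ has no pole at $q_j$, and (b) its local formal data at every $t_i$ is given by $(\boldsymbol\theta,\boldsymbol\theta_0)$. Write $\widehat\Omega^{(n-2)}_\infty=G_{n-2}^{-1}dG_{n-2}+G_{n-2}^{-1}\widehat\Omega^{(n-2)}G_{n-2}$; at $i=\infty$ this matrix is used in place of $\widehat\Omega^{(n-2)}$ throughout. Let $Q_1(x)=\prod_{j}(x-q_j)$, $Q_2$ the polynomial of degree $\le n-4$ with $Q_2(q_j)=p_j$, $\tilde G=\begin{pmatrix}1&0\\ Q_2&Q_1\end{pmatrix}$, $\tilde G_\infty=G_{n-2}^{-1}\tilde G G_1$. Then $\widehat\Omega^{(1)}=\tilde G^{-1}d\tilde G+\tilde G^{-1}\widehat\Omega^{(n-2)}\tilde G$ defines a connection $\widehat\nabla^{(1)}$ on $E_1$ with polar divisor $\sum_{i\in I}n_it_i$. **Formal solutions, $i\in I_{\mathrm{reg}}\cup I_{\mathrm{un}}$.** Let $\Phi_i\in GL_2$ (compatible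 framing), depending only on $(\boldsymbol t,\boldsymbol\theta)$, be such that $\Phi_i^{-1}\widehat\Omega^{(n-2)}\Phi_i$ has leading coefficient $\mathrm{diag}(\theta^+_{0,t_i},\theta^-_{0,t_i})$ of $x_{t_i}^{-n_i}dx_{t_i}$. There are unique functions $\theta^\pm_{l,t_i}$ ($l\ge n_i$) and a unique formal series $\Xi_i=\mathrm{id}+\sum_{s\ge1}\begin{pmatrix}0&*\\ *&0\end{pmatrix}x_{t_i}^s$ such that $\psi_i=\Phi_i\Xi_i\exp(-\Lambda_i)$, $\Lambda_i=\mathrm{diag}(\hat\lambda_i^+,\hat\lambda_i^-)$, $\hat\lambda_i^\pm=\sum_{l\ge0}\theta^\pm_{l,t_i}\int x_{t_i}^{-n_i+l}dx_{t_i}$, formally solves $(d+\widehat\Omega^{(n-2)})\psi_i=0$. **Formal solutions, $i\in I_{\mathrm{ra}}$.** Put $x_{t_i}=\zeta_i^2$, $M_{\zeta_i}=\begin{pmatrix}1&1\\ \zeta_i&-\zeta_i\end{pmatrix}$. A compatible framing $\Phi_i\in GL_2$ is a matrix depending only on $(\boldsymbol t,\boldsymbol\theta)$ such that $\Phi_i^{-1}\widehat\Omega^{(n-2)}\Phi_i$ has leading coefficient $\begin{pmatrix}\theta_{0,t_i}/2&\theta_{1,t_i}/2\\ 0&\theta_{0,t_i}/2\end{pmatrix}$; take it such that there are (unique) functions $\theta_{l',t_i}$ ($l'\ge2n_i-1$) and a (unique) formal series $\Xi_i(x_{t_i})=\mathrm{id}+O(x_{t_i})$ with: (1) the gauge transform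 of $\widehat\Omega^{(n-2)}$ by $\Phi_i\Xi_i$ is $\begin{pmatrix}\alpha_i&\beta_i\\ x_{t_i}\beta_i&\alpha_i-\frac{dx_{t_i}}{2x_{t_i}}\end{pmatrix}$ with $\alpha_i=\sum_{l\ge0}\frac{\theta_{2l,t_i}}2x_{t_i}^{-n_i+l}dx_{t_i}$, $\beta_i=\sum_{l\ge0}\frac{\theta_{2l+1,t_i}}2x_{t_i}^{-n_i+l}dx_{t_i}$; (2) $M_{\zeta_i}^{-1}\Xi_i(\zeta_i^2)M_{\zeta_i}=\begin{pmatrix}1&\zeta_i\xi(\zeta_i)\\ -\zeta_i\xi(-\zeta_i)&1\end{pmatrix}$ for some formal power series $\xi$. Put $\hat\lambda_{i,\pm}(\zeta_i)=\sum_{l'\ge0}(\pm1)^{l'}\theta_{l',t_i}\int\zeta_i^{-2n_i+l'+1}d\zeta_i$ and $\psi_{\zeta_i}=\Phi_i\Xi_i(\zeta_i^2)M_{\zeta_i}\exp(-\mathrm{diag}(\hat\lambda_{i,+},\hat\lambda_{i,-}))$, a formal solution of $(d+\widehat\Omega^{(n-2)}(\zeta_i^2))\psi_{\zeta_i}=0$, where $\widehat\Omega^{(n-2)}(\zeta_i^2)$ is the pull-back under $x_{t_i}=\zeta_i^2$. **Solutions at $q_j$.** $\psi_{q_j}=\begin{pmatrix}1&0\\ p_j&1\end{pmatrix}\Xi_{q_j}(x)\,\mathrm{diag}(1,x-q_j)$, with $\Xi_{q_j}$ a convergent power series in $x-q_j$, $\Xi_{q_j}(q_j)=\mathrm{id}$,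 is a fundamental solution of $(d+\widehat\Omega^{(n-2)})\psi_{q_j}=0$. **The 2-form $\hat\omega$.** A vector field $\hat\delta$ on $\widehat{\mathcal M}_{\boldsymbol t_{\mathrm{ra}}}\times T_{\boldsymbol\theta}$ acts on matrices depending on $x$ and the parameters with $x$ fixed (so $\hat\delta(x_{t_i})=-\hat\delta(t_i)$ for $i\neq\infty$, and $\hat\delta(\zeta_i)=0$ for $i\in I_{\mathrm{ra}}$). Put $\hat\delta(A)\wedge\hat\delta(\psi)\psi^{-1}=\hat\delta_1(A)\hat\delta_2(\psi)\psi^{-1}-\hat\delta_1(\psi)\psi^{-1}\hat\delta_2(A)$ and $$\hat\omega(\hat\delta_1,\hat\delta_2)=\tfrac12\sum_{i\in I\setminus I_{\mathrm{ra}}}\mathrm{res}_{x=t_i}\mathrm{Tr}\big(\hat\delta(\widehat\Omega^{(n-2)})\wedge\hat\delta(\psi_i)\psi_i^{-1}\big)+\tfrac14\sum_{i\in I_{\mathrm{ra}}}\mathrm{res}_{\zeta_i=0}\mathrm{Tr}\big(\hat\delta(\widehat\Omega^{(n-2)}(\zeta_i^2))\wedge\hat\delta(\psi_{\zeta_i})\psi_{\zeta_i}^{-1}\big)+\tfrac12\sum_{j=1}^{n-3}\mathrm{res}_{x=q_j}\mathrm{Tr}\big(\hat\delta(\widehat\Omega^{(n-2)})\wedge\hat\delta(\psi_{q_j})\psi_{q_j}^{-1}\big),$$ which is independent of the choices of solutions. **Vector fields $\delta^{\mathrm{IMD}}_s$.** Let $s$ be one of the coordinates $\theta^\pm_{l,t_i}$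 ($i\in I_{\mathrm{un}}$, $0\le l\le n_i-2$) or $t_i$ ($i\in\{3,\dots,\nu\}\cap(I_{\mathrm{reg}}\cup I_{\mathrm{un}})$), with corresponding index $i$. Put $B_{\theta^+_{l,t_i}}=\frac{x_{t_i}^{-(n_i-l-1)}}{-n_i+l+1}\mathrm{diag}(1,0)$, $B_{\theta^-_{l,t_i}}=\frac{x_{t_i}^{-(n_i-l-1)}}{-n_i+l+1}\mathrm{diag}(0,1)$, $B_{t_i}=-\sum_{l=0}^{n_i-1}\mathrm{diag}(\theta^+_{l,t_i},\theta^-_{l,t_i})(x-t_i)^{-(n_i-l)}$. Let $P_i$ be the truncation, up to and including the $x_{t_i}^{2n_i-1}$-term, of the expansion of $\tilde G^{-1}\Phi_i\Xi_i$ (of $\tilde G_\infty^{-1}\Phi_\infty\Xi_\infty$ if $i=\infty$). Let $\hat U$ be an open neighbourhood of the section $t_i$ in $\mathbb P^1\times(\widehat{\mathcal M}_{\boldsymbol t_{\mathrm{ra}}}\times T_{\boldsymbol\theta})$, not meeting $t_k$, $k\ne i$, on which $P_i$ is invertible, and $V$ the complement of the section $t_i$; $\mathfrak B_s=P_iB_sP_i^{-1}$ is an endomorphism of $E_1$ over $\hat U\cap V$ (in the $U_0$-frame, resp. the $U_\infty$-frame if $i=\infty$). Glue the trivial extensions over $\mathbb C[\epsilon]$ ($\epsilon^2=0$) of $E_1|_{\hat U}$ and $E_1|_V$ by $\mathrm{id}+\epsilon\mathfrak B_s$ (from $\hat U$ to $V$), and equip the result with the relative connection equal to $\widehat\nabla^{(1)}$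 on $V$ and to $\widehat\nabla^{(1)}+\epsilon[\widehat\nabla^{(1)},\mathfrak B_s]$ on $\hat U$. This is a family of connections over $(\widehat{\mathcal M}_{\boldsymbol t_{\mathrm{ra}}}\times T_{\boldsymbol\theta})\times\mathrm{Spec}\,\mathbb C[\epsilon]$ whose singular points and local formal data are those of $\widehat\nabla^{(1)}$ with $s$ replaced by $s+\epsilon$ (all other $t,\theta$ unchanged). As $H^1(\mathbb P^1,\mathcal End(E_1))=0$, the bundle is isomorphic to $E_1\otimes\mathbb C[\epsilon]$ by an isomorphism reducing to the identity mod $\epsilon$, so the connection can be written over $U_0$ as $d+\begin{pmatrix}A&B\\ C&D\end{pmatrix}\frac{dx}{P^\epsilon}$ with $P^\epsilon$ the deformed $P$. Its apparent singularities $q_j^\epsilon$ are the zeros of $B$, and its dual parameters are $p_j^\epsilon=A(q_j^\epsilon)$. Then $\delta^{\mathrm{IMD}}_s$ is the vector field on $\widehat{\mathcal M}_{\boldsymbol t_{\mathrm{ra}}}\times T_{\boldsymbol\theta}$ with $\delta^{\mathrm{IMD}}_s(s)=1$, zero on the other coordinates among $\boldsymbol t,\boldsymbol\theta$, and $q_j^\epsilon=q_j+\epsilon\,\delta_s^{\mathrm{IMD}}(q_j)$, $p_j^\epsilon=p_j+\epsilon\,\delta_s^{\mathrm{IMD}}(p_j)$. *)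

(* Defs.v *)
From HB Require Import structures.
From mathcomp Require Import all_boot all_order all_algebra.
From mathcomp Require Import generic_quotient fraction complex zify.
From mathcomp Require Import boolp classical_sets reals topology normedtype derive.
Set Implicit Arguments.
Unset Strict Implicit.
Unset Printing Implicit Defensive.
Import Order.TTheory GRing.Theory Num.Theory numFieldNormedType.Exports.
Local Open Scope ring_scope.

Section Laurent.
Variable F : fieldType.

Definition vanish_below (N : int) (f : int -> F) := forall k : int, k < N -> f k = 0.

Record laurent := Laurent {
  lcoef :> int -> F;
  lcoef_bounded : exists N, vanish_below N lcoef }.

Lemma laurentP (f g : laurent) : lcoef f =1 lcoef g -> f = g.
Proof.
case: f g => f hf [g hg] /= /funext e; case: _ / e hg => hg.
by rewrite (Prop_irrelevance hf hg).
Qed.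

Definition low (f : laurent) : int := projT1 (cid (lcoef_bounded f)).

Lemma lowP (f : laurent) : vanish_below (low f) f.
Proof. by rewrite /low; case: cid. Qed.

HB.instance Definition _ := gen_eqMixin laurent.
HB.instance Definition _ := gen_choiceMixin laurent.

Lemma lzero_bounded : exists N, vanish_below N (fun _ => 0).
Proof. by exists 0. Qed.
Definition lzero := Laurent lzero_bounded.

Lemma lopp_bounded (f : laurent) : exists N, vanish_below N (fun k => - f k).
Proof. by exists (low f) => k /lowP ->; rewrite oppr0. Qed.
Definition lopp f := Laurent (lopp_bounded f).

Lemma ladd_bounded (f g : laurent) : exists N, vanish_below N (fun k => f k + g k).
Proof.
exists (Num.min (low f) (low g)) => k; rewrite lt_min => /andP[hf hg].
by rewrite (lowP hf) (lowP hg) addr0.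
Qed.
Definition ladd f g := Laurent (ladd_bounded f g).

Lemma laddA : associative ladd.
Proof. by move=> f g h; apply/laurentP => k /=; rewrite addrA. Qed.
Lemma laddC : commutative ladd.
Proof. by move=> f g; apply/laurentP => k /=; rewrite addrC. Qed.
Lemma ladd0 : left_id lzero ladd.
Proof. by move=> f; apply/laurentP => k /=; rewrite add0r. Qed.
Lemma laddN : left_inverse lzero lopp ladd.
Proof. by move=> f; apply/laurentP => k /=; rewrite addNr. Qed.

HB.instance Definition _ :=
  GRing.isZmodule.Build laurent laddA laddC ladd0 laddN.

(* The sum of f_i g_(k - i) over all integers i, restricted to a finite range
   outside which every term vanishes. *)
Definition conv (M : int) (K : nat) (f g : int -> F) (k : int) :=
  \sum_(i < K) f (M + i%:Z) * g (k - M - i%:Z).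

Definition lmul_coef (f g : laurent) (k : int) :=
  conv (low f) ((absz (k - low f - low g)%R)).+1 f g k.

Lemma lmul_bounded (f g : laurent) : exists N, vanish_below N (lmul_coef f g).
Proof.
exists (low f + low g) => k hk; apply: big1 => i _.
by rewrite (@lowP g) ?mulr0 //; lia.
Qed.
Definition lmul f g := Laurent (lmul_bounded f g).

Lemma conv_shift M (e K : nat) f g k : vanish_below M f ->
  conv (M - e%:Z) (e + K) f g k = conv M K f g k.
Proof.
move=> hf; rewrite /conv big_split_ord /= [X in X + _ = _]big1 ?add0r => [|i _].
  by apply: eq_bigr => i _; congr (f _ * g _); lia.
by rewrite hf ?mul0r //; have := ltn_ord i; lia.
Qed.

Lemma conv_widen M N (K K' : nat) f g k : vanish_below N g ->
  k - M - N < K%:Z -> (K <= K')%N -> conv M K f g k = conv M K' f g k.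
Proof.
move=> hg hK /subnKC <-; rewrite /conv big_split_ord /= [X in _ = _ + X]big1 ?addr0 // => i _.
by rewrite hg ?mulr0 //; lia.
Qed.

Lemma lmulE M N (K : nat) (f g : laurent) k : vanish_below M f -> vanish_below N g ->
  k - M - N < K%:Z -> lmul f g k = conv M K f g k.
Proof.
move=> hf hg hK; rewrite /= /lmul_coef.
have hf1 := @lowP f; have hg1 := @lowP g.
move: (low f) hf1 => M1 hf1; set K1 := (_.+1).
pose M0 := Num.min M M1; pose e := (absz (M - M0)%R); pose e1 := (absz (M1 - M0)%R).
pose B := (e + e1 + K + K1 + absz (k - M0 - N)%R + absz (k - M0 - low g)%R)%N.
rewrite -(@conv_shift M e K) // -(@conv_shift M1 e1 K1) //.
have -> : M - e%:Z = M0 by rewrite /e /M0; lia.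
have -> : M1 - e1%:Z = M0 by rewrite /e1 /M0; lia.
have w1 : conv M0 (e + K) f g k = conv M0 B f g k.
  by apply: (@conv_widen _ N) => //; rewrite ?/B ?/e ?/M0; lia.
have w2 : conv M0 (e1 + K1) f g k = conv M0 B f g k.
  by apply: (@conv_widen _ (low g)) => //; rewrite ?/B ?/K1 ?/e1 ?/M0; lia.
by rewrite w1 w2.
Qed.

Definition ltrunc (M : int) (m : nat) (f : int -> F) : {poly F} :=
  \poly_(i < m) f (M + i%:Z).

Lemma lmul_trunc M N (m n : nat) (f g : laurent) :
  vanish_below M f -> vanish_below N g -> (n < m)%N ->
  lmul f g (M + N + n%:Z) = (ltrunc M m f * ltrunc N m g)`_n.
Proof.
move=> hf hg nm; rewrite (@lmulE M N n.+1) //; last lia.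
rewrite coefM; apply: eq_bigr => i _; rewrite !coef_poly.
have hi := ltn_ord i.
have -> : (i < m)%N by lia.
have -> : (n - i < m)%N by lia.
by congr (f _ * g _); lia.
Qed.

Lemma lmul_vanish M N (f g : laurent) : vanish_below M f -> vanish_below N g ->
  vanish_below (M + N) (lmul f g).
Proof.
move=> hf hg k hk; rewrite (@lmulE M N 0) //; last lia.
by rewrite /conv big_ord0.
Qed.

Lemma lmul_eqP N (f g : laurent) : vanish_below N f -> vanish_below N g ->
  (forall n : nat, f (N + n%:Z) = g (N + n%:Z)) -> f = g.
Proof.
move=> hf hg e; apply/laurentP => k.
have [/[dup] /hf -> /hg -> //|hk] := ltP k N.
by have -> : k = N + (absz (k - N)%R)%:Z by lia.
Qed.

Lemma coef_mul_eq (p p' q q' : {poly F}) n :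
  (forall i, (i <= n)%N -> p`_i = p'`_i) -> (forall i, (i <= n)%N -> q`_i = q'`_i) ->
  (p * q)`_n = (p' * q')`_n.
Proof.
move=> hp hq; rewrite !coefM; apply: eq_bigr => i _.
by rewrite hp ?hq ?leq_subr // -ltnS ltn_ord.
Qed.

Lemma lmulC : commutative lmul.
Proof.
move=> f g; apply: (@lmul_eqP (low f + low g)) => [||n].
- by apply: lmul_vanish; apply: lowP.
- by rewrite addrC; apply: lmul_vanish; apply: lowP.
rewrite (@lmul_trunc (low f) (low g) n.+1) //; try exact: lowP.
rewrite [low f + low g]addrC (@lmul_trunc (low g) (low f) n.+1) //; try exact: lowP.
by rewrite mulrC.
Qed.

Lemma ltrunc_mul M N (m i : nat) (f g : laurent) :
  vanish_below M f -> vanish_below N g -> (i < m)%N ->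
  (ltrunc (M + N) m (lmul f g))`_i = (ltrunc M m f * ltrunc N m g)`_i.
Proof. by move=> hf hg im; rewrite coef_poly im (@lmul_trunc _ _ m). Qed.

Lemma lmulA : associative lmul.
Proof.
move=> f g h; have hf := @lowP f; have hg := @lowP g; have hh := @lowP h.
have hfg := lmul_vanish hf hg; have hgh := lmul_vanish hg hh.
apply: (@lmul_eqP (low f + low g + low h)) => [||n].
- by rewrite -addrA; apply: lmul_vanish.
- exact: lmul_vanish.
rewrite -(addrA (low f)).
rewrite [LHS](@lmul_trunc (low f) (low g + low h) n.+1) //.
rewrite addrA [RHS](@lmul_trunc (low f + low g) (low h) n.+1) //.
rewrite (@coef_mul_eq _ (ltrunc (low f) n.+1 f) _ (ltrunc (low g) n.+1 g * ltrunc (low h) n.+1 h)) //; last first.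
  by move=> i hi; rewrite ltrunc_mul.
rewrite mulrA; apply: coef_mul_eq => // i hi.
by rewrite ltrunc_mul.
Qed.

Lemma lmulDl : left_distributive lmul ladd.
Proof.
move=> f g h; pose M := Num.min (low f) (low g).
have hf : vanish_below M f by move=> k; rewrite lt_min => /andP[/lowP].
have hg : vanish_below M g by move=> k; rewrite lt_min => /andP[_ /lowP].
have hfg : vanish_below M (ladd f g) by move=> k hk /=; rewrite hf // hg // addr0.
have hh := @lowP h.
apply/laurentP => k; rewrite [RHS]/=.
pose K := (absz (k - M - low h)%R).+1.
rewrite [LHS](@lmulE M (low h) K) //; last by rewrite /K; lia.
rewrite -![lmul_coef _ _ _]/(lmul _ _ _).
rewrite !(@lmulE M (low h) K) //; try by rewrite /K; lia.
by rewrite /conv -big_split /=; apply: eq_bigr => i _; rewrite mulrDl.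
Qed.

Lemma lmono_bounded (c : F) (d : int) :
  exists N, vanish_below N (fun k => if k == d then c else 0).
Proof. by exists d => k; case: eqP => // ->; rewrite ltxx. Qed.
Definition lmono c d := Laurent (lmono_bounded c d).

Lemma lmul1 : left_id (lmono 1 0) lmul.
Proof.
move=> f; apply/laurentP => k; pose K := (absz (k - low f)%R).+1.
rewrite (@lmulE 0 (low f) K) //; [|by move=> j /= hj; case: eqP hj => // ->|exact: lowP|by rewrite /K; lia].
rewrite /conv big_ord_recl /= !subr0 ?eqxx mul1r big1 ?addr0 // => i _.
by rewrite /= mul0r.
Qed.

Lemma lone_neq0 : lmono 1 0 != lzero.
Proof.
apply/eqP => /(congr1 (fun f : laurent => f 0)) /= /eqP.
by rewrite oner_eq0.
Qed.

HB.instance Definition _ :=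
  GRing.Zmodule_isComNzRing.Build laurent lmulA lmulC lmul1 lmulDl lone_neq0.

Fixpoint inv_seq (a : nat -> F) (n : nat) : seq F :=
  if n is n'.+1 then
    let s := inv_seq a n' in
    rcons s (- (a 0%N)^-1 * \sum_(j < n'.+1) a (n'.+1 - j)%N * s`_j)
  else [:: (a 0%N)^-1].
Definition inv_coef a n := (inv_seq a n)`_n.

Lemma size_inv_seq a n : size (inv_seq a n) = n.+1.
Proof. by elim: n => //= n IH; rewrite size_rcons IH. Qed.

Lemma inv_seq_nth a n i : (i <= n)%N -> (inv_seq a n)`_i = inv_coef a i.
Proof.
elim: n => [|n IH]; first by case: i.
rewrite leq_eqVlt => /orP[/eqP -> //|]; rewrite ltnS => hi.
by rewrite /= nth_rcons size_inv_seq ltnS hi IH.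
Qed.

Lemma inv_coefP a n : a 0%N != 0 ->
  \sum_(j < n.+1) a (n - j)%N * inv_coef a j = (n == 0%N)%:R.
Proof.
move=> a0; case: n => [|n]; first by rewrite big_ord1 /= mulfV.
rewrite big_ord_recr /= subnn {2}/inv_coef /= nth_rcons size_inv_seq ltnn eqxx.
rewrite mulrA mulrN mulfV // mulN1r.
rewrite (eq_bigr (fun j : 'I_n.+1 => a (n.+1 - j)%N * (inv_seq a n)`_j)) ?subrr // => j _.
by rewrite inv_seq_nth // -ltnS.
Qed.

Lemma lval_exists (f : laurent) : f != 0 ->
  exists v : int, vanish_below v f /\ f v != 0.
Proof.
move=> f0; have hf := @lowP f.
have [n hn] : exists n : nat, f (low f + n%:Z) != 0.
  apply: contrapT => h; case/eqP: f0; apply: (@lmul_eqP (low f)) => // n.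
  by apply/eqP/negPn/negP => hn; apply: h; exists n.
have [v hv hmin] := ex_minnP (ex_intro (fun n : nat => f (low f + n%:Z) != 0) n hn).
exists (low f + v%:Z); split=> // k hk; have [/hf //|hk'] := ltP k (low f).
have ek : low f + (absz (k - low f)%R)%:Z = k by lia.
by apply/eqP/negPn/negP => fk; have := hmin (absz (k - low f)%R); rewrite ek => /(_ fk); lia.
Qed.

Lemma linv_bounded (a : nat -> F) (v : int) :
  exists N, vanish_below N (fun k => if k < v then 0 else inv_coef a (absz (k - v)%R)).
Proof. by exists v => k ->. Qed.

Lemma linv_exists (f : laurent) : f != 0 -> exists g : laurent, g * f = 1.
Proof.
move=> /lval_exists[v [hv fv]]; pose a n := f (v + n%:Z).
pose g := Laurent (linv_bounded a (- v)); exists g.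
have hg : vanish_below (- v) g by move=> k /= ->.
apply/laurentP => k; rewrite [LHS](@lmulE (- v) v (absz k).+1) //; last lia.
have [hk|hk] := ltP k 0.
  rewrite /= lt_eqF // /conv big1 // => i _.
  by rewrite [f _]hv ?mulr0 //; lia.
have -> : (1 : laurent) k = (absz k == 0%N)%:R.
  by rewrite /= absz_eq0; case: eqP.
rewrite -(@inv_coefP a); last by rewrite /a addr0.
apply: eq_bigr => i _; rewrite mulrC /=; have hi := ltn_ord i.
have -> : (- v + i%:Z < - v) = false by lia.
by rewrite /a; congr (f _ * inv_coef _ _); lia.
Qed.

Definition linv (f : laurent) : laurent :=
  if pselect (exists g : laurent, g * f = 1) is left h then projT1 (cid h) else 0.

Lemma lmulVf f : f != 0 -> linv f * f = 1.
Proof.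
by move=> /linv_exists h; rewrite /linv; case: pselect => // h'; case: cid.
Qed.
Lemma linv0 : linv 0 = 0.
Proof.
rewrite /linv; case: pselect => // h; suff: False by [].
by case: h => g; rewrite mulr0 => /eqP; rewrite eq_sym oner_eq0.
Qed.

HB.instance Definition _ := GRing.ComNzRing_isField.Build laurent lmulVf linv0.
End Laurent.

Section LaurentOps.
Variable F : fieldType.
Local Notation L := (laurent F).
Local Notation K := {fraction {poly F}}.

(* The Laurent series with coefficients f; the value 0 is used when f is not
   bounded below. *)
Definition lseries (f : int -> F) : L :=
  if pselect (exists N, vanish_below N f) is left h then Laurent h else 0.

Lemma lseriesE (f : int -> F) N : vanish_below N f -> lseries f =1 f.
Proof.
by move=> h k; rewrite /lseries; case: pselect => // -[]; exists N.
Qed.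

Definition lC (c : F) : L := lmono c 0.
Definition lX : L := lmono 1 1.

(* \sum_(l >= 0) a_l X^(N + l) *)
Definition lsum (N : int) (a : nat -> F) : L :=
  lseries (fun k => if N <= k then a (absz (k - N)%R) else 0).

Definition lderiv (f : L) : L := lseries (fun k => f (k + 1) *~ (k + 1)).
Definition lres (f : L) : F := f (-1).
(* The primitive of f - res(f) / X without constant term. *)
Definition lint (f : L) : L :=
  lseries (fun k => if k == 0 then 0 else f (k - 1) / k%:~R).
Definition lupto (N : int) (f : L) : L :=
  lseries (fun k => if k <= N then f k else 0).
(* f(X^2) and f(-X) *)
Definition lsquare (f : L) : L :=
  lseries (fun k => if (2 %| k)%Z then f (k %/ 2)%Z else 0).
Definition lneg (f : L) : L := lseries (fun k => (-1) ^ k * f k).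

Definition regular (f : L) := vanish_below 0 f.
Definition mregular (A : 'M[L]_2) := forall a b, regular (A a b).
Definition mcoef (k : int) (A : 'M[L]_2) : 'M[F]_2 := map_mx (fun f : L => f k) A.
Definition GL2_series (M : 'M[L]_2) := mregular M /\ mcoef 0 M \in unitmx.

(* The Laurent expansion of a rational function f(x) under x = xi. *)
Definition lsubst (xi : L) (f : K) : L :=
  (map_poly lC \n_(repr f)).[xi] / (map_poly lC \d_(repr f)).[xi].

Definition rderiv (f : K) : K :=
  let u := \n_(repr f) in let v := \d_(repr f) in
  (tofrac (u^`() * v - u * v^`())) / (tofrac v) ^+ 2.

(* The coefficient of d(X) in the expansion of the form A dx under x = xi. *)
Definition pullback (xi : L) (A : 'M[K]_2) : 'M[L]_2 :=
  lderiv xi *: map_mx (lsubst xi) A.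

Definition mx2 (T : Type) (a b c d : T) : 'M[T]_2 :=
  \matrix_(i < 2, j < 2)
    (if i == 0 then if j == 0 then a else b else if j == 0 then c else d).

(* M^-1 dM + M^-1 A M *)
Definition gauge (T : fieldType) (D : T -> T) (M A : 'M[T]_2) : 'M[T]_2 :=
  invmx M *m map_mx D M + invmx M *m A *m M.

Definition Gmx (k : nat) : 'M[K]_2 := mx2 1 0 0 (tofrac 'X ^+ k).
End LaurentOps.
Arguments lX {F}.
Arguments Gmx {F}.

Variant skind := Reg | Un | Ra.
Definition is_un k := if k is Un then true else false.
Definition is_ra k := if k is Ra then true else false.

(* Points are indexed by [option 'I_nu]: [Some i] is the finite point numbered
   i + 1 (so that [Some 0] is x = 0 and [Some 1] is x = 1) and [None] is
   infinity.  The exponents theta^+ and theta^- are indexed by [true] and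
   [false].  [tra], [th0] and [thra0] are the fixed t_i (ramified i), the fixed
   theta^+-_(n_i - 1) and the fixed theta_(2 n_i - 2); they are used only at the
   indices to which they apply. *)
Record setting (R : realType) := Setting {
  nu : nat;
  nu_ge2 : (2 <= nu)%N;
  pole : option 'I_nu -> nat;
  kind : option 'I_nu -> skind;
  pole_reg : forall i, kind i = Reg -> pole i = 1%N;
  pole_irr : forall i, kind i <> Reg -> (1 < pole i)%N;
  has_ra : exists i, kind i = Ra;
  tra : 'I_nu -> complex R;
  tra_neq : forall i : 'I_nu, (1 < i)%N -> kind (Some i) = Ra -> tra i <> 0 /\ tra i <> 1;
  tra_inj : forall i j : 'I_nu, (1 < i)%N -> (1 < j)%N ->
    kind (Some i) = Ra -> kind (Some j) = Ra -> tra i = tra j -> i = j;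
  th0 : option 'I_nu -> bool -> complex R;
  thra0 : option 'I_nu -> complex R;
  th0_reg : forall i, kind i = Reg -> forall z : int, th0 i true - th0 i false <> z%:~R;
  fuchs : \sum_(i | ~~ is_ra (kind i)) (th0 i true + th0 i false)
        + \sum_(i | is_ra (kind i)) (thra0 i - 2^-1) = -1 }.

Section Family.
Variables (R : realType) (S : setting R).
Local Notation C := (complex R).
Local Notation L := (laurent C).
Local Notation K := {fraction {poly C}}.
Local Notation I := (option 'I_(nu S)).
Local Notation pole := (@pole R S).
Local Notation kind := (@kind R S).

Definition ntot : nat := \sum_(i : I) pole i.

(* The coordinates of Mhat x T_theta. *)
Definition free_t := {i : 'I_(nu S) | (1 < i)%N && ~~ is_ra (kind (Some i))}.
Definition dim_un (i : I) : nat := if is_un (kind i) then (pole i).-1 else 0.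
Definition dim_ra (i : I) : nat := if is_ra (kind i) then (2 * pole i - 2)%N else 0.
Definition coord : finType :=
  (('I_(ntot - 3) + 'I_(ntot - 3)) + (free_t +
    ({i : I & ('I_(dim_un i) * bool)%type} + {i : I & 'I_(dim_ra i)})))%type.

Definition cq (j : 'I_(ntot - 3)) : coord := inl (inl j).
Definition cp (j : 'I_(ntot - 3)) : coord := inl (inr j).
Definition ct (i : free_t) : coord := inr (inl i).
Definition cth (i : I) (l : 'I_(dim_un i)) (e : bool) : coord :=
  inr (inr (inl (Tagged (fun i => ('I_(dim_un i) * bool)%type) (l, e)))).
Definition cthra (i : I) (l : 'I_(dim_ra i)) : coord :=
  inr (inr (inr (Tagged (fun i => 'I_(dim_ra i)) l))).
Definition is_time (k : coord) : bool := if k is inr _ then true else false.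

Definition pspace : normedModType C := 'rV[C]_#|coord|.
Definition cval (m : pspace) (k : coord) : C := (m : 'rV[C]_#|coord|) ord0 (enum_rank k).

Definition qv (m : pspace) j := cval m (cq j).
Definition pv (m : pspace) j := cval m (cp j).
Definition tv (m : pspace) (i : 'I_(nu S)) : C :=
  if i == 0%N :> nat then 0 else if i == 1%N :> nat then 1
  else if insub i is Some i' then cval m (ct i') else tra i.
Definition thv (m : pspace) (i : I) (e : bool) (l : nat) : C :=
  if insub l is Some l' then cval m (@cth i l' e) else th0 i e.
Definition thrav (m : pspace) (i : I) (l : nat) : C :=
  if insub l is Some l' then cval m (@cthra i l') else thra0 i.

(* The open subset of C^N lying over Mhat x T_theta: the q_j are numbered, i.e.
   this is the etale covering of Mhat x T_theta with group the permutations of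
   the pairs (q_j, p_j). *)
Definition in_dom (m : pspace) : Prop :=
  [/\ injective (tv m), injective (qv m), forall i j, qv m j <> tv m i,
      forall i, kind i = Un -> thv m i true 0 <> thv m i false 0 &
      forall i, kind i = Ra -> thrav m i 1 <> 0].

Definition holomorphic (f : pspace -> C) : Prop :=
  forall m, in_dom m -> differentiable (f : pspace -> C^o) m.
Definition dir (v : pspace) (f : pspace -> C) (m : pspace) : C :=
  'D_v (f : pspace -> C^o) m.

Definition xfin (c : C) : L := lC c + lX.
(* x and x(zeta^2) near t_i as functions of the local coordinates x_(t_i), zeta. *)
Definition xloc (m : pspace) (i : I) : L :=
  if i is Some i' then xfin (tv m i') else lX^-1.
Definition xram (m : pspace) (i : I) : L :=
  if i is Some i' then lC (tv m i') + lX ^+ 2 else (lX ^+ 2)^-1.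

Definition Ppoly (m : pspace) : {poly C} :=
  \prod_(i < nu S) ('X - (tv m i)%:P) ^+ pole (Some i).

Record nf_coeffs := NFCoeffs {
  Cpol : 'I_(nu S) -> {poly C};
  Dpol : 'I_(nu S) -> {poly C};
  Ctil : {poly C};
  Cinf : {poly C};
  Dinf : {poly C} }.

Definition nf_size (a : nf_coeffs) : Prop :=
  [/\ forall i, (size (Cpol a i) <= pole (Some i))%N /\ (size (Dpol a i) <= pole (Some i))%N,
      (size (Ctil a) <= ntot - 3)%N,
      (size (Cinf a) <= pole None)%N &
      (size (Dinf a) <= (pole None).-1)%N].

Definition xsub (c : C) : K := tofrac ('X - c%:P).
Definition c0 (m : pspace) (a : nf_coeffs) : K :=
  \sum_(i < nu S) tofrac (Cpol a i) / xsub (tv m i) ^+ pole (Some i)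
  + \sum_(j < ntot - 3) tofrac (pv m j)%:P / xsub (qv m j)
  + tofrac (Ctil a) + tofrac ('X ^+ (ntot - 3) * Cinf a).
Definition d0 (m : pspace) (a : nf_coeffs) : K :=
  \sum_(i < nu S) tofrac (Dpol a i) / xsub (tv m i) ^+ pole (Some i)
  - \sum_(j < ntot - 3) (xsub (qv m j))^-1
  + tofrac (Dinf a).

(* On U_0; forms A dx are represented by A. *)
Definition Omega (m : pspace) (a : nf_coeffs) : 'M[K]_2 :=
  mx2 0 (tofrac (Ppoly m))^-1 (c0 m a) (d0 m a).

(* The matrix of a connection on E_k in the frame used at t_i, still as a
   coefficient of dx. *)
Definition conn_at (k : nat) (i : I) (A : 'M[K]_2) : 'M[K]_2 :=
  if i is None then gauge (@rderiv C) (Gmx k) A else A.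
Definition Omega_at (m : pspace) (a : nf_coeffs) (i : I) : 'M[K]_2 :=
  conn_at (ntot - 2) i (Omega m a).
Definition Omega_loc (m : pspace) (a : nf_coeffs) (i : I) : 'M[L]_2 :=
  pullback (xloc m i) (Omega_at m a i).

Definition unram_form (lp lm : L) : 'M[L]_2 := mx2 lp 0 0 lm.
Definition ram_form (al be : L) : 'M[L]_2 :=
  mx2 al be (lX * be) (al - lC 2^-1 * lX^-1).

Definition formal_data (m : pspace) (i : I) (A : 'M[L]_2) : Prop :=
  let n := pole i in
  exists2 M, GL2_series M &
  gauge (@lderiv C) M A =
    if is_ra (kind i) then
      ram_form (\sum_(l < n) lC (thrav m i (2 * l) / 2) * lX ^ (l%:Z - n%:Z))
               (\sum_(l < n.-1) lC (thrav m i (2 * l).+1 / 2) * lX ^ (l%:Z - n%:Z))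
    else
      unram_form (\sum_(l < n) lC (thv m i true l) * lX ^ (l%:Z - n%:Z))
                 (\sum_(l < n) lC (thv m i false l) * lX ^ (l%:Z - n%:Z)).

Definition apparent (m : pspace) (j : 'I_(ntot - 3)) (A : 'M[K]_2) : Prop :=
  mregular (gauge (@lderiv C) (mx2 1 0 (lC (pv m j)) lX) (pullback (xfin (qv m j)) A)).

Definition is_normal_form (m : pspace) (a : nf_coeffs) : Prop :=
  [/\ nf_size a, forall j, apparent m j (Omega m a) &
      forall i, formal_data m i (Omega_loc m a i)].

(* The normal form, the framings, the formal solutions and the exponents of
   all orders, as functions on the parameter space. *)
Record solutions := Solutions {
  nf : pspace -> nf_coeffs;
  Phi : I -> pspace -> 'M[C]_2;
  Xi : I -> pspace -> 'M[L]_2;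
  ths : I -> bool -> nat -> pspace -> C;
  thras : I -> nat -> pspace -> C;
  Xiq : 'I_(ntot - 3) -> pspace -> 'M[L]_2 }.

Variable D : solutions.

Definition lmx (M : 'M[C]_2) : 'M[L]_2 := map_mx (@lC C) M.
Definition OmL (i : I) (m : pspace) : 'M[L]_2 := Omega_loc m (nf D m) i.
Definition lamder (i : I) (e : bool) (m : pspace) : L :=
  lsum (- (pole i)%:Z) (fun l => ths D i e l m).
Definition PhiXi (i : I) (m : pspace) : 'M[L]_2 := lmx (Phi D i m) *m Xi D i m.

Definition time_only (f : pspace -> 'M[C]_2) : Prop :=
  forall m m', in_dom m -> in_dom m' ->
  (forall k, is_time k -> cval m k = cval m' k) -> f m = f m'.

Definition framing (i : I) (m : pspace) : Prop :=
  Phi D i m \in unitmx /\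
  mcoef (- (pole i)%:Z) (invmx (lmx (Phi D i m)) *m OmL i m *m lmx (Phi D i m)) =
    if is_ra (kind i) then
      mx2 (thrav m i 0 / 2) (thrav m i 1 / 2) 0 (thrav m i 0 / 2)
    else mx2 (thv m i true 0) 0 0 (thv m i false 0).

(* The last clause is (d + Omega) psi = 0 for psi = Phi Xi exp(- Lambda), where
   Lambda is a primitive of diag(lamder i true, lamder i false). *)
Definition unram_solution (i : I) (m : pspace) : Prop :=
  [/\ forall e l, (l < pole i)%N -> ths D i e l m = thv m i e l,
      forall a, Xi D i m a a = 1,
      forall a b, a != b -> vanish_below 1 (Xi D i m a b) &
      map_mx (@lderiv C) (PhiXi i m) + OmL i m *m PhiXi i m =
        PhiXi i m *m unram_form (lamder i true m) (lamder i false m)].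

Definition Mzeta : 'M[L]_2 := mx2 1 1 lX (- lX).

Definition ram_solution (i : I) (m : pspace) : Prop :=
  let n := pole i in
  [/\ forall l, (l <= 2 * n - 2)%N -> thras D i l m = thrav m i l,
      mregular (Xi D i m) /\ mcoef 0 (Xi D i m) = 1%:M,
      gauge (@lderiv C) (PhiXi i m) (OmL i m) =
        ram_form (lsum (- n%:Z) (fun l => thras D i (2 * l) m / 2))
                 (lsum (- n%:Z) (fun l => thras D i (2 * l).+1 m / 2)) &
      exists2 xi : L, regular xi &
        invmx Mzeta *m map_mx (@lsquare C) (Xi D i m) *m Mzeta =
          mx2 1 (lX * xi) (- lX * lneg xi) 1].

(* d(hat lambda_(i, +-)) / d zeta *)
Definition lamder_ram (i : I) (s : C) (m : pspace) : L :=
  lsum (1 - 2 * (pole i)%:Z) (fun l => s ^+ l * thras D i l m).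

Definition psi_ram (i : I) (m : pspace) : 'M[L]_2 :=
  lmx (Phi D i m) *m map_mx (@lsquare C) (Xi D i m) *m Mzeta.

Definition convergent (f : L) : Prop :=
  regular f /\ exists r M : C, 0 < r /\ forall k : nat, `|f k%:Z| * r ^+ k <= M.

Definition psi_q (j : 'I_(ntot - 3)) (m : pspace) : 'M[L]_2 :=
  mx2 1 0 (lC (pv m j)) 1 *m Xiq D j m *m mx2 1 0 0 lX.
Definition OmL_q (j : 'I_(ntot - 3)) (m : pspace) : 'M[L]_2 :=
  pullback (xfin (qv m j)) (Omega m (nf D m)).

Definition apparent_solution (j : 'I_(ntot - 3)) (m : pspace) : Prop :=
  [/\ forall a b, convergent (Xiq D j m a b),
      mcoef 0 (Xiq D j m) = 1%:M &
      map_mx (@lderiv C) (psi_q j m) + OmL_q j m *m psi_q j m = 0].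

Definition holomorphic_poly (f : pspace -> {poly C}) :=
  forall k, holomorphic (fun m => (f m)`_k).
Definition holomorphic_mx (f : pspace -> 'M[L]_2) :=
  forall a b (k : int), holomorphic (fun m => f m a b k).

Definition holomorphic_nf : Prop :=
  [/\ forall i, holomorphic_poly (fun m => Cpol (nf D m) i)
             /\ holomorphic_poly (fun m => Dpol (nf D m) i),
      holomorphic_poly (fun m => Ctil (nf D m)),
      holomorphic_poly (fun m => Cinf (nf D m)) &
      holomorphic_poly (fun m => Dinf (nf D m))].

Definition holomorphic_solutions : Prop :=
  [/\ forall i a b, holomorphic (fun m => Phi D i m a b),
      forall i, holomorphic_mx (Xi D i),
      forall i e l, ~~ is_ra (kind i) -> holomorphic (ths D i e l),
      forall i l, is_ra (kind i) -> holomorphic (thras D i l) &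
      forall j, holomorphic_mx (Xiq D j)].

Definition admissible : Prop :=
  [/\ holomorphic_nf, holomorphic_solutions, forall i, time_only (Phi D i) &
  forall m, in_dom m ->
    [/\ is_normal_form m (nf D m), forall i, framing i m,
        forall i, ~~ is_ra (kind i) -> unram_solution i m,
        forall i, is_ra (kind i) -> ram_solution i m &
        forall j, apparent_solution j m]].

(* The derivative along v, with x fixed, of a family of Laurent series in
   X = x - c, where c depends on the parameters. *)
Definition ldelta (c : pspace -> C) (v : pspace) (f : pspace -> L) (m : pspace) : L :=
  lseries (fun k => dir v (fun m' => f m' k) m - dir v c m * (f m (k + 1) *~ (k + 1))).
Definition mdelta (c : pspace -> C) (v : pspace) (A : pspace -> 'M[L]_2) (m : pspace)
    : 'M[L]_2 :=
  \matrix_(a, b) ldelta c v (fun m' => A m' a b) m.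
(* The derivative along v of the primitive lint(f) + res(f) log(X) of f(X) dX,
   where res(f) does not depend on the parameters. *)
Definition ldelta_int (c : pspace -> C) (v : pspace) (f : pspace -> L) (m : pspace) : L :=
  ldelta c v (fun m' => lint (f m')) m - lC (dir v c m * lres (f m)) * lX^-1.
(* delta(psi) psi^-1 for psi = A exp(- diag(lp, lm)), where lp and lm are
   primitives of lp' and lm'. *)
Definition dlog (c : pspace -> C) (v : pspace) (A : pspace -> 'M[L]_2)
    (lp' lm' : pspace -> L) (m : pspace) : 'M[L]_2 :=
  (mdelta c v A m - A m *m mx2 (ldelta_int c v lp' m) 0 0 (ldelta_int c v lm' m))
  *m invmx (A m).

Definition res_wedge (c : pspace -> C) (Om psi : pspace -> 'M[L]_2)
    (lp' lm' : pspace -> L) (v1 v2 m : pspace) : C :=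
  lres (\tr (mdelta c v1 Om m *m dlog c v2 psi lp' lm' m
           - dlog c v1 psi lp' lm' m *m mdelta c v2 Om m)).

Definition center (i : I) (m : pspace) : C := if i is Some i' then tv m i' else 0.
Definition OmL_ram (i : I) (m : pspace) : 'M[L]_2 :=
  pullback (xram m i) (Omega_at m (nf D m) i).

Definition omega_hat (v1 v2 m : pspace) : C :=
  2^-1 * (\sum_(i : I | ~~ is_ra (kind i))
     res_wedge (center i) (OmL i) (PhiXi i) (lamder i true) (lamder i false) v1 v2 m)
  + 4^-1 * (\sum_(i : I | is_ra (kind i))
     res_wedge (fun _ => 0) (OmL_ram i) (psi_ram i)
       (lamder_ram i 1) (lamder_ram i (-1)) v1 v2 m)
  + 2^-1 * (\sum_(j < ntot - 3)
     res_wedge (fun m' => qv m' j) (OmL_q j) (psi_q j) (fun _ => 0) (fun _ => 0) v1 v2 m).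

(* An endomorphism of E_1 over an open subset of U_0, in the frame used at t_i. *)
Definition endo_at (i : I) (H : 'M[K]_2) : 'M[K]_2 :=
  if i is None then invmx (Gmx 1) *m H *m Gmx 1 else H.

Definition Gtilde (Q2 : {poly C}) (m : pspace) : 'M[K]_2 :=
  mx2 1 0 (tofrac Q2) (tofrac (\prod_(j < ntot - 3) ('X - (qv m j)%:P))).
Definition Gtilde_at (Q2 : {poly C}) (m : pspace) (i : I) : 'M[K]_2 :=
  if i is None then invmx (Gmx (ntot - 2)) *m Gtilde Q2 m *m Gmx 1 else Gtilde Q2 m.

Definition Pmx (Q2 : {poly C}) (i : I) (m : pspace) : 'M[L]_2 :=
  map_mx (lupto (2 * (pole i)%:Z - 1))
    (invmx (map_mx (lsubst (xloc m i)) (Gtilde_at Q2 m i)) *m PhiXi i m).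

(* The value of the polynomial p0 + eps p1 at a + eps b, with eps^2 = 0. *)
Definition eps_eval (p0 p1 : {poly C}) (a b : C) : C * C :=
  (p0.[a], p0^`().[a] * b + p1.[a]).

(* [B] is the matrix B_s at t_i, [dP] is the derivative of P with respect to s,
   and v is the value at m of the vector field.  The bundle glued by
   id + eps BB is identified with E_1 (x) C[eps] by id + eps H on V and
   id + eps HU on Uhat, where HU = H + BB extends over t_i; the rational
   matrix H describes a section of End(E_1) over the complement of t_i.
   Through this isomorphism the connection on V becomes
   d + Om1 - eps (dH + [Om1, H]); N0 + eps N1 is its product with P + eps dP. *)
Definition is_IMD_at (s : coord) (i : I) (B : 'M[L]_2) (dP : {poly C})
    (m v : pspace) : Prop :=
  (forall k, is_time k -> cval v k = (k == s)%:R) /\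
  exists (Q2 : {poly C}) (H : 'M[K]_2) (N0 N1 : 'M[{poly C}]_2),
  let Om1 := gauge (@rderiv C) (Gtilde Q2 m) (Omega m (nf D m)) in
  let BB := Pmx Q2 i m *m B *m invmx (Pmx Q2 i m) in
  let Om1' := - (map_mx (@rderiv C) H + (Om1 *m H - H *m Om1)) in
  let PF : K := tofrac (Ppoly m) in
  [/\ (size Q2 <= ntot - 3)%N /\ forall j, Q2.[qv m j] = pv m j,
      [/\ forall c : C, (forall i', i = Some i' -> c <> tv m i') ->
            mregular (map_mx (lsubst (xfin c)) H),
          i <> None -> mregular (map_mx (lsubst lX^-1) (endo_at None H)) &
          mregular (map_mx (lsubst (xloc m i)) (endo_at i H) + BB)],
      map_mx (@tofrac {poly C}) N0 = PF *: Om1,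
      map_mx (@tofrac {poly C}) N1 = PF *: Om1' + tofrac dP *: Om1 &
      forall j,
        eps_eval (N0 0 1) (N1 0 1) (qv m j) (qv v j) = (0, 0) /\
        eps_eval (N0 0 0) (N1 0 0) (qv m j) (qv v j) = (pv m j, pv v j)].

Definition B_theta (i : I) (l : nat) (e : bool) : 'M[L]_2 :=
  let b := lC (l%:Z + 1 - (pole i)%:Z)%:~R^-1 * lX ^ (l%:Z + 1 - (pole i)%:Z) in
  if e then mx2 b 0 0 0 else mx2 0 0 0 b.
Definition B_t (i : I) (m : pspace) : 'M[L]_2 :=
  - \sum_(l < pole i) lX ^ (l%:Z - (pole i)%:Z) *:
      mx2 (lC (thv m i true l)) 0 0 (lC (thv m i false l)).

Definition dPpoly (i : 'I_(nu S)) (m : pspace) : {poly C} :=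
  - (('X - (tv m i)%:P) ^+ (pole (Some i)).-1 *+ pole (Some i)
     * \prod_(k < nu S | k != i) ('X - (tv m k)%:P) ^+ pole (Some k)).

Definition is_IMD_theta (i : I) (l : 'I_(dim_un i)) (e : bool)
    (delta : pspace -> pspace) : Prop :=
  forall m, in_dom m -> is_IMD_at (cth l e) i (B_theta i l e) 0 m (delta m).

Definition is_IMD_t (i : free_t) (delta : pspace -> pspace) : Prop :=
  forall m, in_dom m ->
    is_IMD_at (ct i) (Some (val i)) (B_t (Some (val i)) m) (dPpoly (val i) m) m (delta m).
End Family.

(* Main.v *)
(* The local variations W = delta(psi) psi^-1 solve dW + [Omega, W] = - delta Omega.
   For an isomonodromic direction, the cochain H, transported to the normal form
   and corrected by a lower triangular matrix, gives a rational matrix Y meant to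
   solve the same equation.  The defect Delta = delta Omega + dY + [Omega, Y] has
   zero first row; it is regular at the t_i because Y - W is, it keeps the
   apparent singularities q_j, and its order at infinity then forces Delta = 0.
   Integrating by parts, the local terms of omega_hat(delta, delta') become
   multiples of res Tr(Y delta' Omega), where x = zeta^2 doubles the ramified
   residues, so that omega_hat is minus the sum of all residues of this form. *)
Require Import Defs.
From HB Require Import structures.
From mathcomp Require Import all_boot all_order all_algebra.
From mathcomp Require Import generic_quotient fraction complex zify ring.
From mathcomp Require Import boolp classical_sets reals topology normedtype derive.

Set Implicit Arguments.
Unset Strict Implicit.
Unset Printing Implicit Defensive.
Import Order.TTheory GRing.Theory Num.Theory numFieldNormedType.Exports.
Local Open Scope ring_scope.

(** The obstacle is that [id + eps H] lives on E_1 and does not respect the normal form: transported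
    to E_(n-2) it spoils the first row (0, 1/P). A lower row (kappa, mu) restores that row, but its
    order at the singular points, in particular at infinity, is not under direct control. The
    repaired row supplies the control: the entry 1/P has a pole of the full order n_i at every t_i,
    infinity included, so dividing by it bounds kappa and mu, and two trace identities then bound
    the lower row (g, h) of the defect. At q_j the pair does have a pole; the equations defining
    q_j^eps and p_j^eps say that it matches the variation of psi_(q_j). The final count rests on the
    twist n - 2: h dx is holomorphic on the projective line, hence 0, and g is a polynomial of
    degree at most n - 4 vanishing at the n - 3 points q_j. A second obstacle is that delta fixes x
    while the series live in moving coordinates x - t_i or x - q_j. Charts make one rational matrix
    the variation of Omega at all points at once, as the residue theorem requires. The formal
    solutions contain exponentials of Laurent series; only the Laurent factor and the derivative of
    the exponent are ever manipulated. *)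

Local Notation vb := vanish_below.

(** * Laurent series *)

Section LaurentTheory.
Variable F : fieldType.
Local Notation L := (laurent F).
Implicit Types (f g : L) (k M N d : int).

Lemma lcoefD f g k : (f + g) k = f k + g k. Proof. by []. Qed.
Lemma lcoefN f k : (- f) k = - f k. Proof. by []. Qed.
Lemma lcoefB f g k : (f - g) k = f k - g k. Proof. by []. Qed.
Lemma lcoef0 k : (0 : L) k = 0. Proof. by []. Qed.
Lemma lcoef_sum (I : Type) (r : seq I) (P : pred I) (f : I -> L) k :
  (\sum_(i <- r | P i) f i) k = \sum_(i <- r | P i) f i k.
Proof. by elim/big_rec2: _ => //= i x y _ <-. Qed.
Lemma lcoefM M N (K : nat) f g k : vb M f -> vb N g ->
  k - M - N < K%:Z -> (f * g) k = \sum_(i < K) f (M + i%:Z) * g (k - M - i%:Z).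
Proof. by move=> hf hg hK; rewrite [LHS](@lmulE _ M N K). Qed.
Lemma vb_le M N f : N <= M -> vb M f -> vb N f.
Proof. by move=> h hf k hk; apply: hf; lia. Qed.
Lemma vb0 N : vb N (0 : L). Proof. by []. Qed.
Lemma vbD N f g : vb N f -> vb N g -> vb N (f + g).
Proof. by move=> hf hg k hk; rewrite lcoefD hf ?hg ?addr0. Qed.
Lemma vbN N f : vb N f -> vb N (- f).
Proof. by move=> hf k hk; rewrite lcoefN hf ?oppr0. Qed.
Lemma vbB N f g : vb N f -> vb N g -> vb N (f - g).
Proof. by move=> hf hg; apply: vbD => //; apply: vbN. Qed.
Lemma vbM M N f g : vb M f -> vb N g -> vb (M + N) (f * g).
Proof. exact: lmul_vanish. Qed.
Lemma vb_sum N (I : Type) (r : seq I) (P : pred I) (f : I -> L) :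
  (forall i, P i -> vb N (f i)) -> vb N (\sum_(i <- r | P i) f i).
Proof. by move=> h; elim/big_rec: _ => // i x Pi hx; apply: vbD => //; apply: h. Qed.
Lemma reg_mul f g : regular f -> regular g -> regular (f * g).
Proof. by move=> hf hg; apply: vb_le (vbM hf hg); lia. Qed.
Lemma vb_mono (a : F) d : vb d (lmono a d).
Proof. by move=> k hk /=; case: eqP hk => // ->; rewrite ltxx. Qed.
Lemma lmono_coefM (a : F) d f k : (lmono a d * f) k = a * f (k - d).
Proof.
have hf := @lowP _ f.
rewrite (@lcoefM d (low f) (absz (k - d - low f)%R).+1) //; last by lia.
  rewrite big_ord_recl /= addr0 eqxx subr0 big1 ?addr0 // => i _.
  by rewrite (_ : (_ == d) = false) ?mul0r // /bump /=; lia.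
exact: vb_mono.
Qed.
Lemma lmonoM (a b : F) d e : lmono a d * lmono b e = lmono (a * b) (d + e).
Proof.
apply: laurentP => k; rewrite lmono_coefM /=.
by rewrite (_ : (k - d == e) = (k == d + e)) ?(fun_if ( *%R a)) ?mulr0 //; lia.
Qed.
Lemma lC_zmod : zmod_morphism (@lC F).
Proof. by move=> a b; apply: laurentP => k /=; case: eqP => //; rewrite subr0. Qed.
Lemma lC_monoid : monoid_morphism (@lC F).
Proof. by split=> // a b; rewrite /lC lmonoM addr0. Qed.
HB.instance Definition _ := GRing.isZmodMorphism.Build F L (@lC F) lC_zmod.
HB.instance Definition _ := GRing.isMonoidMorphism.Build F L (@lC F) lC_monoid.

Lemma lC_coefM (a : F) f k : (lC a * f) k = a * f k.
Proof. by rewrite lmono_coefM subr0. Qed.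
Lemma lC_coef (a : F) k : lC a k = if k == 0 then a else 0. Proof. by []. Qed.
Lemma reg_lC (a : F) : regular (lC a). Proof. exact: vb_mono. Qed.
Lemma lXn (n : nat) : lX ^+ n = lmono (1 : F) n%:Z.
Proof.
elim: n => [|n IH]; first by rewrite expr0.
by rewrite exprS IH lmonoM mulr1; congr lmono; lia.
Qed.
Lemma lmono_neq0 (a : F) d : a != 0 -> lmono a d != 0.
Proof.
by move=> a0; apply/eqP => /(congr1 (fun f : L => f d)) /= /eqP; rewrite eqxx; apply/negP.
Qed.
Lemma lX_neq0 : (lX : L) != 0. Proof. exact/lmono_neq0/oner_neq0. Qed.
Lemma lmonoV d : (lmono (1 : F) d)^-1 = lmono 1 (- d).
Proof.
have h : lmono (1 : F) d * lmono 1 (- d) = 1 by rewrite lmonoM mulr1 subrr.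
by rewrite -[LHS]mulr1 -h mulKf // lmono_neq0 ?oner_neq0.
Qed.
Lemma lXz d : lX ^ d = lmono (1 : F) d.
Proof. by case: d => n; [exact: lXn | rewrite NegzE -exprnN lXn lmonoV]. Qed.
Lemma lXV : lX^-1 = lmono (1 : F) (- 1). Proof. exact: lmonoV. Qed.
Lemma lXz_coefM d f k : (lX ^ d * f) k = f (k - d).
Proof. by rewrite lXz lmono_coefM mul1r. Qed.
Lemma lX_coefM f k : (lX * f) k = f (k - 1).
Proof. by rewrite lmono_coefM mul1r. Qed.
Lemma lmonoE (a : F) d : lmono a d = lC a * lX ^ d.
Proof. by rewrite lXz lmonoM add0r mulr1. Qed.
(** The valuation as a relation rather than a function: in a family, one fixed [N] can then be
    required near a point, which is what inverting the family needs. *)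
Definition exactly N f := vb N f /\ f N != 0.

Lemma lcoefM_low M N f g : vb M f -> vb N g ->
  (f * g) (M + N) = f M * g N.
Proof.
move=> hf hg; rewrite (@lcoefM M N 1) //; last lia.
by rewrite big_ord1 addr0 subr0; congr (_ * g _); lia.
Qed.
Lemma exactlyM M N f g : exactly M f -> exactly N g -> exactly (M + N) (f * g).
Proof.
move=> [hf f0] [hg g0]; split; first exact: vbM.
by rewrite lcoefM_low // mulf_neq0.
Qed.
Lemma exactly_neq0 N f : exactly N f -> f != 0.
Proof. by move=> [_]; apply: contraNneq => ->. Qed.
Lemma exactly_uniq M N f : exactly M f -> exactly N f -> M = N.
Proof.
move=> [hM M0] [hN N0]; case: (ltgtP M N) => // h.
- by rewrite (hN _ h) eqxx in M0.
- by rewrite (hM _ h) eqxx in N0.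
Qed.
Lemma exactly_mono (a : F) d : a != 0 -> exactly d (lmono a d).
Proof. by move=> a0; split; [exact: vb_mono | rewrite /= eqxx]. Qed.
Lemma exactlyXz d : exactly d (lX ^ d).
Proof. by rewrite lXz; apply/exactly_mono/oner_neq0. Qed.
Lemma exactly1 : exactly 0 (1 : L). Proof. exact/exactly_mono/oner_neq0. Qed.
Lemma exactlyV N f : exactly N f -> exactly (- N) f^-1.
Proof.
move=> hf; have f0 := exactly_neq0 hf.
have [v hv] : exists v, exactly v f^-1 by apply: lval_exists; rewrite invr_eq0.
have := exactlyM hf hv; rewrite divff // => /exactly_uniq /(_ exactly1) h.
by rewrite (_ : - N = v) //; lia.
Qed.
Lemma exactlyXn N f (n : nat) : exactly N f -> exactly (N *+ n) (f ^+ n).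
Proof.
move=> hf; elim: n => [|n IH]; first exact: exactly1.
by rewrite exprS mulrS; apply: exactlyM.
Qed.
Lemma exactly_prod (I : Type) (r : seq I) (P : pred I) (N : I -> int) (f : I -> L) :
  (forall i, P i -> exactly (N i) (f i)) ->
  exactly (\sum_(i <- r | P i) N i) (\prod_(i <- r | P i) f i).
Proof.
move=> h; elim/big_rec2: _ => [|i x y Pi hx]; first exact: exactly1.
by apply: exactlyM => //; apply: h.
Qed.
Lemma vb_cancel M N f g : exactly N f -> vb M (f * g) -> vb (M - N) g.
Proof.
move=> hf hfg; rewrite -(mulKf (exactly_neq0 hf) g) addrC.
by apply: vbM => //; case: (exactlyV hf).
Qed.
Lemma exactlyD_small N f g : exactly N f -> vb (N + 1) g -> exactly N (f + g).
Proof.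
move=> [hf f0] hg; split; first by apply: vbD => //; apply: vb_le hg; lia.
by rewrite lcoefD (hg N) ?addr0 //; lia.
Qed.
Lemma lderivE f k : lderiv f k = f (k + 1) *~ (k + 1).
Proof.
rewrite [LHS](@lseriesE _ _ (low f - 1)) // => j hj.
by rewrite (@lowP _ f) ?mul0rz //; lia.
Qed.
Lemma vb_lderiv N f : vb N f -> vb (N - 1) (lderiv f).
Proof. by move=> hf k hk; rewrite lderivE hf ?mul0rz //; lia. Qed.
Lemma reg_lderiv f : regular f -> regular (lderiv f).
Proof.
move=> hf k hk; rewrite lderivE; have [->|h] := eqVneq k (-1); first by rewrite mulr0z.
by rewrite hf ?mul0rz //; lia.
Qed.
Lemma lderivD f g : lderiv (f + g) = lderiv f + lderiv g.
Proof. by apply: laurentP => k; rewrite lcoefD !lderivE mulrzDl. Qed.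
(** The three products are summed over one window of exponents; in each term the weight [k + 1] is
    the sum of the exponents of the two factors. *)
Lemma lderivM f g : lderiv (f * g) = lderiv f * g + f * lderiv g.
Proof.
have hf := @lowP _ f; have hg := @lowP _ g.
have hf' := vb_lderiv hf; have hg' := vb_lderiv hg.
move: (low f) (low g) hf hg hf' hg' => M N hf hg hf' hg'.
apply: laurentP => k; pose K := (absz (k + 1 - M - N)%R).+1.
have hK : k + 1 - M - N < K%:Z by lia.
rewrite lcoefD lderivE (@lcoefM M N K) // (@lcoefM (M - 1) N K) //; last lia.
rewrite (@lcoefM M (N - 1) K) //; last lia.
rewrite mulrz_suml -big_split /=; apply: eq_bigr => i _.
rewrite !lderivE.
have -> : M - 1 + i%:Z + 1 = M + i%:Z by lia.
have -> : k - (M - 1) - i%:Z = k + 1 - M - i%:Z by lia.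
have -> : k - M - i%:Z + 1 = k + 1 - M - i%:Z by lia.
rewrite mulrzAl mulrzAr -mulrzDr; congr (_ *~ _); lia.
Qed.
Lemma lderivC (a : F) : lderiv (lC a) = 0.
Proof.
apply: laurentP => k; rewrite lderivE lC_coef; case: eqP => [->|_]; last by rewrite mul0rz.
by rewrite mulr0z.
Qed.
Lemma lderivX : lderiv lX = 1 :> L.
Proof.
apply: laurentP => k; rewrite lderivE /=.
have [->|h] := eqVneq k 0; first by rewrite add0r eqxx mulr1z.
by rewrite (_ : (k + 1 == 1) = false) ?mul0rz //; lia.
Qed.
Lemma lres_lderiv f : lres (lderiv f) = 0.
Proof. by rewrite /lres lderivE mulr0z. Qed.
End LaurentTheory.
#[global] Hint Resolve vb0 reg_lC : core.

(** * Two-by-two matrices and covariant derivatives *)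

Section Mx2.
Variable T : fieldType.
Implicit Types A B : 'M[T]_2.

Lemma mx2_00 (a b c d : T) : mx2 a b c d 0 0 = a. Proof. by rewrite mxE. Qed.
Lemma mx2_01 (a b c d : T) : mx2 a b c d 0 1 = b. Proof. by rewrite mxE. Qed.
Lemma mx2_10 (a b c d : T) : mx2 a b c d 1 0 = c. Proof. by rewrite mxE. Qed.
Lemma mx2_11 (a b c d : T) : mx2 a b c d 1 1 = d. Proof. by rewrite mxE. Qed.
Definition mx2E := (mx2_00, mx2_01, mx2_10, mx2_11).

Lemma forall_ord2 (P : 'I_2 -> Prop) : P 0 -> P 1 -> forall i, P i.
Proof.
move=> h0 h1 [[|[|//]] hi]; first by rewrite (_ : Ordinal hi = 0) //; apply: val_inj.
by rewrite (_ : Ordinal hi = 1) //; apply: val_inj.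
Qed.
Lemma mx2P A B : A 0 0 = B 0 0 -> A 0 1 = B 0 1 -> A 1 0 = B 1 0 -> A 1 1 = B 1 1 -> A = B.
Proof.
by move=> h00 h01 h10 h11; apply/matrixP; do 2 (apply: forall_ord2); do 1?exact.
Qed.
Lemma mx2_eta A : A = mx2 (A 0 0) (A 0 1) (A 1 0) (A 1 1).
Proof. by apply: mx2P; rewrite mx2E. Qed.
Lemma mulmx2E A B i j : (A *m B) i j = A i 0 * B 0 j + A i 1 * B 1 j.
Proof. by rewrite mxE big_ord_recl big_ord1; congr (_ + _ * _); congr (_ _ _); apply: val_inj. Qed.
Lemma mx2M (a b c d a' b' c' d' : T) : mx2 a b c d *m mx2 a' b' c' d' =
  mx2 (a * a' + b * c') (a * b' + b * d') (c * a' + d * c') (c * b' + d * d').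
Proof. by apply: mx2P; rewrite mulmx2E !mx2E. Qed.
Lemma mx2D (a b c d a' b' c' d' : T) : mx2 a b c d + mx2 a' b' c' d' =
  mx2 (a + a') (b + b') (c + c') (d + d').
Proof. by apply: mx2P; rewrite mxE !mx2E. Qed.
Lemma mx2N (a b c d : T) : - mx2 a b c d = mx2 (- a) (- b) (- c) (- d).
Proof. by apply: mx2P; rewrite mxE !mx2E. Qed.
Lemma mx2Z (k a b c d : T) : k *: mx2 a b c d = mx2 (k * a) (k * b) (k * c) (k * d).
Proof. by apply: mx2P; rewrite mxE !mx2E. Qed.
Lemma mx2_1 : 1%:M = mx2 1 0 0 1 :> 'M[T]_2.
Proof. by apply: mx2P; rewrite mxE !mx2E. Qed.
Lemma mxtrace2 A : \tr A = A 0 0 + A 1 1.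
Proof. by rewrite /mxtrace big_ord_recl big_ord1; congr (_ + A _ _); apply: val_inj. Qed.
Lemma det2 A : \det A = A 0 0 * A 1 1 - A 0 1 * A 1 0.
Proof.
rewrite (expand_det_row _ 0) big_ord_recl big_ord1 /cofactor !det_mx11 !mxE /=.
rewrite expr0 mul1r expr1 mulN1r mulrN; congr (_ * A _ _ - A _ _ * A _ _); exact: val_inj.
Qed.
Lemma invmx2 (a b c d : T) : a * d - b * c != 0 ->
  invmx (mx2 a b c d) = (a * d - b * c)^-1 *: mx2 d (- b) (- c) a.
Proof.
move=> h; have u : mx2 a b c d \in unitmx by rewrite unitmxE det2 !mx2E unitfE.
apply: (can_inj (mulKmx u)); rewrite mulmxV // -scalemxAr mx2M mx2Z mx2_1.
by congr mx2; field.
Qed.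
Lemma unitmx2 (a b c d : T) : (mx2 a b c d \in unitmx) = (a * d - b * c != 0).
Proof. by rewrite unitmxE det2 !mx2E unitfE. Qed.
End Mx2.
Lemma map_mx2 (T U : fieldType) (f : T -> U) a b c d :
  map_mx f (mx2 a b c d) = mx2 (f a) (f b) (f c) (f d).
Proof. by apply: mx2P; rewrite mxE !mx2E. Qed.
Lemma mx_addE (T : zmodType) m n (A B : 'M[T]_(m, n)) i j : (A + B) i j = A i j + B i j.
Proof. by rewrite mxE. Qed.
Lemma mx_oppE (T : zmodType) m n (A : 'M[T]_(m, n)) i j : (- A) i j = - A i j.
Proof. by rewrite mxE. Qed.
Lemma mx_zeroE (T : zmodType) m n i j : (0 : 'M[T]_(m, n)) i j = 0.
Proof. by rewrite mxE. Qed.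
Ltac mxring := apply/matrixP => ? ?; rewrite ?(mx_addE, mx_oppE, mx_zeroE); ring.

Section MatDer.
Variables (T : fieldType) (D : T -> T).
Hypothesis DD : forall x y, D (x + y) = D x + D y.
Hypothesis DM : forall x y, D (x * y) = D x * y + x * D y.
Local Notation "A ^D" := (map_mx D A) (at level 2, format "A ^D").
Implicit Types A B M X Y Om : 'M[T]_2.

Lemma der0 : D 0 = 0.
Proof. by apply: (addrI (D 0)); rewrite -DD !addr0. Qed.
Lemma der1 : D 1 = 0.
Proof. by apply: (addrI (D 1)); rewrite addr0 -{3}[1]mul1r DM mulr1 mul1r. Qed.
Lemma derN x : D (- x) = - D x.
Proof. by apply/eqP; rewrite -addr_eq0 -DD addNr der0. Qed.
Lemma der_sum (I : Type) (r : seq I) (P : pred I) (f : I -> T) :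
  D (\sum_(i <- r | P i) f i) = \sum_(i <- r | P i) D (f i).
Proof. by rewrite (big_morph D DD der0). Qed.
Lemma derV x : x != 0 -> D x^-1 = - D x / x ^+ 2.
Proof.
move=> h; have := der1; rewrite -(divff h) DM => /eqP; rewrite addrC addr_eq0 => /eqP e.
by apply: (mulfI h); rewrite e; field.
Qed.
Lemma mapD_mul A B : (A *m B)^D = A^D *m B + A *m B^D.
Proof.
apply/matrixP => i j; rewrite !mxE der_sum -big_split /=.
by apply: eq_bigr => k _; rewrite DM !mxE.
Qed.
Lemma mapD_add A B : (A + B)^D = A^D + B^D.
Proof. by apply/matrixP => i j; rewrite !mxE DD. Qed.
Lemma mapD_opp A : (- A)^D = - A^D.
Proof. by apply/matrixP => i j; rewrite !mxE derN. Qed.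
Lemma mapD_1 : (1%:M : 'M[T]_2)^D = 0.
Proof. by apply/matrixP => i j; rewrite !mxE; case: eqP; rewrite ?der0 ?der1. Qed.
Lemma mapD_inv M : M \in unitmx -> (invmx M)^D = - (invmx M *m M^D *m invmx M).
Proof.
move=> u; apply: (can_inj (mulmxK u)); apply/eqP.
rewrite mulNmx mulmxKV // -addr_eq0 -mapD_mul mulVmx //.
exact/eqP/mapD_1.
Qed.
Lemma mapD_tr A : \tr A^D = D (\tr A).
Proof. by rewrite !mxtrace2 !mxE DD. Qed.
(** The connection that d + Om induces on endomorphisms. *)
Definition cov Om X := X^D + (Om *m X - X *m Om).

Lemma covD Om X Y : cov Om (X + Y) = cov Om X + cov Om Y.
Proof. by rewrite /cov mapD_add mulmxDl mulmxDr; mxring. Qed.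
Lemma covN Om X : cov Om (- X) = - cov Om X.
Proof. by rewrite /cov mapD_opp mulNmx mulmxN; mxring. Qed.
Lemma covB Om X Y : cov Om (X - Y) = cov Om X - cov Om Y.
Proof. by rewrite covD covN. Qed.
(** Conjugation by [M] intertwines the induced connections of d + Om and of its gauge transform: the
    terms coming from dM cancel against the commutator with M^-1 dM. *)
Lemma cov_gauge M Om X : M \in unitmx ->
  cov (gauge D M Om) (invmx M *m X *m M) = invmx M *m cov Om X *m M.
Proof.
move=> u; rewrite /cov /gauge !mapD_mul mapD_inv //.
rewrite !(mulmxDl, mulmxDr, mulNmx, mulmxN, mulmxA, mulmxK u, mulmxKV u).
mxring.
Qed.
(** The commutators cancel by cyclicity of the trace. Since the residue of a derivative is zero,
    this becomes integration by parts for residues. *)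
Lemma tr_cov Om X Y : \tr (cov Om X *m Y) + \tr (X *m cov Om Y) = D (\tr (X *m Y)).
Proof.
rewrite -mapD_tr mapD_mul /cov !(mulmxDl, mulmxDr, mulNmx, mulmxN, mulmxA).
rewrite !mxtraceD !(raddfN (@mxtrace T 2)) /= [\tr (X *m Y *m Om)]mxtrace_mulC mulmxA.
by ring.
Qed.
(** [Om] is orthogonal to its commutators for the trace form. For regular [X] the trace thus has no
    worse pole than [Om], whereas the product itself could have a pole of twice the order. *)
Lemma tr_cov_self Om X : \tr (Om *m cov Om X) = \tr (Om *m X^D).
Proof.
rewrite /cov mulmxDr mxtraceD mulmxBr linearB /=.
by rewrite [\tr (Om *m (Om *m X))]mxtrace_mulC -mulmxA subrr addr0.
Qed.
Lemma tr_cov1 Om X : \tr (cov Om X) = D (\tr X).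
Proof.
by rewrite /cov mxtraceD linearB /= [\tr (X *m Om)]mxtrace_mulC subrr addr0 mapD_tr.
Qed.
End MatDer.

(** * Pole orders of matrices and GL_2 of the power series ring *)

Section MatReg.
Variable F : fieldType.
Local Notation L := (laurent F).
Implicit Types A B : 'M[L]_2.

Definition mvb N A := forall a b, vb N (A a b).
Lemma mvb_le M N A : N <= M -> mvb M A -> mvb N A.
Proof. by move=> h hA a b; apply: vb_le (hA a b). Qed.
Lemma mvbD N A B : mvb N A -> mvb N B -> mvb N (A + B).
Proof. by move=> hA hB a b; rewrite mxE; apply: vbD. Qed.
Lemma mvbN N A : mvb N A -> mvb N (- A).
Proof. by move=> hA a b; rewrite mxE; apply: vbN. Qed.
Lemma mvbB N A B : mvb N A -> mvb N B -> mvb N (A - B).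
Proof. by move=> hA hB; apply: mvbD => //; apply: mvbN. Qed.
Lemma mvbM M N A B : mvb M A -> mvb N B -> mvb (M + N) (A *m B).
Proof. by move=> hA hB a b; rewrite mulmx2E; apply: vbD; apply: vbM. Qed.
Lemma mvbZ M N (f : L) A : vb M f -> mvb N A -> mvb (M + N) (f *: A).
Proof. by move=> hf hA a b; rewrite mxE; apply: vbM. Qed.
Lemma mvb2 N (a b c d : L) : vb N a -> vb N b ->
  vb N c -> vb N d -> mvb N (mx2 a b c d).
Proof. by move=> ha hb hc hd; do 2 apply: forall_ord2; rewrite mx2E. Qed.
Lemma mreg_mul A B : mregular A -> mregular B -> mregular (A *m B).
Proof. exact: mvbM. Qed.
Lemma mreg_lderiv A : mregular A -> mregular (map_mx (@lderiv F) A).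
Proof. by move=> hA a b; rewrite mxE; apply: reg_lderiv. Qed.
Lemma mvb_tr N A : mvb N A -> vb N (\tr A).
Proof. by move=> hA; rewrite mxtrace2; apply: vbD. Qed.
Lemma mvb_cov N Om X : mvb N Om -> N <= 0 -> mregular X -> mvb N (cov (@lderiv F) Om X).
Proof.
move=> hO hN hX; apply: mvbD; first by apply: mvb_le hN _; apply: mreg_lderiv.
apply: mvbB; first by rewrite -[N]addr0; apply: mvbM.
by rewrite -[N]add0r; apply: mvbM.
Qed.
(** Membership in GL_2 of the power series ring, phrased so that closure under products and inverses
    needs no determinant. *)
Definition GLreg (M : 'M[L]_2) := [/\ M \in unitmx, mregular M & mregular (invmx M)].

Lemma GLreg_det M : mregular M -> exactly 0 (\det M) -> GLreg M.
Proof.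
move=> hM hd; have u : M \in unitmx by rewrite unitmxE unitfE; apply: exactly_neq0 hd.
split => //; rewrite [M]mx2_eta invmx2; last by rewrite -det2; apply: exactly_neq0 hd.
rewrite -det2; apply: (@mvbZ 0 0); first by case: (exactlyV hd).
by apply: mvb2; try apply: vbN; apply: hM.
Qed.
Lemma GLreg_series M : GL2_series M -> GLreg M.
Proof.
move=> [hM]; rewrite unitmxE det2 !mxE unitfE => h; apply: GLreg_det => //.
split; first by rewrite det2; apply: vbB; apply: reg_mul; apply: hM.
have mul0 f g : regular f -> regular g -> (f * g) 0 = f 0 * g 0.
  by move=> hf hg; rewrite -[0 in LHS](addr0 0) lcoefM_low.
by rewrite det2 lcoefB !mul0 //; apply: hM.
Qed.
Lemma GLreg_inv M : GLreg M -> GLreg (invmx M).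
Proof. by move=> [u h h']; split; rewrite ?unitmx_inv ?invmxK. Qed.
Lemma GLreg_mul A B : GLreg A -> GLreg B -> GLreg (A *m B).
Proof.
move=> [uA hA hA'] [uB hB hB']; have u : A *m B \in unitmx by rewrite unitmx_mul uA.
split=> //; first exact: mreg_mul.
have -> : invmx (A *m B) = invmx B *m invmx A; last exact: mreg_mul.
by apply: (can_inj (mulKmx u)); rewrite mulmxV // mulmxA mulmxK // mulmxV.
Qed.
Lemma GLreg_lmx (M : 'M[F]_2) : M \in unitmx -> GLreg (map_mx (@lC F) M).
Proof.
move=> u; split; first by rewrite map_unitmx.
  by move=> a b; rewrite mxE.
by rewrite -map_invmx => a b; rewrite mxE; apply: reg_lC.
Qed.
Lemma mreg_conj M A : GLreg M -> mregular A -> mregular (M *m A *m invmx M).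
Proof. by move=> [_ h h'] hA; apply: mreg_mul => //; apply: mreg_mul. Qed.
End MatReg.

(** * Expansions of rational functions *)

Lemma frac_repr (R : idomainType) (f : {fraction R}) :
  f = tofrac \n_(repr f) / tofrac \d_(repr f).
Proof.
rewrite -[f in LHS]reprK; set x := repr f.
have d0 : \d_x != 0 by apply: denom_ratioP.
rewrite [_ / _](_ : _ = \pi_(FracField.type R)%qT
  (FracField.mulf (Ratio \n_x 1) (FracField.invf (Ratio \d_x 1)))).
2: by rewrite FracField.pi_mul FracField.pi_inv !piE.
apply/eqmodP => /=; rewrite FracField.equivfE.
by rewrite /FracField.mulf /FracField.invf !numden_Ratio ?oner_neq0 ?mulr1 ?mul1r // mulrC.
Qed.
Lemma fracP (R : idomainType) (f : {fraction R}) :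
  exists u v : R, v != 0 /\ f = tofrac u / tofrac v.
Proof.
exists \n_(repr f), \d_(repr f); split; last exact: frac_repr.
exact: denom_ratioP.
Qed.
(** Algebraic closedness, in the form that places every pole of a fraction at a point of [F]. *)
Definition all_split (F : fieldType) := forall p : {poly F},
  exists s : seq F, p = lead_coef p *: \prod_(z <- s) ('X - z%:P).

Section Subst.
Variable F : fieldType.
Local Notation L := (laurent F).
Local Notation K := {fraction {poly F}}.
Implicit Types (xi f g : L) (u v : K) (p q : {poly F}).

Definition ev xi p : L := (map_poly (@lC F) p).[xi].
Lemma ev_zmod xi : zmod_morphism (ev xi).
Proof. by move=> p q; rewrite /ev rmorphB hornerD hornerN. Qed.
Lemma ev_monoid xi : monoid_morphism (ev xi).
Proof. by split=> [|p q]; rewrite /ev ?rmorph1 ?hornerC // rmorphM hornerM. Qed.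
HB.instance Definition _ xi := GRing.isZmodMorphism.Build {poly F} L (ev xi) (ev_zmod xi).
HB.instance Definition _ xi := GRing.isMonoidMorphism.Build {poly F} L (ev xi) (ev_monoid xi).
Lemma evC xi (c : F) : ev xi c%:P = lC c.
Proof. by rewrite /ev map_polyC hornerC. Qed.
Lemma evX xi : ev xi 'X = xi.
Proof. by rewrite /ev map_polyX hornerX. Qed.
Lemma evZ xi (c : F) p : ev xi (c *: p) = lC c * ev xi p.
Proof. by rewrite -mul_polyC rmorphM /= evC. Qed.

(* Under this condition [lsubst xi] is a ring morphism on all fractions. *)
Definition transc xi := forall p, p != 0 -> ev xi p != 0.
(** After splitting, p(xi) is a nonzero scalar times a product of factors xi - r, so it can vanish
    only if xi is a constant. *)
Lemma transcP xi : all_split F -> (forall r, xi != lC r) -> transc xi.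
Proof.
move=> hF h p p0; have [s ->] := hF p.
rewrite evZ rmorph_prod /= mulf_neq0 //.
  by rewrite fmorph_eq0 lead_coef_eq0.
rewrite prodf_seq_neq0; apply/allP => r _ /=.
by rewrite rmorphB /= evX evC subr_eq0.
Qed.
Lemma lsubst_frac xi p q : transc xi -> q != 0 ->
  lsubst xi (tofrac p / tofrac q) = ev xi p / ev xi q.
Proof.
move=> h q0; rewrite /lsubst; set f := tofrac p / tofrac q.
have d0 : \d_(repr f) != 0 by apply: denom_ratioP.
rewrite -!/(ev _ _); have := frac_repr f; rewrite {1}/f.
set n := \n_ _; move: d0; set d := \d_ _ => d0 /eqP.
rewrite eqr_div ?tofrac_eq0 // -!tofracM tofrac_eq => /eqP e.
by apply/eqP; rewrite eqr_div ?h // -!rmorphM e.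
Qed.
Lemma lsubst_tofrac xi p : transc xi -> lsubst xi (tofrac p) = ev xi p.
Proof.
move=> h; rewrite -[tofrac p]divr1 -tofrac1 lsubst_frac ?oner_neq0 //.
by rewrite rmorph1 divr1.
Qed.
(** [lsubst] is computed on a chosen representative, so its multiplicativity and additivity depend
    on the choice being irrelevant. Exhibiting an equal ring morphism makes the algebra of morphisms
    available. *)
Lemma lsubst_morph xi : transc xi -> {f : {rmorphism K -> L} | lsubst xi = f}.
Proof.
move=> h; have zm : zmod_morphism (lsubst xi).
  move=> x y; have [u [v [v0 ->]]] := fracP x; have [u' [v' [v'0 ->]]] := fracP y.
  rewrite -mulNr addf_div ?tofrac_eq0 // -tofracN -!tofracM -tofracD.
  rewrite !lsubst_frac ?mulf_neq0 // -mulNr addf_div ?h //.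
  by rewrite rmorphD !rmorphM rmorphN.
have mm : monoid_morphism (lsubst xi).
  split; first by rewrite -tofrac1 lsubst_tofrac // rmorph1.
  move=> x y; have [u [v [v0 ->]]] := fracP x; have [u' [v' [v'0 ->]]] := fracP y.
  by rewrite mulf_div -!tofracM !lsubst_frac ?mulf_neq0 // !rmorphM mulf_div.
pose m1 := GRing.isZmodMorphism.Build _ _ (lsubst xi) zm.
pose m2 := GRing.isMonoidMorphism.Build _ _ (lsubst xi) mm.
by exists (HB.pack_for (GRing.RMorphism.type K L) (lsubst xi) m1 m2).
Qed.
Lemma transc_xfin (c : F) : all_split F -> transc (lC c + lX).
Proof.
move=> hF; apply: transcP => // r; apply/eqP => /(congr1 (fun f : L => f 1)) /= /eqP.
by rewrite add0r oner_eq0.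
Qed.
Lemma transc_xfin2 (c : F) : all_split F -> transc (lC c + lX ^+ 2).
Proof.
move=> hF; apply: transcP => // r; apply/eqP; rewrite lXn => /(congr1 (fun f : L => f 2%:Z)) /= /eqP.
by rewrite add0r oner_eq0.
Qed.
Lemma transc_inf : all_split F -> transc lX^-1.
Proof.
move=> hF; apply: transcP => // r; apply/eqP; rewrite lXV => /(congr1 (fun f : L => f (-1))) /= /eqP.
by rewrite oner_eq0.
Qed.
Lemma transc_inf2 : all_split F -> transc (lX ^+ 2)^-1.
Proof.
move=> hF; apply: transcP => // r; apply/eqP; rewrite lXn lmonoV => /(congr1 (fun f : L => f (- 2%:Z))) /= /eqP.
by rewrite oner_eq0.
Qed.
Lemma der_ev (D : L -> L) xi p : (forall f g, D (f + g) = D f + D g) ->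
  (forall f g, D (f * g) = D f * g + f * D g) -> (forall c, D (lC c) = 0) ->
  D (ev xi p) = ev xi p^`() * D xi.
Proof.
move=> DD DM DC; elim/poly_ind: p => [|p c IH].
  by rewrite rmorph0 deriv0 rmorph0 mul0r (der0 DD).
rewrite rmorphD rmorphM /= evX evC DD DM DC addr0 IH derivD derivM derivX derivC addr0.
by rewrite mulr1 rmorphD rmorphM /= evX; ring.
Qed.
Lemma lderiv_ev xi p : lderiv (ev xi p) = ev xi p^`() * lderiv xi.
Proof. by apply: der_ev; [exact: lderivD | exact: lderivM | exact: lderivC]. Qed.
Lemma lderiv_lsubst xi u : transc xi ->
  lderiv (lsubst xi u) = lsubst xi (rderiv u) * lderiv xi.
Proof.
move=> h; rewrite /rderiv; set p := \n_ _; set q := \d_ _.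
have q0 : q != 0 by apply: denom_ratioP.
rewrite -tofracXn lsubst_frac ?expf_neq0 // {1}[u]frac_repr -/p -/q lsubst_frac //.
have e0 := h _ q0.
rewrite lderivM (derV (@lderivM F)) // !lderiv_ev.
by rewrite rmorphB !rmorphM ?rmorphXn /=; field.
Qed.

Hypothesis hF : all_split F.

(** The rule is not visible on chosen numerators and denominators. It is transported from [lderiv]
    by the expansion at x = 0, which is injective and has dx/dX = 1. *)
Lemma rderivD u v : rderiv (u + v) = rderiv u + rderiv v.
Proof.
have h := transc_xfin 0 hF; have [f fE] := lsubst_morph h.
apply: (fmorph_inj f); rewrite rmorphD -fE.
have e (w : K) : lsubst (lC 0 + lX : L) (rderiv w) = lderiv (lsubst (lC 0 + lX) w).
  by rewrite lderiv_lsubst // lderivD lderivC lderivX add0r mulr1.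
by rewrite !e -lderivD; congr lderiv; rewrite fE rmorphD.
Qed.
Lemma rderivM u v : rderiv (u * v) = rderiv u * v + u * rderiv v.
Proof.
have h := transc_xfin 0 hF; have [f fE] := lsubst_morph h.
apply: (fmorph_inj f); rewrite rmorphD (rmorphM f (rderiv u)) (rmorphM f u) /= -fE.
have e (w : K) : lsubst (lC 0 + lX : L) (rderiv w) = lderiv (lsubst (lC 0 + lX) w).
  by rewrite lderiv_lsubst // lderivD lderivC lderivX add0r mulr1.
by rewrite !e -lderivM; congr lderiv; rewrite fE rmorphM.
Qed.
Lemma lsquareE f k : lsquare f k = if (2 %| k)%Z then f (k %/ 2)%Z else 0.
Proof.
rewrite [LHS](@lseriesE _ _ (2 * low f)) // => j hj.
by case: ifP => // h2; rewrite (@lowP _ f) //; lia.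
Qed.
Lemma lsquare_even f k : lsquare f (2 * k) = f k.
Proof. by rewrite lsquareE; case: ifP => h; [congr (f _) | exfalso]; lia. Qed.
Lemma lsquare_odd f k : lsquare f (2 * k + 1) = 0.
Proof. by rewrite lsquareE; case: ifP => h //; exfalso; lia. Qed.
Lemma vb_lsquare N f : vb N f -> vb (2 * N) (lsquare f).
Proof.
by move=> h k hk; rewrite lsquareE; case: ifP => // h2; rewrite h //; lia.
Qed.
(** Only even exponents occur in f(X^2), so a bound that misses by one unit is still enough. This
    spare unit absorbs the division by dx/dzeta = 2 zeta. *)
Lemma vb_lsquareV M N f : 2 * N - 1 <= M -> vb M (lsquare f) -> vb N f.
Proof. by move=> hM h k hk; rewrite -lsquare_even h //; lia. Qed.
Lemma big_double (K' : nat) (G : nat -> F) :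
  \sum_(i < 2 * K') G i = \sum_(i < K') (G (2 * i)%N + G (2 * i).+1).
Proof.
elim: K' => [|n IH]; first by rewrite muln0 !big_ord0.
by rewrite mulnS !add2n 2!big_ord_recr big_ord_recr /= IH addrA.
Qed.
Lemma lsquare_zmod : zmod_morphism (@lsquare F).
Proof. by move=> f g; apply: laurentP => k; rewrite lcoefB !lsquareE; case: ifP; rewrite ?subr0. Qed.
Lemma lsquare_C (c : F) : lsquare (lC c) = lC c.
Proof.
apply: laurentP => k; rewrite lsquareE !lC_coef.
by case: ifP => h; [case: eqP => a; case: eqP => b // | case: eqP => b //]; exfalso; lia.
Qed.
Lemma lsquare_monoid : monoid_morphism (@lsquare F).
Proof.
split=> [|f g]; first exact: lsquare_C.
have hf := @lowP _ f; have hg := @lowP _ g; move: (low f) (low g) hf hg => M N hf hg.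
have hf2 := vb_lsquare hf; have hg2 := vb_lsquare hg.
apply: laurentP => k; pose n := (absz k + absz M + absz N)%N.+1.
rewrite (@lcoefM _ (2 * M) (2 * N) (2 * n)) //; last by lia.
rewrite (big_double n (fun i => lsquare f (2 * M + i%:Z) * lsquare g (k - 2 * M - i%:Z))).
rewrite lsquareE; case: ifP => h.
  rewrite (@lcoefM _ M N n) //; last by lia.
  apply: eq_bigr => i _.
  have -> : 2 * M + (2 * i).+1%:Z = 2 * (M + i%:Z) + 1 by lia.
  rewrite lsquare_odd mul0r addr0.
  have -> : 2 * M + (2 * i)%N%:Z = 2 * (M + i%:Z) by lia.
  have -> : k - 2 * M - (2 * i)%N%:Z = 2 * ((k %/ 2)%Z - M - i%:Z) by lia.
  by rewrite !lsquare_even.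
rewrite big1 // => i _.
have -> : 2 * M + (2 * i).+1%:Z = 2 * (M + i%:Z) + 1 by lia.
rewrite lsquare_odd mul0r addr0.
have -> : k - 2 * M - (2 * i)%N%:Z = 2 * ((k %/ 2)%Z - M - i%:Z) + 1 by lia.
by rewrite lsquare_odd mulr0.
Qed.
HB.instance Definition _ := GRing.isZmodMorphism.Build L L (@lsquare F) lsquare_zmod.
HB.instance Definition _ := GRing.isMonoidMorphism.Build L L (@lsquare F) lsquare_monoid.
Lemma lsquare_X : lsquare (lX : L) = lX ^+ 2.
Proof.
apply: laurentP => k; rewrite lsquareE lXn /=.
by case: ifP => h; [case: eqP => a; case: eqP => b // | case: eqP => b //]; exfalso; lia.
Qed.
Lemma lderiv_lsquare f : lderiv (lsquare f) = lC 2%:R * lX * lsquare (lderiv f).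
Proof.
apply: laurentP => k; rewrite lderivE -mulrA lC_coefM lX_coefM !lsquareE lderivE.
have -> : (2 %| k - 1)%Z = (2 %| k + 1)%Z by lia.
case: ifP => h; last by rewrite mul0rz mulr0.
have -> : ((k - 1) %/ 2)%Z + 1 = ((k + 1) %/ 2)%Z by lia.
by rewrite mulr_natl [RHS]pmulrn -mulrzA; congr (_ *~ _); lia.
Qed.
Lemma lsquare_ev xi p : lsquare (ev xi p) = ev (lsquare xi) p.
Proof.
elim/poly_ind: p => [|p c IH]; first by rewrite !rmorph0.
by rewrite !(rmorphD, rmorphM) /= !evX !evC /= lsquare_C IH.
Qed.
Lemma lsquare_lsubst xi u : lsquare (lsubst xi u) = lsubst (lsquare xi) u.
Proof. by rewrite /lsubst -!/(ev _ _) fmorph_div /= !lsquare_ev. Qed.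
Lemma reg_ev xi p : regular xi -> regular (ev xi p).
Proof.
move=> h; elim/poly_ind: p => [|p c IH]; first by rewrite rmorph0.
by rewrite rmorphD rmorphM /= evX evC; apply: vbD; [apply: reg_mul | apply: reg_lC].
Qed.
Lemma reg_X : regular (lX : L).
Proof. by apply: vb_le (@vb_mono _ _ _); lia. Qed.
Lemma reg_xfin (c : F) : regular (lC c + lX).
Proof. by apply: vbD; [apply: reg_lC | apply: reg_X]. Qed.
Lemma ev_xfin_split (c : F) p :
  exists2 q, p = q * ('X - c%:P) + p.[c]%:P & ev (lC c + lX) p = ev (lC c + lX) q * lX + lC p.[c].
Proof.
have /factor_theorem[q eq] : root (p - p.[c]%:P) c by rewrite /root hornerD hornerN hornerC subrr.
have e : p = q * ('X - c%:P) + p.[c]%:P by rewrite -eq subrK.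
exists q => //; rewrite {1}e rmorphD rmorphM rmorphB /= evX !evC.
by congr (_ * _ + _); ring.
Qed.
Lemma ev_xfin0 (c : F) p : ev (lC c + lX) p 0 = p.[c].
Proof.
have [q _ ->] := ev_xfin_split c p.
by rewrite lcoefD mulrC lX_coefM reg_ev ?add0r //; apply: reg_xfin.
Qed.
Lemma ev_xfin_exact (c : F) p : p.[c] != 0 -> exactly 0 (ev (lC c + lX) p).
Proof. by move=> h; split; [apply/reg_ev/reg_xfin | rewrite ev_xfin0]. Qed.
Lemma ev_xfin_root (c : F) p : p.[c] = 0 -> vb 1 (ev (lC c + lX) p).
Proof.
move=> h k hk; have [->|k0] := eqVneq k 0; first by rewrite ev_xfin0.
by apply/reg_ev; [apply: reg_xfin | lia].
Qed.
Definition reg_at (c : F) u := regular (lsubst (lC c + lX) u).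

(** Induction on the degree of the denominator: regularity at a root of the denominator forces the
    numerator to vanish there, and the common factor cancels. *)
Lemma reg_at_poly u : (forall c, reg_at c u) -> exists p, u = tofrac p.
Proof.
have [p [q [q0 ->]]] := fracP u; move: {2}(size q) (leqnn (size q)) => n.
elim: n p q q0 => [|n IH] p q q0 hn; first by rewrite leqn0 size_poly_eq0 (negPf q0) in hn.
move=> h; have [/size_poly1P[c c0 ->]|hs] := boolP (size q == 1)%N.
  exists (c^-1 *: p); rewrite -mul_polyC tofracM mulrC; congr (_ * _).
  by apply: (mulIf (_ : tofrac c%:P != 0)); rewrite ?tofrac_eq0 ?polyC_eq0 // mulVf
    ?tofrac_eq0 ?polyC_eq0 // -tofracM -polyCM mulVf ?polyC1 ?tofrac1.
have [r hr] : exists r, root q r.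
  have [[|r t] eqs] := hF q; last first.
    by exists r; rewrite eqs big_cons rootZ ?lead_coef_eq0 // rootM root_XsubC eqxx.
  by move: hs; rewrite eqs big_nil -mul_polyC mulr1 size_polyC lead_coef_eq0 q0.
have /factor_theorem[q' eq] := hr.
have hp : p.[r] = 0.
  have := h r; rewrite /reg_at lsubst_frac //; last exact: transc_xfin hF.
  set f := _ / _ => hf; rewrite -ev_xfin0.
  have -> : ev (lC r + lX) p = f * ev (lC r + lX) q.
    by rewrite /f divfK //; apply: (transc_xfin r hF).
  by apply: (@vbM _ 0 1) => //; apply: ev_xfin_root; apply/eqP.
have /factor_theorem[p' ep] : root p r by rewrite /root hp.
have q'0 : q' != 0 by apply: contraNneq q0 => e; rewrite eq e mul0r.
have x0 : 'X - r%:P != 0 by rewrite polyXsubC_eq0.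
have e : tofrac p / tofrac q = tofrac p' / tofrac q'.
  by rewrite ep eq !tofracM -mulf_div divff ?mulr1 // tofrac_eq0.
rewrite e; apply: IH => //; last by move=> c; rewrite -e; apply: h.
by move: hn; rewrite eq size_Mmonic ?monicXsubC // size_XsubC addn2.
Qed.
Lemma ev_inf p k : ev lX^-1 p k = if k <= 0 then p`_(absz k) else 0.
Proof.
have e : ev lX^-1 p = \sum_(i < size p) lC p`_i * lX ^ (- i%:Z).
  rewrite -[p in LHS]coefK poly_def rmorph_sum /=.
  by apply: eq_bigr => i _; rewrite evZ rmorphXn /= evX exprVn exprnN.
rewrite e lcoef_sum (eq_bigr (fun i : 'I_ _ => if i%:Z == - k then p`_i else 0)); last first.
  move=> i _; rewrite lC_coefM lXz /=; case: eqP => a; case: eqP => b; rewrite ?mulr1 ?mulr0 //; exfalso; lia.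
have [hk|hk] := leP k 0; last by apply: big1 => i _; case: eqP => //; lia.
have [hs|hs] := ltnP (absz k) (size p).
  rewrite (bigD1 (Ordinal hs)) //= big1 ?addr0; last first.
    by move=> i /eqP hi; case: eqP => // e'; case: hi; apply: val_inj => /=; lia.
  by case: eqP => // h; exfalso; lia.
rewrite nth_default // big1 // => i _; case: eqP => // h; have := ltn_ord i; lia.
Qed.
Lemma vb_inf_size p N : vb N (ev lX^-1 p) -> (p != 0) -> (size p)%:Z <= 1 - N.
Proof.
move=> h p0; rewrite leNgt; apply/negP => hN.
have := h (- (size p).-1%:Z); rewrite ev_inf.
have s0 : (0 < size p)%N by rewrite size_poly_gt0.
have -> : (- (size p).-1%:Z <= 0) by lia.
have -> : absz (- (size p).-1%:Z)%R = (size p).-1 by lia.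
by move=> /(_ ltac:(lia)) /eqP; rewrite -lead_coefE lead_coef_eq0 (negPf p0).
Qed.
End Subst.

(** * The residue theorem *)

Lemma inv_prod_split (T : fieldType) (x y : T) : x != 0 -> y != 0 ->
  (y - x) * (x * y)^-1 = x^-1 - y^-1.
Proof. by move=> x0 y0; field; rewrite x0 y0. Qed.
Lemma inv_prod_step (T : fieldType) (c d x y z : T) : (x * y)^-1 = d * (x^-1 - y^-1) ->
  c / (z * x) / y = d * (c / (z * x) - c / z / y).
Proof.
move=> h; transitivity (c / z * (x * y)^-1); first by rewrite !invfM; ring.
by rewrite h invfM; ring.
Qed.

Section Residues.
Variable F : fieldType.
Hypothesis hF : all_split F.
Local Notation L := (laurent F).
Local Notation K := {fraction {poly F}}.
Implicit Types (u v : K) (p : {poly F}).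

Definition res_at (c : F) u : F := lres (lsubst (lC c + lX) u).
(** The residue of the form u dx: with x = 1/X the factor [lderiv lX^-1] is dx/dX, which equals 1 at
    finite points and is therefore absent from [res_at]. *)
Definition res_inf u : F := lres (lderiv lX^-1 * lsubst lX^-1 u).

Lemma res_atD c u v : res_at c (u + v) = res_at c u + res_at c v.
Proof.
have [f fE] := lsubst_morph (transc_xfin c hF).
by rewrite /res_at fE rmorphD.
Qed.
Lemma res_infD u v : res_inf (u + v) = res_inf u + res_inf v.
Proof.
have [f fE] := lsubst_morph (transc_inf hF).
by rewrite /res_inf fE rmorphD mulrDr.
Qed.
Lemma res_at_reg c u : reg_at c u -> res_at c u = 0.
Proof. by move=> h; apply: h. Qed.
Lemma lderiv_Xinv : lderiv lX^-1 = - lX ^ (- 2) :> L.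
Proof.
rewrite (derV (@lderivM F)) ?lX_neq0 // lderivX mulN1r; congr (- _).
Qed.
Definition simple_frac (c a : F) (k : nat) : K := tofrac c%:P / tofrac ('X - a%:P) ^+ k.+1.

(** Sums of polynomials and polar parts. [pfracT] shows that every fraction is of this kind, so that
    additive statements such as the residue theorem can be proved by induction. *)
Inductive pfrac : K -> Prop :=
| pfrac_poly p : pfrac (tofrac p)
| pfrac_pole c a k : pfrac (simple_frac c a k)
| pfrac_add u v : pfrac u -> pfrac v -> pfrac (u + v).

Lemma tofracXsubC_neq0 (a : F) : tofrac ('X - a%:P) != 0 :> K.
Proof. by rewrite tofrac_eq0 polyXsubC_eq0. Qed.
Lemma pfrac_scale (c : F) u : pfrac u -> pfrac (tofrac c%:P * u).
Proof.
elim=> [p|c' a k|x y _ hx _ hy].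
- by rewrite -tofracM; apply: pfrac_poly.
- by rewrite /simple_frac mulrA -tofracM -polyCM; apply: pfrac_pole.
- by rewrite mulrDr; apply: pfrac_add.
Qed.
(** For b different from a, the identity 1/((x-b)(x-a)) = (1/(x-b) - 1/(x-a))/(b-a) trades the new
    factor for a pole of lower order at b; the induction on [k] repeats this down to simple
    poles. *)
Lemma pfrac_divX (a : F) u : pfrac u -> pfrac (u / tofrac ('X - a%:P)).
Proof.
have a0 := tofracXsubC_neq0 a.
elim=> [p|c b k|x y _ hx _ hy]; last by rewrite mulrDl; apply: pfrac_add.
  have [q e _] := ev_xfin_split a p.
  rewrite e tofracD tofracM mulrDl mulfK //.
  by apply: pfrac_add; [apply: pfrac_poly | apply: (pfrac_pole _ _ 0)].
have b0 := tofracXsubC_neq0 b.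
have [<-|ab] := eqVneq b a.
  have -> : simple_frac c b k / tofrac ('X - b%:P) = simple_frac c b k.+1.
    by rewrite /simple_frac [in RHS]exprSr invfM mulrA.
  exact: pfrac_pole.
have e1 : (tofrac ('X - b%:P) * tofrac ('X - a%:P))^-1 =
    tofrac ((b - a)^-1)%:P * ((tofrac ('X - b%:P))^-1 - (tofrac ('X - a%:P))^-1) :> K.
  have ba0 : tofrac (b - a)%:P != 0 :> K by rewrite tofrac_eq0 polyC_eq0 subr_eq0.
  apply: (mulfI ba0); rewrite [RHS]mulrA -[in RHS]tofracM -polyCM mulfV ?subr_eq0 // polyC1 tofrac1 mul1r.
  rewrite -(inv_prod_split b0 a0); congr (_ * _).
  by rewrite -tofracB; congr tofrac; rewrite polyCB; ring.
elim: k => [|k IH].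
  rewrite /simple_frac expr1 -mulrA -invfM e1 mulrCA mulrBr.
  apply: pfrac_scale; apply: pfrac_add; first exact: (pfrac_pole c b 0).
  rewrite -mulNr -tofracN -polyCN; exact: (pfrac_pole (- c) a 0).
have -> : simple_frac c b k.+1 / tofrac ('X - a%:P) =
    tofrac ((b - a)^-1)%:P * (simple_frac c b k.+1 - simple_frac c b k / tofrac ('X - a%:P)).
  by rewrite /simple_frac [_ ^+ k.+2]exprSr; apply: inv_prod_step.
apply: pfrac_scale; apply: pfrac_add; first exact: pfrac_pole.
by rewrite -mulN1r -tofrac1 -tofracN -polyCN; apply: pfrac_scale.
Qed.
Lemma pfracT u : pfrac u.
Proof.
have [p [q [q0 ->]]] := fracP u.
have [s ->] := hF q.
rewrite -mul_polyC tofracM invfM mulrA.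
have -> : (tofrac (lead_coef q)%:P)^-1 = tofrac ((lead_coef q)^-1)%:P :> K.
  have l0 : lead_coef q != 0 by rewrite lead_coef_eq0.
  apply: (mulfI (_ : tofrac (lead_coef q)%:P != 0)); first by rewrite tofrac_eq0 polyC_eq0.
  by rewrite mulfV ?tofrac_eq0 ?polyC_eq0 // -tofracM -polyCM mulfV ?polyC1 ?tofrac1.
rewrite -tofracM; move: (p * _) => p'; elim: s => [|r s IH]; first by rewrite big_nil tofrac1 divr1; apply: pfrac_poly.
rewrite big_cons /= [_ * \prod_(_ <- _) _]mulrC tofracM invfM mulrA; by apply: pfrac_divX.
Qed.
Lemma lsubst_simple_frac (xi : L) c a k : transc xi ->
  lsubst xi (simple_frac c a k) = lC c / (xi - lC a) ^+ k.+1.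
Proof.
move=> h; rewrite /simple_frac -tofracXn lsubst_frac ?expf_neq0 ?polyXsubC_eq0 //.
by rewrite rmorphXn rmorphB /= evX !evC.
Qed.
Lemma res_simple_frac c a k (s : seq F) : uniq s -> a \in s ->
  \sum_(b <- s) res_at b (simple_frac c a k) + res_inf (simple_frac c a k) = 0.
Proof.
move=> us sa; rewrite (bigD1_seq a) //= big1_seq ?addr0 => [|b /andP[ba _]]; last first.
  apply: res_at_reg; rewrite /reg_at lsubst_simple_frac; last exact: transc_xfin hF.
  have h : exactly 0 (lC b + lX - lC a : L).
    have -> : lC b + lX - lC a = lC (b - a) + lX :> L by rewrite rmorphB /=; ring.
    by apply: exactlyD_small; [apply: exactly_mono; rewrite subr_eq0 | apply: vb_mono].
  have h2 := exactlyV (exactlyXn k.+1 h); rewrite mul0rn oppr0 in h2.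
  by apply: reg_mul; [apply: reg_lC | case: h2].
have -> : res_at a (simple_frac c a k) = if k == 0%N then c else 0.
  rewrite /res_at lsubst_simple_frac; last exact: transc_xfin hF.
  have -> : lC a + lX - lC a = lX :> L by ring.
  rewrite exprnN lXz /lres lC_coefM /= -[X in _ * X]/(lmono _ _ _) /=.
  by case: k => [|k] /=; rewrite ?mulr1 // ?mulr0.
rewrite /res_inf lsubst_simple_frac; last exact: transc_inf hF.
have e1 : exactly (- 1) (lX^-1 - lC a : L).
  have h : exactly (-1) (lX^-1 : L) by rewrite lXV; apply/exactly_mono/oner_neq0.
  by apply: exactlyD_small => //; apply/vbN/reg_lC.
have [v1 n1] := exactlyV (exactlyXn k.+1 e1).
have hv : vb (- (-1 *+ k.+1)) (lC c / (lX^-1 - lC a) ^+ k.+1 : L).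
  by rewrite -[X in vb X]add0r; apply: vbM => //; apply: reg_lC.
rewrite /lres lderiv_Xinv mulNr lcoefN lXz_coefM.
(* Since dx = - X^-2 dX, the residue is minus the coefficient of X. A simple pole gives cX/(1 - aX),
   with coefficient c, which cancels the residue at [a]; a higher pole vanishes at infinity to order
   at least 2 and contributes nothing. *)
case: k v1 n1 hv => [|k] v1 n1 hv.
  have -> : -1 - -2 = 1 :> int by [].
  rewrite expr1 lC_coefM.
  have -> : (lX^-1 - lC a)^-1 = lX * (1 - lC a * lX)^-1 :> L.
    have x0 := @lX_neq0 F.
    have y0 : (1 - lC a * lX : L) != 0.
      apply: (@exactly_neq0 _ 0); apply: exactlyD_small; first exact: exactly1.
      by apply: vbN; apply: (@vbM _ 0 1); [apply: reg_lC | apply: vb_mono].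
    have -> : lX^-1 - lC a = lX^-1 * (1 - lC a * lX) :> L by field.
    by rewrite invfM invrK.
  rewrite lX_coefM subrr.
  have h : exactly 0 (1 - lC a * lX : L).
    apply: exactlyD_small; first exact: exactly1.
    by apply: vbN; apply: (@vbM _ 0 1); [apply: reg_lC | apply: vb_mono].
  have [h1 h2] := exactlyV h; rewrite oppr0 in h1 h2.
  have /(congr1 (fun f : L => f 0)) : (1 - lC a * lX) * (1 - lC a * lX)^-1 = 1 :> L.
    by rewrite mulfV //; apply: exactly_neq0 h.
  rewrite -[in X in X -> _](addr0 0) lcoefM_low // ?addr0; last by case: h.
  rewrite lcoefB lC_coefM [lX 0]/= mulr0 subr0 => h3.
  by rewrite -[X in - (c * X)]mul1r h3 mulr1 subrr.
by rewrite hv ?oppr0 ?addr0 //; lia.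
Qed.

Theorem residue_theorem u (s : seq F) : uniq s -> (forall c, c \notin s -> reg_at c u) ->
  \sum_(c <- s) res_at c u + res_inf u = 0.
Proof.
move=> us hs.
(* Different summands have different poles, so the induction only claims the formula for every list
   containing some [s0]. Afterwards [s] is enlarged by [s0], and the added points contribute nothing
   by regularity. *)
have [s0 h0] : exists s0 : seq F, forall t, uniq t -> {subset s0 <= t} ->
    \sum_(c <- t) res_at c u + res_inf u = 0.
  elim: (pfracT u) => [p|c a k|x y _ [sx hx] _ [sy hy]].
  - exists [::] => t _ _; rewrite big1 ?add0r => [|c _].
      rewrite /res_inf lsubst_tofrac; last exact: transc_inf hF.
      by rewrite lderiv_Xinv /lres mulNr lcoefN lXz_coefM ev_inf /= oppr0.
    apply: res_at_reg; rewrite /reg_at lsubst_tofrac; last exact: transc_xfin hF.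
    by apply: reg_ev; apply: reg_xfin.
  - by exists [:: a] => t ut ht; apply: res_simple_frac => //; apply: ht; rewrite mem_seq1.
  exists (sx ++ sy) => t ut ht.
  rewrite (eq_bigr _ (fun c _ => res_atD c x y)) big_split res_infD /= addrACA.
  rewrite hx // ?hy ?addr0 // => z hz; apply: ht; rewrite mem_cat hz ?orbT //.
have := h0 (undup (s ++ s0)) (undup_uniq _).
rewrite (bigID (mem s)) /= [X in _ + X + _]big1_seq ?addr0; last first.
  by move=> c /andP[hc _]; apply: res_at_reg; apply: hs.
rewrite -big_filter (perm_big s) => [->//|].
  by move=> z hz; rewrite mem_undup mem_cat hz orbT.
apply: uniq_perm => //; first by rewrite filter_uniq ?undup_uniq.
move=> c; rewrite mem_filter mem_undup mem_cat.
by case: (c \in s).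
Qed.
End Residues.

(** * Families of Laurent series *)

(* Abstracts the germs at [m] and the derivative there along a fixed direction. *)
Record derivation_at (P : Type) (F : fieldType) (m : P) := DerivationAt {
  near_pt : (P -> Prop) -> Prop;
  dble : (P -> F) -> Prop;
  ddir : (P -> F) -> F;
  nearT : forall Q : P -> Prop, (forall p, Q p) -> near_pt Q;
  nearS2 : forall Q1 Q2 Q3 : P -> Prop, (forall p, Q1 p -> Q2 p -> Q3 p) ->
    near_pt Q1 -> near_pt Q2 -> near_pt Q3;
  near_at : forall Q, near_pt Q -> Q m;
  dble_near : forall a b, near_pt (fun p => a p = b p) -> dble a -> dble b;
  dir_near : forall a b, near_pt (fun p => a p = b p) -> ddir a = ddir b;
  dble_cst : forall k, dble (fun _ => k);
  dir_cst : forall k, ddir (fun _ => k) = 0;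
  dbleD : forall a b, dble a -> dble b -> dble (fun p => a p + b p);
  dirD : forall a b, dble a -> dble b -> ddir (fun p => a p + b p) = ddir a + ddir b;
  dbleM : forall a b, dble a -> dble b -> dble (fun p => a p * b p);
  dirM : forall a b, dble a -> dble b ->
    ddir (fun p => a p * b p) = ddir a * b m + a m * ddir b;
  dbleV : forall a, a m != 0 -> dble a -> dble (fun p => (a p)^-1) }.

(** The chain rule at fixed x for series in X = x - c: [dc] is the derivative of c, hence delta(X) =
    - dc. *)
Definition ldelta_at (P : Type) (F : fieldType) (m : P) (D : derivation_at F m) (dc : F)
    (f : P -> laurent F) : laurent F :=
  lseries (fun k => ddir D (fun p => f p k) - dc * (f m (k + 1) *~ (k + 1))).

Section Directional.
Variables (P : Type) (F : fieldType) (m : P) (D : derivation_at F m).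
Local Notation L := (laurent F).
Local Notation near := (near_pt D).
Local Notation dble := (dble D).
Local Notation ddir := (ddir D).
Local Notation ldelta := (ldelta_at D).
Implicit Types (a b : P -> F) (f g : P -> L) (c : F).

Lemma nearS (Q1 Q2 : P -> Prop) : (forall p, Q1 p -> Q2 p) -> near Q1 -> near Q2.
Proof. by move=> h h1; apply: (nearS2 _ h1 h1) => p q _; apply: h. Qed.
Lemma near_all (I : finType) (Q : I -> P -> Prop) : (forall i, near (Q i)) ->
  near (fun p => forall i, Q i p).
Proof.
move=> h; suff H : near (fun p => forall i, i \in enum I -> Q i p).
  by apply: (nearS _ H) => p hp i; apply: hp; rewrite mem_enum.
elim: (enum I) => [|i r IH]; first exact: nearT.
apply: (nearS2 _ (h i) IH) => p h1 h2 j; rewrite inE => /orP[/eqP -> //|].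
exact: h2.
Qed.
Lemma dbleN a : dble a -> dble (fun p => - a p).
Proof.
move=> ha; apply: (@dble_near _ _ _ _ (fun p => -1 * a p)).
  by apply: nearT => p; rewrite mulN1r.
by apply: dbleM => //; apply: dble_cst.
Qed.
Lemma dirN a : dble a -> ddir (fun p => - a p) = - ddir a.
Proof.
move=> ha; rewrite (@dir_near _ _ _ _ _ (fun p => -1 * a p)); last first.
  by apply: nearT => p; rewrite mulN1r.
by rewrite (dirM (dble_cst _ _) ha) dir_cst mul0r add0r mulN1r.
Qed.
Lemma dble_sum (I : Type) (r : seq I) (G : I -> P -> F) :
  (forall i, dble (G i)) -> dble (fun p => \sum_(i <- r) G i p).
Proof.
move=> h; elim: r => [|i r IH].
  by apply: (@dble_near _ _ _ _ (fun _ => 0)); [apply: nearT => p; rewrite big_nil | apply: dble_cst].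
apply: (@dble_near _ _ _ _ (fun p => G i p + \sum_(j <- r) G j p)); last exact: (dbleD (h i) IH).
by apply: nearT => p; rewrite big_cons.
Qed.
Lemma dir_sum (I : Type) (r : seq I) (G : I -> P -> F) :
  (forall i, dble (G i)) ->
  ddir (fun p => \sum_(i <- r) G i p) = \sum_(i <- r) ddir (G i).
Proof.
move=> h; elim: r => [|i r IH].
  rewrite big_nil (@dir_near _ _ _ _ _ (fun _ => 0)) ?dir_cst //.
  by apply: nearT => p; rewrite big_nil.
rewrite big_cons -IH -(dirD (h i) (dble_sum r h)).
by apply: dir_near; apply: nearT => p; rewrite big_cons.
Qed.

(** The pole bound has to be uniform near [m]: a coefficient of a product is then one fixed finite
    sum near [m] and may be differentiated term by term. *)
Variant good f : Prop := Good (_ : exists N, near (fun p => vb N (f p)))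
  (_ : forall k, dble (fun p => f p k)).
Lemma good_dble f k : good f -> dble (fun p => f p k).
Proof. by case. Qed.
Lemma good_at f : good f -> exists N, (near (fun p => vb N (f p))) /\ vb N (f m).
Proof. by move=> [[N hN] _]; exists N; split=> //; apply: near_at hN. Qed.
Lemma good_near f g : near (fun p => f p = g p) -> good f -> good g.
Proof.
move=> e [[N hN] hf]; split; first by exists N; apply: (nearS2 _ e hN) => p ->.
by move=> k; apply: dble_near (hf k); apply: (nearS _ e) => p ->.
Qed.
Lemma good_cst (h : L) : good (fun _ => h).
Proof.
split; last by move=> k; apply: dble_cst.
by exists (low h); apply: nearT => _; apply: lowP.
Qed.
Lemma goodD f g : good f -> good g -> good (fun p => f p + g p).
Proof.
move=> [[M hM] hf] [[N hN] hg]; split; last by move=> k; apply: dbleD.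
exists (Num.min M N); apply: (nearS2 _ hM hN) => p h1 h2.
by apply: vbD; [apply: vb_le h1 | apply: vb_le h2]; lia.
Qed.
Lemma goodN f : good f -> good (fun p => - f p).
Proof.
move=> [[M hM] hf]; split; last by move=> k; apply: dbleN.
by exists M; apply: (nearS _ hM) => p h1; apply: vbN.
Qed.
Lemma goodB f g : good f -> good g -> good (fun p => f p - g p).
Proof. by move=> hf hg; apply: goodD => //; apply: goodN. Qed.
Lemma near_coefM f g M N k : near (fun p => vb M (f p)) ->
  near (fun p => vb N (g p)) -> near (fun p =>
  (f p * g p) k = \sum_(i < (absz (k - M - N)%R).+1) f p (M + i%:Z) * g p (k - M - i%:Z)).
Proof.
move=> hf hg; apply: (nearS2 _ hf hg) => p h1 h2.
by rewrite (@lcoefM _ M N (absz (k - M - N)%R).+1) //; lia.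
Qed.
Lemma goodM f g : good f -> good g -> good (fun p => f p * g p).
Proof.
move=> [[M hM] hf] [[N hN] hg]; split.
  by exists (M + N); apply: (nearS2 _ hM hN) => p; apply: vbM.
move=> k; apply: (@dble_near _ _ _ _ (fun p => \sum_(i < (absz (k - M - N)%R).+1)
  f p (M + i%:Z) * g p (k - M - i%:Z))).
  by apply: (nearS _ (near_coefM k hM hN)) => p ->.
by apply: dble_sum => i; apply: dbleM.
Qed.
Lemma good_lC a : dble a -> good (fun p => lC (a p)).
Proof.
move=> ha; split; first by exists 0; apply: nearT => p; apply: reg_lC.
move=> k; case: (eqVneq k 0) => hk; last first.
  apply: (@dble_near _ _ _ _ (fun _ => 0)); last exact: dble_cst.
  by apply: nearT => p; rewrite lC_coef (negPf hk).
by apply: dble_near ha; apply: nearT => p; rewrite lC_coef hk.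
Qed.
Lemma goodXn f n : good f -> good (fun p => f p ^+ n).
Proof.
move=> hf; elim: n => [|n IH]; first exact: good_cst.
apply: (@good_near (fun p => f p * f p ^+ n)); last exact: goodM.
by apply: nearT => p; rewrite exprS.
Qed.
Lemma good_sum (I : Type) (r : seq I) (G : I -> P -> L) :
  (forall i, good (G i)) -> good (fun p => \sum_(i <- r) G i p).
Proof.
move=> h; elim: r => [|i r IH].
  by apply: (@good_near (fun _ => 0)); [apply: nearT => p; rewrite big_nil | apply: good_cst].
apply: (@good_near (fun p => G i p + \sum_(j <- r) G j p)); last exact: goodD.
by apply: nearT => p; rewrite big_cons.
Qed.
Lemma dble_mulz a (z : int) : dble a -> dble (fun p => a p *~ z).
Proof.
move=> ha; apply: (@dble_near _ _ _ _ (fun p => z%:~R * a p)).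
  by apply: nearT => p; rewrite mulrzl.
by apply: dbleM => //; apply: dble_cst.
Qed.
Lemma dir_mulz a (z : int) : dble a -> ddir (fun p => a p *~ z) = ddir a *~ z.
Proof.
move=> ha; rewrite (@dir_near _ _ _ _ _ (fun p => z%:~R * a p)).
  by rewrite dirM ?dir_cst ?mul0r ?add0r ?mulrzl //; apply: dble_cst.
by apply: nearT => p; rewrite mulrzl.
Qed.
Lemma good_lderiv f : good f -> good (fun p => lderiv (f p)).
Proof.
move=> [[N hN] hf]; split; first by exists (N - 1); apply: (nearS _ hN) => p; apply: vb_lderiv.
move=> k; apply: (@dble_near _ _ _ _ (fun p => f p (k + 1) *~ (k + 1))); last exact: dble_mulz.
by apply: nearT => p; rewrite lderivE.
Qed.
Lemma good_lsquare f : good f -> good (fun p => lsquare (f p)).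
Proof.
move=> [[N hN] hf]; split; first by exists (2 * N); apply: (nearS _ hN) => p; apply: vb_lsquare.
move=> k; apply: (@dble_near _ _ _ _ (fun p => if (2 %| k)%Z then f p (k %/ 2)%Z else 0)).
  by apply: nearT => p; rewrite lsquareE.
by case: (2 %| k)%Z => //; apply: dble_cst.
Qed.
Lemma ldeltaE c f k : good f -> ldelta c f k =
  ddir (fun p => f p k) - c * (f m (k + 1) *~ (k + 1)).
Proof.
move=> /good_at[N [hN hm]]; rewrite [LHS](@lseriesE _ _ (N - 1)) // => j hj.
rewrite (hm (j + 1)) ?mul0rz ?mulr0 ?subr0; last lia.
rewrite (@dir_near _ _ _ _ _ (fun _ => 0)) ?dir_cst //.
by apply: (nearS _ hN) => p h; apply: h; lia.
Qed.
Lemma vb_ldelta_fixed N c f : good f -> near (fun p => vb N (f p)) ->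
  c = 0 -> vb N (ldelta c f).
Proof.
move=> gf hN c0 k hk; rewrite ldeltaE // c0 mul0r subr0.
rewrite (@dir_near _ _ _ _ _ (fun _ => 0)) ?dir_cst //.
by apply: (nearS _ hN) => p h; apply: h.
Qed.
(** A moving center lowers exponents by one, but the only coefficient that could become polar, at
    X^-1, carries the weight k + 1 = 0. *)
Lemma reg_ldelta c f : good f -> near (fun p => regular (f p)) ->
  regular (ldelta c f).
Proof.
move=> gf hN k hk; have hm := near_at hN; rewrite ldeltaE //.
rewrite (@dir_near _ _ _ _ _ (fun _ => 0)) ?dir_cst //; last first.
  by apply: (nearS _ hN) => p h; apply: h.
have [->|k1] := eqVneq k (-1); first by rewrite mulr0z mulr0 subr0.
by rewrite hm ?mul0rz ?mulr0 ?subr0 //; lia.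
Qed.
Lemma ldelta_near c f g : good f -> near (fun p => f p = g p) ->
  ldelta c f = ldelta c g.
Proof.
move=> gf e; apply: laurentP => k; rewrite !ldeltaE //; last exact: good_near gf.
have -> : f m = g m := near_at e.
have -> // : ddir (fun p => f p k) = ddir (fun p => g p k).
by apply: dir_near; apply: (nearS _ e) => p ->.
Qed.
Lemma ldelta_cst c (h : L) : ldelta c (fun _ => h) = - (lC c * lderiv h).
Proof.
apply: laurentP => k; rewrite ldeltaE; last exact: good_cst.
by rewrite dir_cst sub0r lcoefN lC_coefM lderivE.
Qed.
Lemma ldelta_lC c a : dble a -> ldelta c (fun p => lC (a p)) = lC (ddir a).
Proof.
move=> ha; apply: laurentP => k; rewrite ldeltaE; last exact: good_lC.
have -> : lC (a m) (k + 1) *~ (k + 1) = 0.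
  by rewrite lC_coef; case: eqP => [->|]; rewrite ?mulr0z ?mul0rz.
rewrite mulr0 subr0; case: (eqVneq k 0) => hk; last first.
  rewrite lC_coef (negPf hk) (@dir_near _ _ _ _ _ (fun _ => 0)) ?dir_cst //.
  by apply: nearT => p; rewrite lC_coef (negPf hk).
by rewrite lC_coef hk /= (@dir_near _ _ _ _ _ a) //; apply: nearT => p; rewrite ?lC_coef.
Qed.
Lemma ldeltaD c f g : good f -> good g ->
  ldelta c (fun p => f p + g p) = ldelta c f + ldelta c g.
Proof.
move=> gf gg; apply: laurentP => k; rewrite lcoefD !ldeltaE //; last exact: goodD.
have -> : ddir (fun p => (f p + g p) k) = _ := dirD (good_dble k gf) (good_dble k gg).
by rewrite lcoefD mulrzDl mulrDr opprD addrACA.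
Qed.
Lemma ldeltaN c f : good f -> ldelta c (fun p => - f p) = - ldelta c f.
Proof.
move=> gf; apply: laurentP => k; rewrite lcoefN !ldeltaE //; last exact: goodN.
have -> : ddir (fun p => (- f p) k) = _ := dirN (good_dble k gf).
by rewrite lcoefN mulNrz mulrN opprD opprK.
Qed.
Lemma ldeltaB c f g : good f -> good g ->
  ldelta c (fun p => f p - g p) = ldelta c f - ldelta c g.
Proof. by move=> gf gg; rewrite ldeltaD ?ldeltaN //; apply: goodN. Qed.
Lemma ldelta_split c f : good f ->
  ldelta c f = ldelta 0 f - lC c * lderiv (f m).
Proof.
move=> gf; apply: laurentP => k.
by rewrite lcoefB lC_coefM lderivE !ldeltaE // mul0r subr0.
Qed.
Lemma ldelta0E f k : good f -> ldelta 0 f k = ddir (fun p => f p k).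
Proof. by move=> gf; rewrite ldeltaE // mul0r subr0. Qed.
(** The operation is split into differentiation of the coefficients and a multiple of d/dX. The
    second part obeys Leibniz by [lderivM], the first by differentiating the finite sum for each
    coefficient. *)
Lemma ldeltaM c f g : good f -> good g ->
  ldelta c (fun p => f p * g p) = ldelta c f * g m + f m * ldelta c g.
Proof.
move=> gf gg; have gfg := goodM gf gg; rewrite (ldelta_split c gfg) (ldelta_split c gf) (ldelta_split c gg) lderivM.
set df := ldelta 0 f; set dg := ldelta 0 g; set d := ldelta 0 _.
suff -> : d = df * g m + f m * dg.
  by rewrite !mulrBl !mulrBr mulrDr opprD addrACA mulrA [lC _ * (f m * _)]mulrCA.
have [M [hM hfM]] := good_at gf; have [N [hN hgN]] := good_at gg.
have vf : vb M df by apply: vb_ldelta_fixed.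
have vg : vb N dg by apply: vb_ldelta_fixed.
apply: laurentP => k; rewrite lcoefD /d ldelta0E // (dir_near (near_coefM k hM hN)).
have hK : k - M - N < (absz (k - M - N)%R).+1%:Z by lia.
rewrite (lcoefM vf hgN hK) (lcoefM hfM vg hK) -big_split dir_sum /=; last first.
  by move=> i; apply: dbleM; [exact: good_dble | exact: good_dble].
apply: eq_bigr => i _; rewrite dirM; [|exact: good_dble | exact: good_dble].
by rewrite !ldelta0E.
Qed.
Lemma ldelta_lderiv c f : good f ->
  ldelta c (fun p => lderiv (f p)) = lderiv (ldelta c f).
Proof.
move=> gf; apply: laurentP => k; rewrite [RHS]lderivE (ldeltaE c _ gf).
rewrite (ldeltaE c k (good_lderiv gf)) lderivE mulrzBl mulrzAr; congr (_ - _).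
rewrite -dir_mulz; last exact: good_dble.
by apply: dir_near; apply: nearT => p; rewrite lderivE.
Qed.
Lemma ldelta_Xn c f n : good f -> ldelta c (fun p => f p ^+ n) =
  n%:R * f m ^+ n.-1 * ldelta c f.
Proof.
move=> gf; elim: n => [|n IH].
  by rewrite !mul0r ldelta_cst lderivC mulr0 oppr0.
rewrite (@ldelta_near _ _ (fun p => f p * f p ^+ n)); last first.
- by apply: nearT => p; rewrite exprS.
- exact: goodXn.
rewrite ldeltaM ?IH //; last exact: goodXn.
move: (ldelta c f) (f m) => d x; case: n {IH} => [|n] /=.
  by rewrite expr0 !mulr1 mulr0n !mul0r mulr0 addr0 mulr1n mul1r.
by rewrite [in RHS]mulrSr !exprS; ring.
Qed.

(** Locally constant valuation: without it the inverse of a good family could acquire a jump in its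
    pole order. *)
Variant ugood f : Prop := UGood (_ : good f) (_ : exists N, near (fun p => exactly N (f p))).

Lemma ugood_near f g : near (fun p => f p = g p) -> ugood f -> ugood g.
Proof.
move=> e [gf [N hN]]; split; first exact: good_near gf.
by exists N; apply: (nearS2 _ e hN) => p ->.
Qed.
Lemma ugood_neq0 f : ugood f -> near (fun p => f p != 0).
Proof. by move=> [_ [N hN]]; apply: (nearS _ hN) => p; apply: exactly_neq0. Qed.
Lemma ugood_cst (h : L) : h != 0 -> ugood (fun _ => h).
Proof.
move=> /lval_exists[N hN]; split; first exact: good_cst.
by exists N; apply: nearT.
Qed.
Lemma ugoodM f g : ugood f -> ugood g -> ugood (fun p => f p * g p).
Proof.
move=> [gf [M hM]] [gg [N hN]]; split; first exact: goodM.
by exists (M + N); apply: (nearS2 _ hM hN) => p; apply: exactlyM.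
Qed.
Lemma ugoodXn f n : ugood f -> ugood (fun p => f p ^+ n).
Proof.
move=> [gf [M hM]]; split; first exact: goodXn.
by exists (M *+ n); apply: (nearS _ hM) => p; apply: exactlyXn.
Qed.
Lemma ugood_prod (I : Type) (r : seq I) (G : I -> P -> L) :
  (forall i, ugood (G i)) -> ugood (fun p => \prod_(i <- r) G i p).
Proof.
move=> h; elim: r => [|i r IH].
  apply: (@ugood_near (fun _ => 1)); first by apply: nearT => p; rewrite big_nil.
  exact/ugood_cst/oner_neq0.
apply: (@ugood_near (fun p => G i p * \prod_(j <- r) G j p)); last exact: ugoodM.
by apply: nearT => p; rewrite big_cons.
Qed.
(** Strong induction on the coefficient: each one is the inverse of the leading coefficient of [f]
    times a polynomial expression in the earlier ones and the coefficients of [f]. *)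
Lemma goodV f : ugood f -> good (fun p => (f p)^-1).
Proof.
move=> [gf [N hN]]; have hV : near (fun p => vb (- N) (f p)^-1).
  by apply: (nearS _ hN) => p /exactlyV[].
split; first by exists (- N).
suff h (n : nat) : dble (fun p => (f p)^-1 (- N + n%:Z)).
  move=> k; have [hk|hk] := ltP k (- N).
    apply: (@dble_near _ _ _ _ (fun _ => 0)); last exact: dble_cst.
    by apply: (nearS _ hV) => p hp; rewrite hp.
  by have := h (absz (k + N)); have -> : - N + absz (k + N)%R = k by lia.
elim/ltn_ind: n => n IH.
apply: (@dble_near _ _ _ _ (fun p => (f p N)^-1 * ((n == 0%N)%:R -
   \sum_(i < n) (f p)^-1 (- N + i%:Z) * f p (N + n%:Z - i%:Z)))).
  apply: (nearS _ hN) => p hp; have [v1 n1] := hp; have [v2 _] := exactlyV hp.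
  have /(congr1 (fun g : L => g n%:Z)) : (f p)^-1 * f p = 1.
    by rewrite mulVf //; apply: exactly_neq0 hp.
  rewrite (lcoefM v2 v1 (_ : _ < n.+1%:Z)); last lia.
  rewrite big_ord_recr /= => e.
  have -> : (n == 0%N)%:R = (if n%:Z == 0 then 1 else 0) :> F by case: n {IH e}.
  rewrite -e; apply: (mulfI n1); rewrite mulrA mulfV // mul1r.
  have -> : n%:Z - - N - n%:Z = N by lia.
  rewrite [RHS]mulrC -[RHS]add0r addrAC; congr (_ + _); apply/eqP; rewrite subr_eq0; apply/eqP.
  by apply: eq_bigr => i _; congr (_ * f p _); lia.
apply: dbleM; first by apply: dbleV; [case: (near_at hN) | exact: good_dble].
apply: dbleD; first exact: dble_cst.
apply: dbleN.
apply: (@dble_near _ _ _ _ (fun p => \sum_(i <- index_enum 'I_n) (if (i < n)%N then (f p)^-1 (- N + i%:Z) else 0) * f p (N + n%:Z - i%:Z))).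
  by apply: nearT => p; apply: eq_bigr => i _; rewrite ltn_ord.
apply: dble_sum => i; apply: dbleM; last by exact: good_dble.
by rewrite ltn_ord; apply: IH.
Qed.
Lemma ldeltaV c f : ugood f -> ldelta c (fun p => (f p)^-1) = - ldelta c f / f m ^+ 2.
Proof.
move=> uf; have [gf [N hN]] := uf; have gV := goodV uf.
have f0 := near_at (ugood_neq0 uf).
have : ldelta c (fun p => f p * (f p)^-1) = 0.
  rewrite (@ldelta_near _ _ (fun _ => 1)); first by rewrite ldelta_cst lderivC mulr0 oppr0.
    exact: goodM.
  by apply: (nearS _ (ugood_neq0 uf)) => p h; rewrite mulfV.
rewrite ldeltaM // => /eqP; rewrite addrC addr_eq0 => /eqP e.
move: (f m) (ldelta c f) f0 e => x d f0 e.
by apply: (mulfI f0); rewrite e; field.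
Qed.
End Directional.

(** * Families of matrices and formal solutions *)

Section MatFamilies.
Variables (P : Type) (F : fieldType) (m : P) (D : derivation_at F m).
Local Notation L := (laurent F).
Local Notation near := (near_pt D).
Local Notation ldelta := (ldelta_at D).
Implicit Types (A B : P -> 'M[L]_2) (f : P -> L) (c : F).

Definition mgood A := forall a b, good D (fun p => A p a b).
Definition mdelta_at c A : 'M[L]_2 := \matrix_(a, b) ldelta c (fun p => A p a b).

Lemma mgood_near A B : near (fun p => A p = B p) -> mgood A -> mgood B.
Proof. by move=> e gA a b; apply: good_near (gA a b); apply: (nearS _ e) => p ->. Qed.
Lemma mgoodM A B : mgood A -> mgood B -> mgood (fun p => A p *m B p).
Proof.
move=> gA gB a b; apply: (@good_near _ _ _ D (fun p => A p a 0 * B p 0 b + A p a 1 * B p 1 b)).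
  by apply: nearT => p; rewrite mulmx2E.
by apply: goodD; apply: goodM.
Qed.
Lemma mgoodD A B : mgood A -> mgood B -> mgood (fun p => A p + B p).
Proof.
move=> gA gB a b; apply: (@good_near _ _ _ D (fun p => A p a b + B p a b)).
  by apply: nearT => p; rewrite mxE.
exact: goodD.
Qed.
Lemma mgoodZ f A : good D f -> mgood A -> mgood (fun p => f p *: A p).
Proof.
move=> gf gA a b; apply: (@good_near _ _ _ D (fun p => f p * A p a b)).
  by apply: nearT => p; rewrite mxE.
exact: goodM.
Qed.
Lemma mgood_cst (A : 'M[L]_2) : mgood (fun _ => A).
Proof. by move=> a b; apply: good_cst. Qed.
Lemma mgood2 (x y z t : P -> L) : good D x -> good D y -> good D z -> good D t ->
  mgood (fun p => mx2 (x p) (y p) (z p) (t p)).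
Proof.
move=> gx gy gz gt; apply: forall_ord2; apply: forall_ord2.
- by apply: good_near gx; apply: nearT => p; rewrite mx2E.
- by apply: good_near gy; apply: nearT => p; rewrite mx2E.
- by apply: good_near gz; apply: nearT => p; rewrite mx2E.
- by apply: good_near gt; apply: nearT => p; rewrite mx2E.
Qed.
Lemma mgood_lderiv A : mgood A -> mgood (fun p => map_mx (@lderiv F) (A p)).
Proof.
move=> gA a b; apply: (@good_near _ _ _ D (fun p => lderiv (A p a b))).
  by apply: nearT => p; rewrite mxE.
exact: good_lderiv.
Qed.
Lemma mdelta_near c A B : mgood A -> near (fun p => A p = B p) -> mdelta_at c A = mdelta_at c B.
Proof.
move=> gA e; apply/matrixP => a b; rewrite !mxE; apply: ldelta_near; first exact: gA.
by apply: (nearS _ e) => p ->.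
Qed.
Lemma mdeltaM c A B : mgood A -> mgood B ->
  mdelta_at c (fun p => A p *m B p) = mdelta_at c A *m B m + A m *m mdelta_at c B.
Proof.
move=> gA gB; apply/matrixP => a b; rewrite mxE [RHS]mxE !mulmx2E.
rewrite (@ldelta_near _ _ _ _ _ _ (fun p => A p a 0 * B p 0 b + A p a 1 * B p 1 b)); last first.
- by apply: nearT => p; rewrite mulmx2E.
- exact: mgoodM.
by rewrite ldeltaD ?ldeltaM ?mxE; try apply: goodM; rewrite ?[in RHS]mxE //; ring.
Qed.
Lemma mdeltaD c A B : mgood A -> mgood B ->
  mdelta_at c (fun p => A p + B p) = mdelta_at c A + mdelta_at c B.
Proof.
move=> gA gB; apply/matrixP => a b; rewrite mxE [RHS]mxE !mxE -ldeltaD //.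
apply: ldelta_near; first exact: mgoodD.
by apply: nearT => p; rewrite mxE.
Qed.
Lemma mdeltaZ c f A : good D f -> mgood A -> ldelta c f = 0 ->
  mdelta_at c (fun p => f p *: A p) = f m *: mdelta_at c A.
Proof.
move=> gf gA e; apply/matrixP => a b; rewrite mxE [RHS]mxE mxE.
rewrite (@ldelta_near _ _ _ _ _ _ (fun p => f p * A p a b)); last first.
- by apply: nearT => p; rewrite mxE.
- exact: mgoodZ.
by rewrite ldeltaM // e mul0r add0r.
Qed.
Lemma mdelta2 c (x y z t : P -> L) : good D x -> good D y -> good D z -> good D t ->
  mdelta_at c (fun p => mx2 (x p) (y p) (z p) (t p)) =
  mx2 (ldelta c x) (ldelta c y) (ldelta c z) (ldelta c t).
Proof.
move=> gx gy gz gt; apply: mx2P; rewrite mxE mx2E; symmetry; apply: ldelta_near => //;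
by apply: nearT => p; rewrite mx2E.
Qed.
Lemma mdelta_lderiv c A : mgood A ->
  mdelta_at c (fun p => map_mx (@lderiv F) (A p)) = map_mx (@lderiv F) (mdelta_at c A).
Proof.
move=> gA; apply/matrixP => a b; rewrite !mxE -ldelta_lderiv //.
apply: ldelta_near; first exact: mgood_lderiv.
by apply: nearT => p; rewrite mxE.
Qed.
Lemma mreg_mdelta c A : mgood A -> near (fun p => mregular (A p)) -> mregular (mdelta_at c A).
Proof.
move=> gA hA a b; rewrite mxE; apply: reg_ldelta; first exact: gA.
by apply: (nearS _ hA) => p h; apply: h.
Qed.

Hypothesis char0 : forall k : int, k != 0 -> k%:~R != 0 :> F.

Definition ldint_at c f : L := ldelta c (fun p => lint (f p)) - lC (c * lres (f m)) * lX^-1.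

Lemma lintE (g : L) k : lint g k = if k == 0 then 0 else g (k - 1) / k%:~R.
Proof.
rewrite [LHS](@lseriesE _ _ (low g)) // => j hj.
by case: eqP => // _; rewrite (@lowP _ g) ?mul0r //; lia.
Qed.
Lemma good_lint f : good D f -> good D (fun p => lint (f p)).
Proof.
move=> gf; have [N [hN _]] := good_at gf; split.
  exists N; apply: (nearS _ hN) => p h k hk; rewrite lintE; case: eqP => // _.
  by rewrite h ?mul0r //; lia.
move=> k; apply: (@dble_near _ _ _ _ (fun p => (if k == 0 then 0 else f p (k - 1) / k%:~R))).
  by apply: nearT => p; rewrite lintE.
case: (k == 0); first exact: dble_cst.
by apply: dbleM; [exact: good_dble | exact: dble_cst].
Qed.
(** The subtracted multiple of X^-1 is the derivative of the logarithm, absent from [lint]. With it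
    the effect of the moving center is exactly - c f in every degree. *)
Lemma ldintE c f k : good D f -> ldint_at c f k =
  (if k == 0 then 0 else ddir D (fun p => f p (k - 1)) / k%:~R) - c * f m k.
Proof.
move=> gf; rewrite lcoefB lC_coefM lXV (ldeltaE c _ (good_lint gf)) -addrA; congr (_ + _).
  rewrite (@dir_near _ _ _ _ _ (fun p => (if k == 0 then 0 else f p (k - 1) / k%:~R))).
    case: (k == 0); first by rewrite dir_cst.
    by rewrite dirM ?dir_cst ?mulr0 ?addr0 //; [exact: good_dble | exact: dble_cst].
  by apply: nearT => p; rewrite lintE.
rewrite lintE -opprD; congr (- _) => /=.
have [->|hk] := eqVneq k (-1).
  by rewrite addNr eqxx mul0rz mulr0 add0r mulr1.
have hk1 : k + 1 != 0 by lia.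
rewrite (negPf hk1) mulr0 addr0 addrK; congr (_ * _).
by rewrite -mulrzr divfK // char0.
Qed.
(** A derivative has no X^-1 term, so the identity can hold only if the residue of [f] does not
    vary; hence the second hypothesis. *)
Lemma lderiv_ldint c f : good D f -> ddir D (fun p => lres (f p)) = 0 ->
  lderiv (ldint_at c f) = ldelta c f.
Proof.
move=> gf h; apply: laurentP => k; rewrite lderivE ldintE // ldeltaE //.
have [->|hk] := eqVneq k (-1).
  by rewrite addNr !mulr0z mulr0 subr0; symmetry; apply: h.
have hk1 : k + 1 != 0 by lia.
rewrite (negPf hk1) addrK mulrzBl mulrzAr; congr (_ - _).
by rewrite -mulrzr divfK // char0.
Qed.
Definition dlog_at c A (lp lm : P -> L) : 'M[L]_2 :=
  (mdelta_at c A - A m *m mx2 (ldint_at c lp) 0 0 (ldint_at c lm)) *m invmx (A m).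

(** The equation A' + Om A = A diag(lp, lm), which says that A times an exponential is a solution,
    is differentiated along the direction and solved for [W]; the exponential itself never
    appears. *)
Lemma cov_dlog c A (Om : P -> 'M[L]_2) lp lm : mgood A -> mgood Om ->
  good D lp -> good D lm -> A m \in unitmx ->
  ddir D (fun p => lres (lp p)) = 0 -> ddir D (fun p => lres (lm p)) = 0 ->
  near (fun p => map_mx (@lderiv F) (A p) + Om p *m A p = A p *m mx2 (lp p) 0 0 (lm p)) ->
  cov (@lderiv F) (Om m) (dlog_at c A lp lm) = - mdelta_at c Om.
Proof.
move=> gA gO gp gm u rp rm e; set W := dlog_at _ _ _ _.
have em := near_at e.
have gl : mgood (fun p => mx2 (lp p) 0 0 (lm p)).
  by apply: mgood2 => //; apply: good_cst.
have dl : mdelta_at c (fun p => mx2 (lp p) 0 0 (lm p)) =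
    map_mx (@lderiv F) (mx2 (ldint_at c lp) 0 0 (ldint_at c lm)).
  rewrite map_mx2 !lderiv_ldint // mdelta2 //; try exact: good_cst.
  by rewrite ldelta_cst (der0 (@lderivD F)) mulr0 oppr0.
have de : map_mx (@lderiv F) (mdelta_at c A) + (mdelta_at c Om *m A m + Om m *m mdelta_at c A) =
    mdelta_at c A *m mx2 (lp m) 0 0 (lm m) +
    A m *m map_mx (@lderiv F) (mx2 (ldint_at c lp) 0 0 (ldint_at c lm)).
  rewrite -mdelta_lderiv // -mdeltaM // -dl -(mdeltaM c gA gl) -mdeltaD //; last 2 first.
  - exact: mgood_lderiv.
  - exact: mgoodM.
  apply: mdelta_near => //; apply: mgoodD; [exact: mgood_lderiv | exact: mgoodM].
have WA : W *m A m = mdelta_at c A - A m *m mx2 (ldint_at c lp) 0 0 (ldint_at c lm).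
  by rewrite /W /dlog_at mulmxKV.
set dA := mdelta_at c A in de WA *; set dO := mdelta_at c Om in de WA *.
set l := mx2 (lp m) 0 0 (lm m) in em de.
set dL := mx2 (ldint_at c lp) 0 0 (ldint_at c lm) in de WA.
set X := A m in em de WA u *; set O := Om m in em de *.
(* Diagonal matrices commute, so the variation of the exponential factor leaves no commutator
   behind. *)
have ll : l *m dL = dL *m l by rewrite !mx2M; congr mx2; ring.
clearbody W dA dO l dL X O.
have hW : map_mx (@lderiv F) W *m X + W *m map_mx (@lderiv F) X = map_mx (@lderiv F) dA -
    (map_mx (@lderiv F) X *m dL + X *m map_mx (@lderiv F) dL).
  rewrite -(mapD_mul (@lderivD F) (@lderivM F) W X) WA (mapD_add (@lderivD F)).
  by rewrite (mapD_opp (@lderivD F)) (mapD_mul (@lderivD F) (@lderivM F) X dL).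
apply: (can_inj (mulmxK u)); rewrite /cov mulmxDl mulmxBl mulNmx.
have eX : map_mx (@lderiv F) X = X *m l - O *m X by rewrite -em addrK.
move/(canRL (addrK _)) in hW.
have hdA : map_mx (@lderiv F) dA = dA *m l + X *m map_mx (@lderiv F) dL
    - (dO *m X + O *m dA) by rewrite -de addrK.
rewrite hW hdA eX !(mulmxDl, mulmxDr, mulmxN, mulNmx) !mulmxA -(mulmxA O W X) WA.
rewrite !(mulmxDl, mulmxDr, mulmxN, mulNmx) !mulmxA.
have -> : X *m l *m dL = X *m dL *m l by rewrite -mulmxA ll mulmxA.
mxring.
Qed.
End MatFamilies.

(** * Local consequences of the variation equation *)

Section LocalAnalysis.
Variable F : fieldType.
Local Notation L := (laurent F).
Local Notation cov := (@cov L (@lderiv F)).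
Implicit Types Om W Y Z d : 'M[L]_2.

Lemma lresD (f g : L) : lres (f + g) = lres f + lres g. Proof. by []. Qed.
Lemma lresN (f : L) : lres (- f) = - lres f. Proof. by []. Qed.
Lemma mxtraceN (A : 'M[L]_2) : \tr (- A) = - \tr A.
Proof. exact: raddfN. Qed.
Lemma res_by_parts Om X Y :
  lres (\tr (cov Om X *m Y)) = - lres (\tr (X *m cov Om Y)).
Proof.
apply/eqP; rewrite -addr_eq0 -lresD (tr_cov (@lderivD F) (@lderivM F)).
by rewrite lres_lderiv.
Qed.

(* Only the class of W modulo solutions of the homogeneous equation matters, so
   W1 and W2 can be eliminated in favour of Y. *)
Lemma res_wedge_potential Om W1 W2 Y d1 d2 : cov Om W1 = - d1 -> cov Om Y = - d1 ->
  cov Om W2 = - d2 ->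
  lres (\tr (d1 *m W2 - W1 *m d2)) = - (2%:R * lres (\tr (Y *m d2))).
Proof.
move=> e1 eY e2; rewrite mxtraceD mxtraceN lresD lresN.
have h X : cov Om X = - d1 -> lres (\tr (X *m d2)) = - lres (\tr (d1 *m W2)).
  move=> eX; have -> : d2 = - cov Om W2 by rewrite e2 opprK.
  by rewrite mulmxN mxtraceN lresN -res_by_parts eX mulNmx mxtraceN lresN.
by rewrite (h _ e1) (h _ eY); ring.
Qed.
(** Nothing is assumed about the poles of [k] and [u]. The first row of the commutator of [Om] with
    the lower row is [Om 0 1] times (k, u); as the first row of [X] vanishes, this equals minus a
    term of pole order at most N, and division by the entry of exact order N makes [k] and [u]
    regular. *)
Lemma local_regular (N : int) Om Z0 (k u : L) : 0 <= N -> mvb (- N) Om ->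
  exactly (- N) (Om 0 1) -> mregular Z0 ->
  let X := cov Om (Z0 + mx2 0 0 k u) in
  X 0 0 = 0 -> X 0 1 = 0 -> mregular X.
Proof.
move=> N0 hO hO1 hZ0 X X00 X01.
have N1 : - N <= 0 by lia.
have hc := mvb_cov hO N1 hZ0.
have e : X = cov Om Z0 + cov Om (mx2 0 0 k u) by apply: covD; apply: lderivD.
have d0 := der0 (@lderivD F).
have e0 : cov Om (mx2 0 0 k u) 0 0 = Om 0 1 * k.
  by rewrite /cov [Om]mx2_eta map_mx2 !mx2M mx2N !mx2D !mx2E d0; ring.
have e1 : cov Om (mx2 0 0 k u) 0 1 = Om 0 1 * u.
  by rewrite /cov [Om]mx2_eta map_mx2 !mx2M mx2N !mx2D !mx2E d0; ring.
have hk : regular k.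
  rewrite /regular -(subrr (- N)); apply: (vb_cancel hO1); rewrite -e0.
  have /eqP := X00; rewrite e mxE addrC addr_eq0 => /eqP ->.
  by apply: vbN; apply: hc.
have hu : regular u.
  rewrite /regular -(subrr (- N)); apply: (vb_cancel hO1); rewrite -e1.
  have /eqP := X01; rewrite e mxE addrC addr_eq0 => /eqP ->.
  by apply: vbN; apply: hc.
have hZ : mregular (Z0 + mx2 0 0 k u) by apply: mvbD => //; apply: mvb2.
(* With zero first row this entry is the trace of [X], which is the derivative of a regular
   series. *)
have h11 : regular (X 1 1).
  have -> : X 1 1 = \tr X by rewrite mxtrace2 X00 add0r.
  rewrite (tr_cov1 (@lderivD F)); apply: reg_lderiv; exact: mvb_tr.
(* tr(Om X) reduces to Om_01 X_10 + Om_11 X_11, and [tr_cov_self] bounds its pole by N; dividing by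
   Om_01 removes that pole. *)
have h10 : regular (X 1 0).
  rewrite /regular -(subrr (- N)); apply: (vb_cancel hO1).
  have -> : Om 0 1 * X 1 0 = \tr (Om *m X) - Om 1 1 * X 1 1.
    by rewrite mxtrace2 !mulmx2E X00 X01; ring.
  apply: vbB; last by rewrite -[- N]addr0; apply: vbM.
  rewrite /X tr_cov_self; apply: mvb_tr; rewrite -[- N]addr0; apply: mvbM => //.
  exact: mreg_lderiv.
by apply: forall_ord2; apply: forall_ord2; rewrite ?X00 ?X01 //; apply: vb0.
Qed.
(** In the frame [A0] both the connection and [Z] are regular, hence so is the covariant derivative.
    The lower row of A0^-1 (0 0; g h) A0 is ((g + h p)/X, h), which gives the two conclusions. *)
Lemma apparent_regular Om Z (p : F) (g h : L) :
  let A0 := mx2 1 0 (lC p) lX in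
  mregular (gauge (@lderiv F) A0 Om) -> mregular (invmx A0 *m Z *m A0) ->
  cov Om Z = mx2 0 0 g h -> regular h /\ vb 1 (g + h * lC p).
Proof.
move=> A0 hO hZ e.
have u : A0 \in unitmx by rewrite unitmx2 mul0r subr0 mul1r lX_neq0.
have := mvb_cov hO (lexx 0) hZ; rewrite (cov_gauge (@lderivD F) (@lderivM F)) // e.
rewrite invmx2; last by rewrite mul0r subr0 mul1r lX_neq0.
rewrite mul0r subr0 mul1r -!scalemxAl !mx2M mx2Z => H.
have := H 1 1; have := H 1 0; rewrite !mx2E => h1 h2; split.
  have -> : h = lX^-1 * ((- lC p * 0 + 1 * g) * 0 + (- lC p * 0 + 1 * h) * lX).
    by rewrite !mulr0 !add0r !mul1r mulrCA mulVf ?lX_neq0 ?mulr1.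
  exact: h2.
have -> : g + h * lC p = lX * (lX^-1 * ((- lC p * 0 + 1 * g) * 1 + (- lC p * 0 + 1 * h) * lC p)).
  by rewrite mulrA mulfV ?lX_neq0 // !mulr0 !add0r !mul1r mulr1.
by apply: (@vbM _ 1 0) => //; apply: vb_mono.
Qed.
End LocalAnalysis.

(** * Rational functions depending on parameters *)

Section Pullback.
Variable F : fieldType.
Hypothesis hF : all_split F.
Local Notation L := (laurent F).
Local Notation K := {fraction {poly F}}.
Implicit Types (xi : L) (A B X : 'M[K]_2).
Local Notation sub xi := (map_mx (lsubst xi)).

Lemma pullback_cov xi A X : transc xi ->
  cov (@lderiv F) (pullback xi A) (sub xi X) = pullback xi (cov (@rderiv F) A X).
Proof.
move=> h; have [f fE] := lsubst_morph h; rewrite /cov /pullback.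
have -> : map_mx (@lderiv F) (sub xi X) = lderiv xi *: sub xi (map_mx (@rderiv F) X).
  by apply/matrixP => a b; rewrite !mxE lderiv_lsubst // mulrC.
rewrite fE map_mxD map_mxB !map_mxM scalerDr scalerBr.
by rewrite -scalemxAl -scalemxAr.
Qed.
Lemma pullback_gauge xi A X : transc xi -> X \in unitmx ->
  pullback xi (gauge (@rderiv F) X A) = gauge (@lderiv F) (sub xi X) (pullback xi A).
Proof.
move=> h u; have [f fE] := lsubst_morph h; rewrite /gauge /pullback.
have -> : map_mx (@lderiv F) (sub xi X) = lderiv xi *: sub xi (map_mx (@rderiv F) X).
  by apply/matrixP => a b; rewrite !mxE lderiv_lsubst // mulrC.
rewrite fE map_mxD !map_mxM map_invmx scalerDr.
by rewrite -!scalemxAr -scalemxAl.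
Qed.
Lemma sub_unit xi X : transc xi -> X \in unitmx -> sub xi X \in unitmx.
Proof. by move=> h u; have [f ->] := lsubst_morph h; rewrite map_unitmx. Qed.
Lemma sub_conj xi X A : transc xi ->
  sub xi (invmx X *m A *m X) = invmx (sub xi X) *m sub xi A *m sub xi X.
Proof. by move=> h; have [f ->] := lsubst_morph h; rewrite !map_mxM map_invmx. Qed.
Lemma sub_conjV xi X A : transc xi ->
  sub xi (X *m A *m invmx X) = sub xi X *m sub xi A *m invmx (sub xi X).
Proof. by move=> h; have [f ->] := lsubst_morph h; rewrite !map_mxM map_invmx. Qed.
Lemma pullback_conj xi X A : transc xi ->
  pullback xi (invmx X *m A *m X) = invmx (sub xi X) *m pullback xi A *m sub xi X.
Proof. by move=> h; rewrite /pullback sub_conj // -!scalemxAr -scalemxAl. Qed.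
Lemma tr_sub_pullback xi X A : transc xi ->
  \tr (sub xi X *m pullback xi A) = lderiv xi * lsubst xi (\tr (X *m A)).
Proof.
move=> h; have [f fE] := lsubst_morph h.
by rewrite /pullback -scalemxAr mxtraceZ fE -map_mxM trace_map_mx.
Qed.
Lemma sub_lsquare xi A : sub (lsquare xi) A = map_mx (@lsquare F) (sub xi A).
Proof. by apply/matrixP => a b; rewrite !mxE lsquare_lsubst. Qed.
Lemma pullback_lsquare xi A :
  pullback (lsquare xi) A = (lC 2%:R * lX) *: map_mx (@lsquare F) (pullback xi A).
Proof.
apply/matrixP => a b; rewrite !mxE lderiv_lsquare.
by rewrite (rmorphM (@lsquare F) (lderiv xi)) /= lsquare_lsubst mulrA.
Qed.
Lemma pullbackN xi A : transc xi -> pullback xi (- A) = - pullback xi A.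
Proof.
by move=> h; have [f fE] := lsubst_morph h; rewrite /pullback fE map_mxN scalerN.
Qed.
Lemma pullback_mx2 xi (a b c d : K) :
  pullback xi (mx2 a b c d) = mx2 (lderiv xi * lsubst xi a) (lderiv xi * lsubst xi b)
    (lderiv xi * lsubst xi c) (lderiv xi * lsubst xi d).
Proof. by rewrite /pullback map_mx2 mx2Z. Qed.
End Pullback.

Section Charts.
Variables (P : Type) (F : fieldType) (m : P) (D : derivation_at F m).
Hypothesis hF : all_split F.
Variables (I0 : Type) (pts : I0 -> P -> F).
Hypothesis dpts : forall i, dble D (pts i).
Local Notation L := (laurent F).
Local Notation K := {fraction {poly F}}.
Local Notation near := (near_pt D).
Local Notation ldelta := (ldelta_at D).
Implicit Types (xi : P -> L) (c : F) (f g : P -> K) (df dg : K).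

(** A local coordinate X in which x is the series [xi], with center moving at speed [c].
    [chart_delta] says that the derivation keeps x fixed; [chart_pts] makes the functions x - t_i
    and x - q_j invertible as families. *)
Record chart xi c : Prop := Chart {
  chart_good : good D xi;
  chart_delta : ldelta c xi = 0;
  chart_transc : forall p, transc (xi p);
  chart_pts : forall i, ugood D (fun p => xi p - lC (pts i p)) }.

(* [df] is the derivative of the family [f] of rational functions with x fixed,
   as seen in every chart adapted to the moving points. *)
Definition kf f (df : K) := forall xi c, chart xi c ->
  good D (fun p => lsubst (xi p) (f p)) /\
  ldelta c (fun p => lsubst (xi p) (f p)) = lsubst (xi m) df.
Definition hkf f := exists df, kf f df.

Lemma kf_lift xi c f df (g : P -> L) : (forall p, g p = lsubst (xi p) (f p)) -> good D g ->
  ldelta c g = lsubst (xi m) df ->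
  good D (fun p => lsubst (xi p) (f p)) /\
  ldelta c (fun p => lsubst (xi p) (f p)) = lsubst (xi m) df.
Proof. by move=> e; have <- : g = (fun p => lsubst (xi p) (f p)) by apply: funext. Qed.
Lemma kf_near f g df : near (fun p => f p = g p) -> kf f df -> kf g df.
Proof.
move=> e h xi c hx; have [h1 h2] := h xi c hx.
have e' : near (fun p => lsubst (xi p) (f p) = lsubst (xi p) (g p)).
  by apply: (nearS _ e) => p ->.
by split; [apply: good_near e' h1 | rewrite -h2; symmetry; apply: ldelta_near].
Qed.
Lemma kfD f g df dg : kf f df -> kf g dg -> kf (fun p => f p + g p) (df + dg).
Proof.
move=> h h' xi c hx; have [h1 h2] := h xi c hx; have [h3 h4] := h' xi c hx.
have ht := chart_transc hx; apply: kf_lift (goodD h1 h3) _ => [p|].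
  by have [s ->] := lsubst_morph (ht p); rewrite rmorphD.
by have [s sE] := lsubst_morph (ht m); rewrite ldeltaD // h2 h4 sE rmorphD.
Qed.
Lemma kfM f g df dg : kf f df -> kf g dg -> kf (fun p => f p * g p) (df * g m + f m * dg).
Proof.
move=> h h' xi c hx; have [h1 h2] := h xi c hx; have [h3 h4] := h' xi c hx.
have ht := chart_transc hx; apply: kf_lift (goodM h1 h3) _ => [p|].
  by have [s ->] := lsubst_morph (ht p); rewrite rmorphM.
have [s sE] := lsubst_morph (ht m).
by rewrite ldeltaM // h2 h4 sE rmorphD (rmorphM s df) (rmorphM s (f m)).
Qed.
Lemma kfV f df : (forall xi c, chart xi c -> ugood D (fun p => lsubst (xi p) (f p))) ->
  kf f df -> kf (fun p => (f p)^-1) (- df / f m ^+ 2).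
Proof.
move=> u h xi c hx; have [h1 h2] := h xi c hx; have hu := u xi c hx.
have ht := chart_transc hx; apply: kf_lift (goodV hu) _ => [p|].
  by have [s ->] := lsubst_morph (ht p); rewrite fmorphV.
have [s sE] := lsubst_morph (ht m).
by rewrite ldeltaV // h2 sE fmorph_div rmorphN rmorphXn.
Qed.
Lemma kf0 : kf (fun _ => 0) 0.
Proof.
move=> xi c hx; have ht := chart_transc hx; apply: kf_lift (good_cst D 0) _ => [p|].
  by have [s ->] := lsubst_morph (ht p); rewrite rmorph0.
have [s ->] := lsubst_morph (ht m).
by rewrite ldelta_cst (der0 (@lderivD F)) mulr0 oppr0 rmorph0.
Qed.
Lemma hkfD f g : hkf f -> hkf g -> hkf (fun p => f p + g p).
Proof. by move=> [df h] [dg h']; exists (df + dg); apply: kfD. Qed.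
Lemma hkfM f g : hkf f -> hkf g -> hkf (fun p => f p * g p).
Proof. by move=> [df h] [dg h']; exists (df * g m + f m * dg); apply: kfM. Qed.
Lemma hkf_sum (I : Type) (r : seq I) (G : I -> P -> K) :
  (forall i, hkf (G i)) -> hkf (fun p => \sum_(i <- r) G i p).
Proof.
move=> h; elim: r => [|i r IH].
  by exists 0; apply: kf_near kf0; apply: nearT => p; rewrite big_nil.
have [df h'] := hkfD (h i) IH; exists df; apply: kf_near h'.
by apply: nearT => p; rewrite big_cons.
Qed.
Lemma ev_bounded (xi : L) (q : {poly F}) n : (size q <= n)%N ->
  ev xi q = \sum_(k < n) lC q`_k * xi ^+ k.
Proof.
move=> hn; have {1}-> : q = \sum_(k < n) q`_k *: 'X^k.
  rewrite -(poly_def n (fun k => q`_k)); apply/polyP => k; rewrite coef_poly.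
  by case: ltnP => // h; rewrite nth_default //; apply: leq_trans hn h.
by rewrite rmorph_sum /=; apply: eq_bigr => k _; rewrite evZ rmorphXn /= evX.
Qed.
(** A degree bound uniform near [m] turns substitution into a fixed finite sum; as x is fixed, only
    the coefficients are differentiated. *)
Lemma kf_poly (q : P -> {poly F}) n : near (fun p => (size (q p) <= n)%N) ->
  (forall k, dble D (fun p => (q p)`_k)) ->
  kf (fun p => tofrac (q p)) (tofrac (\poly_(k < n) ddir D (fun p => (q p)`_k))).
Proof.
move=> hn hd xi c hx; have gx := chart_good hx.
have e : near (fun p => \sum_(k < n) lC (q p)`_k * xi p ^+ k = lsubst (xi p) (tofrac (q p))).
  apply: (nearS _ hn) => p hp; rewrite (lsubst_tofrac _ (chart_transc hx p)).
  by rewrite (ev_bounded _ hp).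
have gk k : good D (fun p => lC (q p)`_k * xi p ^+ k).
  by apply: goodM; [apply: good_lC | apply: goodXn].
have gs : good D (fun p => \sum_(k < n) lC (q p)`_k * xi p ^+ k).
  by apply: good_sum => k; apply: gk.
split; first exact: good_near e gs.
rewrite -(ldelta_near _ gs e) (lsubst_tofrac _ (chart_transc hx m)).
rewrite (@ev_bounded _ _ n) ?size_poly //.
have -> : ldelta c (fun p => \sum_(k < n) lC (q p)`_k * xi p ^+ k) =
    \sum_(k < n) ldelta c (fun p => lC (q p)`_k * xi p ^+ k).
  elim: (index_enum _) => [|k r IH].
    rewrite big_nil -[RHS](_ : ldelta c (fun _ => 0) = 0).
      by apply: ldelta_near; [apply: good_near (good_cst _ 0) | ]; apply: nearT => p; rewrite big_nil.
    by rewrite ldelta_cst (der0 (@lderivD F)) mulr0 oppr0.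
  rewrite big_cons -IH -ldeltaD //; last by apply: good_sum => j; apply: gk.
  have e1 : near (fun p => lC (q p)`_k * xi p ^+ k + \sum_(j <- r) lC (q p)`_j * xi p ^+ j =
     \sum_(j <- k :: r) lC (q p)`_j * xi p ^+ j) by apply: nearT => p; rewrite big_cons.
  symmetry; apply: ldelta_near e1; apply: goodD => //.
  by apply: good_sum => j; apply: gk.
apply: eq_bigr => k _; rewrite coef_poly ltn_ord ldeltaM //; last first.
- exact: goodXn.
- exact: good_lC.
by rewrite ldelta_lC // ldelta_Xn // (chart_delta hx) mulr0 mulr0 addr0.
Qed.
Definition lin i : P -> K := fun p => tofrac ('X - (pts i p)%:P).
Lemma lsubst_lin xi c i p : chart xi c -> lsubst (xi p) (lin i p) = xi p - lC (pts i p).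
Proof.
move=> hx; rewrite (lsubst_tofrac _ (chart_transc hx p)).
by rewrite rmorphB /= evX evC.
Qed.
Lemma kf_lin i : kf (lin i) (- tofrac (ddir D (pts i))%:P).
Proof.
move=> xi c hx; have gx := chart_good hx; have gl := good_lC (dpts i).
apply: kf_lift (goodB gx gl) _ => [p|]; first by rewrite (lsubst_lin _ _ hx).
rewrite ldeltaB // (chart_delta hx) ldelta_lC // sub0r.
have ht := chart_transc hx m; have [s sE] := lsubst_morph ht.
by rewrite sE rmorphN -sE (lsubst_tofrac _ ht) evC.
Qed.
Lemma ugood_lin xi c i : chart xi c -> ugood D (fun p => lsubst (xi p) (lin i p)).
Proof.
by move=> hx; apply: ugood_near (chart_pts hx i); apply: nearT => p; rewrite (lsubst_lin _ _ hx).
Qed.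
Lemma kf_Xn f df n : kf f df -> kf (fun p => f p ^+ n) (n%:R * f m ^+ n.-1 * df).
Proof.
move=> h xi c hx; have [h1 h2] := h xi c hx.
have ht := chart_transc hx; apply: kf_lift (goodXn n h1) _ => [p|].
  by have [s ->] := lsubst_morph (ht p); rewrite rmorphXn.
have [s sE] := lsubst_morph (ht m).
rewrite ldelta_Xn // h2 sE (rmorphM s (n%:R * f m ^+ n.-1)) (rmorphM s n%:R).
by rewrite rmorph_nat rmorphXn.
Qed.
Lemma hkf_linV i n : hkf (fun p => (lin i p ^+ n)^-1).
Proof.
have h := kf_Xn n (kf_lin i); eexists; apply: kfV h => xi c hx.
apply: (@ugood_near _ _ _ D (fun p => lsubst (xi p) (lin i p) ^+ n)).
  by apply: nearT => p; have [s ->] := lsubst_morph (chart_transc hx p); rewrite rmorphXn.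
by apply: ugoodXn; apply: ugood_lin hx.
Qed.
Lemma kf_prod (I : Type) (r : seq I) (G : I -> P -> K) :
  (forall i, kf (G i) 0) -> kf (fun p => \prod_(i <- r) G i p) 0.
Proof.
move=> h; elim: r => [|i r IH].
  apply: (@kf_near (fun _ => tofrac 1)); first by apply: nearT => p; rewrite big_nil tofrac1.
  have := @kf_poly (fun _ => 1) 1; rewrite (_ : \poly_(k < 1) _ = 0).
    rewrite tofrac0; apply; first by apply: nearT => p; rewrite size_poly1.
    by move=> k; apply: dble_cst.
  by apply/polyP => k; rewrite coef_poly coef0 dir_cst; case: ifP.
have := kfM (h i) IH; rewrite mul0r mulr0 addr0; apply: kf_near.
by apply: nearT => p; rewrite big_cons.
Qed.
Definition mkf (A : P -> 'M[K]_2) (A' : 'M[K]_2) :=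
  forall a b, kf (fun p => A p a b) (A' a b).
Lemma mkf2 (x y z t : P -> K) (dx dy dz dt : K) : kf x dx -> kf y dy -> kf z dz -> kf t dt ->
  mkf (fun p => mx2 (x p) (y p) (z p) (t p)) (mx2 dx dy dz dt).
Proof.
move=> hx hy hz ht; apply: forall_ord2; apply: forall_ord2; rewrite mx2E.
- by apply: kf_near hx; apply: nearT => p; rewrite mx2E.
- by apply: kf_near hy; apply: nearT => p; rewrite mx2E.
- by apply: kf_near hz; apply: nearT => p; rewrite mx2E.
- by apply: kf_near ht; apply: nearT => p; rewrite mx2E.
Qed.
(** The factor dx/dX is constant for the derivation, because delta commutes with d/dX and
    annihilates x. So the variation of A dx is the variation of A, times dx. *)
Lemma mkf_pullback A A' xi c : chart xi c -> mkf A A' ->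
  mgood D (fun p => pullback (xi p) (A p)) /\
  mdelta_at D c (fun p => pullback (xi p) (A p)) = pullback (xi m) A'.
Proof.
move=> hx h; have gx := good_lderiv (chart_good hx).
have gs : mgood D (fun p => map_mx (lsubst (xi p)) (A p)).
  move=> a b; have [h1 _] := h a b _ _ hx; apply: good_near h1.
  by apply: nearT => p; rewrite mxE.
split; first exact: mgoodZ.
rewrite mdeltaZ //; last by rewrite (ldelta_lderiv _ (chart_good hx)) (chart_delta hx) (der0 (@lderivD F)).
rewrite /pullback; congr (_ *: _); apply/matrixP => a b; rewrite !mxE.
have [h1 <-] := h a b _ _ hx; symmetry; apply: ldelta_near => //.
by apply: nearT => p; rewrite mxE.
Qed.
End Charts.

(** * Local regularity and global vanishing *)

Section SingularPart.
Variable F : fieldType.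
Local Notation L := (laurent F).
Implicit Types A B G T E : 'M[L]_2.

Lemma GLreg_exact T : GLreg T -> exactly 0 (\det T).
Proof.
have reg_det (M : 'M[L]_2) : mregular M -> regular (\det M).
  by move=> h; rewrite det2; apply: vbB; apply: reg_mul; apply: h.
move=> [u h h']; split; first exact: reg_det.
have e : \det T * \det (invmx T) = 1 by rewrite -det_mulmx mulmxV // det1.
have e0 : \det T 0 * \det (invmx T) 0 = 1.
  by have := @lcoefM_low _ 0 0 _ _ (reg_det _ h) (reg_det _ h'); rewrite e => <-.
by apply/eqP => T0; move/eqP: e0; rewrite T0 mul0r eq_sym oner_eq0.
Qed.
Lemma luptoE N (f : L) k : lupto N f k = if k <= N then f k else 0.
Proof.
by rewrite [LHS](@lseriesE _ _ (low f)) // => j hj; case: ifP => // _; apply: lowP.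
Qed.

(* An error of order 2 n in T is harmless since B has a pole of order at most n. *)
Lemma truncated_conj (n : nat) T B (T' := map_mx (@lupto F (2 * n%:Z - 1)) T) : (0 < n)%N ->
  GLreg T -> mvb (- n%:Z) B ->
  T' \in unitmx /\ mregular (T' *m B *m invmx T' - T *m B *m invmx T).
Proof.
move=> n0 gT hB; have [uT rT rT'] := gT.
pose E := T' - T; have eT' : T' = T + E by rewrite /E addrC subrK.
have hE : mvb (2 * n%:Z) E.
  by move=> a b k hk; rewrite !mxE lcoefB luptoE ifT ?subrr //; lia.
have hE0 : mregular E by apply: mvb_le hE; lia.
have gT' : GLreg T'.
  apply: GLreg_det; first by rewrite eT'; apply: mvbD.
  have -> : \det T' = \det T + (T 0 0 * E 1 1 + E 0 0 * T 1 1 + E 0 0 * E 1 1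
      - (T 0 1 * E 1 0 + E 0 1 * T 1 0 + E 0 1 * E 1 0)).
    by rewrite eT' !det2 !mx_addE; ring.
  apply: exactlyD_small; first exact: GLreg_exact.
  have h1 a b c d : vb (0 + 1) (T a b * E c d).
    by apply: (@vbM _ 0 1); [apply: rT | apply: vb_le (hE c d); lia].
  have h2 a b c d : vb (0 + 1) (E a b * T c d) by rewrite mulrC; apply: h1.
  have h3 a b c d : vb (0 + 1) (E a b * E c d).
    by apply: (@vbM _ 0 1); [apply: hE0 | apply: vb_le (hE c d); lia].
  by apply: vbB; apply: vbD => //; apply: vbD.
have [uT' rT1 rT1'] := gT'; split => //.
have -> : T' *m B *m invmx T' - T *m B *m invmx T =
    E *m B *m invmx T' - T *m B *m (invmx T *m E *m invmx T').
  have -> : invmx T *m E *m invmx T' = invmx T - invmx T'.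
    by rewrite /E mulmxBr mulmxBl mulVmx // mul1mx mulmxK.
  rewrite mulmxBr {1}eT' !mulmxDl; mxring.
have hEB : mregular (E *m B).
  by apply: mvb_le (mvbM hE hB); lia.
apply: mvbB; first exact: mreg_mul.
rewrite -mulmxA; apply: mreg_mul => //.
rewrite !mulmxA -(mulmxA _ E); apply: (mvb_le (M := - n%:Z + 2 * n%:Z)); first lia.
apply: mvbM.
  by rewrite -[- n%:Z]addr0; apply: mvbM.
by rewrite -[2 * _]addr0; apply: mvbM.
Qed.
(** At the deformed point: [A] is the framed formal series, [G] the modification, G^-1 A the series
    truncated in the gluing. Conjugating the gluing condition by [G] gives G H G^-1 + A B A^-1
    regular, while the variation of the formal solution contains - A dL A^-1 with the same polar
    part, so the singular terms cancel. *)
Lemma special_regular (n : nat) A G B H dA dL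
    (T' := map_mx (@lupto F (2 * n%:Z - 1)) (invmx G *m A)) : (0 < n)%N ->
  GLreg A -> GLreg G -> mvb (- n%:Z) B -> mregular (H + T' *m B *m invmx T') ->
  mregular dA -> mregular (dL - B) ->
  mregular (G *m H *m invmx G - (dA - A *m dL) *m invmx A).
Proof.
move=> n0 gA gG hB hH hdA hdL.
have gT : GLreg (invmx G *m A) by apply: GLreg_mul => //; apply: GLreg_inv.
have [_ hT] := truncated_conj n0 gT hB; rewrite -/T' in hT.
have [uG rG rG'] := gG; have [uA rA rA'] := gA.
set Q := T' *m B *m invmx T' in hH hT.
have eT : invmx (invmx G *m A) = invmx A *m G.
  have [u _ _] := gT; apply: (can_inj (mulKmx u)).
  by rewrite mulmxV // mulmxA mulmxK // mulVmx.
have -> : G *m H *m invmx G - (dA - A *m dL) *m invmx A =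
    G *m (H + Q) *m invmx G
    - G *m (Q - invmx G *m A *m B *m invmx (invmx G *m A)) *m invmx G
    - dA *m invmx A + A *m (dL - B) *m invmx A.
  rewrite eT !(mulmxDl, mulmxDr, mulmxN, mulNmx) !mulmxA mulmxV // mul1mx.
  rewrite -(mulmxA _ G) mulmxV // mulmx1; mxring.
apply: mvbD; last exact: mreg_conj.
apply: mvbB; last exact: mreg_mul.
by apply: mvbB; apply: mreg_conj.
Qed.
Lemma plain_regular A G H dA dL : GLreg A -> GLreg G -> mregular H ->
  mregular dA -> mregular dL ->
  mregular (G *m H *m invmx G - (dA - A *m dL) *m invmx A).
Proof.
move=> gA gG hH hdA hdL; have [_ _ rA'] := gA; have [_ rA _] := gA.
apply: mvbB; first exact: mreg_conj.
by apply: mreg_mul => //; apply: mvbB => //; apply: mreg_mul.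
Qed.

End SingularPart.

Lemma zeta_conj (T : fieldType) (x a b : T) : x != 0 -> 2%:R != 0 :> T ->
  mx2 1 1 x (- x) \in unitmx /\
  mx2 1 1 x (- x) *m mx2 a 0 0 b *m invmx (mx2 1 1 x (- x)) =
  mx2 ((a + b) / 2%:R) ((a - b) / 2%:R * x^-1) (x * ((a - b) / 2%:R)) ((a + b) / 2%:R).
Proof.
move=> x0 h2.
have d0 : 1 * (- x) - 1 * x != 0.
  by rewrite !mul1r -opprD oppr_eq0 -mulr2n -mulr_natl mulf_neq0.
have u : mx2 1 1 x (- x) \in unitmx by rewrite unitmx2.
split=> //; apply: (can_inj (mulmxK u)); rewrite mulmxKV // !mx2M.
by congr mx2; field; rewrite ?x0 ?h2.
Qed.

(** * Ramified points in the coordinate zeta *)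

Section Ramified.
Variable F : fieldType.
Hypothesis char0 : forall k : int, k != 0 -> k%:~R != 0 :> F.
Local Notation L := (laurent F).
Local Notation zeta_mx := (mx2 1 1 lX (- lX) : 'M[L]_2).
Local Notation ram_mx al be := (mx2 al be (lX * be) (al - lC 2^-1 * lX^-1) : 'M[L]_2).

Lemma lC2_neq0 : 2%:R != 0 :> L.
Proof. by rewrite -(rmorph_nat (@lC F)) fmorph_eq0 (char0 (k := 2)). Qed.
Lemma Mzeta_unit : zeta_mx \in unitmx.
Proof. by have [] := zeta_conj 0 0 (@lX_neq0 F) lC2_neq0. Qed.
(** The inverse of the matrix M_zeta has a factor 1/zeta, so regular exponents would not be enough:
    the odd combination (a - b)/2 is divided by zeta, whence the order 1. *)
Lemma Mzeta_conj (a b : L) : vb 1 a -> vb 1 b ->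
  mregular (zeta_mx *m mx2 a 0 0 b *m invmx (zeta_mx)).
Proof.
move=> ha hb; have [_ ->] := zeta_conj a b (@lX_neq0 F) lC2_neq0.
have hh (f : L) : vb 1 f -> vb 1 (f / 2%:R).
  move=> hf; have -> : f / 2%:R = lC (2%:R^-1) * f by rewrite fmorphV rmorph_nat mulrC.
  by apply: (@vbM _ 0 1) => //; apply: reg_lC.
have hD := hh _ (vbD ha hb); have hB := hh _ (vbB ha hb).
apply: mvb2.
- exact: vb_le hD.
- by apply: (@vbM _ 1 (-1)) => //; rewrite lXV; apply: vb_mono.
- by apply: reg_mul; [apply: reg_X | apply: vb_le hB].
- exact: vb_le hD.
Qed.
Lemma lsquare_ram_form (al be : L) :
  map_mx (@lsquare F) (ram_mx al be) = mx2 (lsquare al) (lsquare be)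
    (lX ^+ 2 * lsquare be) (lsquare al - lC 2^-1 * (lX ^+ 2)^-1).
Proof.
rewrite map_mx2 rmorphB !(rmorphM (@lsquare F)) (fmorphV (@lsquare F)) /=.
by rewrite lsquare_C !lsquare_X.
Qed.
(** Pulled back to zeta, M_zeta diagonalises the ramified form with eigenvalues alpha + zeta beta
    and alpha - zeta beta; the term - dx/(2x) of that form is exactly what cancels the derivative of
    M_zeta. *)
Lemma ram_equation (A Om : 'M[L]_2) (al be : L) : A \in unitmx ->
  gauge (@lderiv F) A Om = ram_mx al be ->
  let psi := map_mx (@lsquare F) A *m zeta_mx in
  map_mx (@lderiv F) psi + ((lC 2%:R * lX) *: map_mx (@lsquare F) Om) *m psi =
  psi *m mx2 (lC 2%:R * lX * (lsquare al + lX * lsquare be)) 0 0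
             (lC 2%:R * lX * (lsquare al - lX * lsquare be)).
Proof.
move=> u e psi; set t := lC 2%:R * lX.
have e1 : map_mx (@lderiv F) A + Om *m A = A *m ram_mx al be.
  by rewrite -e /gauge mulmxDr !mulmxA mulmxV // !mul1mx.
pose sq (M : 'M[L]_2) := map_mx (@lsquare F) M; pose R := ram_mx al be.
have e2 : map_mx (@lderiv F) (sq A) = t *: (sq A *m sq R - sq Om *m sq A).
  have -> : map_mx (@lderiv F) (sq A) = t *: sq (map_mx (@lderiv F) A).
    by apply/matrixP => a b; rewrite !mxE lderiv_lsquare.
  congr (_ *: _); rewrite /sq -!map_mxM -map_mxB; congr map_mx.
  by rewrite -e1 addrK.
have e3 : map_mx (@lderiv F) (zeta_mx) = mx2 0 0 1 (-1).
  have d1 := der1 (@lderivM F).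
  by rewrite map_mx2 (derN (@lderivD F)) lderivX d1.
rewrite /psi (mapD_mul (@lderivD F) (@lderivM F)) e2 e3 -/(sq A) -/(sq Om).
rewrite -!scalemxAl mulmxBl scalerBr mulmxA addrAC subrK.
rewrite -!mulmxA scalemxAr -mulmxDr; congr (_ *m _).
rewrite /sq lsquare_ram_form !mx2M mx2Z mx2D.
have x0 := @lX_neq0 F; have h2 := lC2_neq0.
rewrite /t !(fmorphV (@lC F)) !(rmorph_nat (@lC F)) /=.
move: (lX : L) (lsquare al) (lsquare be) x0 => x a b x0.
by congr mx2; field; rewrite ?x0 ?h2.
Qed.
End Ramified.

(** * Vanishing of global sections on the projective line *)

Section GlobalVanishing.
Variable F : fieldType.
Hypothesis hF : all_split F.
Local Notation K := {fraction {poly F}}.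

(** A polynomial vanishing to order 2 at infinity is zero; the order 2 is regularity of the form h
    dx there. *)
Lemma rational_form_eq0 (h : K) : (forall c, reg_at c h) ->
  vb 2 (lsubst lX^-1 h) -> h = 0.
Proof.
move=> hc; have [p ->] := reg_at_poly hF hc; rewrite (lsubst_tofrac _ (transc_inf hF)) => hi.
have [->|p0] := eqVneq p 0; first by rewrite tofrac0.
by have := vb_inf_size hi p0; have := size_poly_gt0 p; rewrite p0; lia.
Qed.
(** The order at infinity bounds the degree by k - 1, fewer than the k distinct roots. *)
Lemma rational_roots_eq0 (g : K) (k : nat) (q : 'I_k -> F) : injective q ->
  (forall c, reg_at c g) -> (forall j, vb 1 (lsubst (lC (q j) + lX) g)) ->
  vb (1 - k%:Z) (lsubst lX^-1 g) -> g = 0.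
Proof.
move=> qi hc; have [p ->] := reg_at_poly hF hc; rewrite (lsubst_tofrac _ (transc_inf hF)) => hq hi.
have [->|p0] := eqVneq p 0; first by rewrite tofrac0.
have hs := vb_inf_size hi p0.
have : (size (map q (enum 'I_k)) < size p)%N.
  apply: max_poly_roots => //; last by rewrite map_inj_uniq // enum_uniq.
  apply/allP => _ /mapP[j _ ->]; rewrite /root -ev_xfin0.
  by have := hq j; rewrite (lsubst_tofrac _ (transc_xfin _ hF)) => ->.
by rewrite size_map size_enum_ord; lia.
Qed.
End GlobalVanishing.

(** * Matrix identities and apparent singularities *)

Lemma gauge1 (T : fieldType) (D : T -> T) (A : 'M[T]_2) : D 0 = 0 -> D 1 = 0 ->
  gauge D 1%:M A = A.
Proof.
move=> d0 d1; rewrite /gauge invmx1 !mul1mx mulmx1 -[RHS]add0r; congr (_ + _).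
by apply/matrixP => a b; rewrite !mxE; case: eqP.
Qed.
Lemma lsumE (F : fieldType) N (a : nat -> F) k :
  lsum N a k = if N <= k then a (absz (k - N)%R) else 0.
Proof. by rewrite [LHS](@lseriesE _ _ N) // => j hj; rewrite leNgt hj. Qed.
Lemma unitmx_diag (T : fieldType) (x : T) : x != 0 -> mx2 1 0 0 x \in unitmx.
Proof. by move=> x0; rewrite unitmx2 mulr0 subr0 mul1r. Qed.

Section FirstRow.
Variables (T : fieldType) (D : T -> T).
Hypothesis DD : forall x y, D (x + y) = D x + D y.
Hypothesis DM : forall x y, D (x * y) = D x * y + x * D y.
Variables (P q1 q2 c d dP : T) (H : 'M[T]_2).
Hypotheses (P0 : P != 0) (q10 : q1 != 0).
Let G := mx2 1 0 q2 q1.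
Let Om := mx2 0 P^-1 c d.
Let Om1 := gauge D G Om.
Let Om1' := - (map_mx D H + (Om1 *m H - H *m Om1)).
Let N1 := P *: Om1' + dP *: Om1.

Lemma triangular_unit : G \in unitmx.
Proof. by rewrite unitmx2 mul1r mul0r subr0. Qed.
Lemma triangular_inv : invmx G = mx2 1 0 (- (q2 / q1)) q1^-1.
Proof.
rewrite invmx2 ?mul1r ?mul0r ?subr0 // mx2Z.
by congr mx2; field.
Qed.
Lemma gauge_00 : Om1 0 0 = q2 / P.
Proof.
rewrite /Om1 /gauge triangular_inv map_mx2 (der0 DD) (der1 DM) !mx2M mx2D mx2E.
by field.
Qed.
Lemma gauge_01 : Om1 0 1 = q1 / P.
Proof.
rewrite /Om1 /gauge triangular_inv map_mx2 (der0 DD) (der1 DM) !mx2M mx2D mx2E.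
by field.
Qed.
(** The pair (kappa, mu) is the first row of [N1] multiplied on the right by G^-1. *)
Definition kappa_of (N1 : 'M[T]_2) := N1 0 0 - N1 0 1 * q2 / q1.
Definition mu_of (N1 : 'M[T]_2) := N1 0 1 / q1.
(* In the frame of Omega the deformation has to fix the first row up to dP; the
   lower row (kappa_of, mu_of) is solved from the first row of N1. *)
Lemma first_row : let X := cov D Om (G *m H *m invmx G + mx2 0 0 (kappa_of N1) (mu_of N1)) in
  X 0 0 = 0 /\ X 0 1 = dP / P ^+ 2.
Proof.
have u := triangular_unit.
(* By gauge covariance the first row of this term is minus the first row of Om1' G^-1; the lower row
   adds it back through the entry 1/P, and the dP part of [N1] leaves only dP/P^2. *)
have e : cov D Om (G *m H *m invmx G) = - (G *m Om1' *m invmx G).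
  have := cov_gauge DD DM Om (G *m H *m invmx G) u.
  have -> : invmx G *m (G *m H *m invmx G) *m G = H.
    by rewrite !mulmxA mulVmx // mul1mx mulmxKV.
  rewrite -/Om1 => h; rewrite /Om1' mulmxN mulNmx opprK -/(cov D Om1 H) h.
  by rewrite !mulmxA mulmxV // mul1mx mulmxK.
have e0 : N1 0 0 = P * Om1' 0 0 + dP * Om1 0 0 by rewrite !mxE.
have e1 : N1 0 1 = P * Om1' 0 1 + dP * Om1 0 1 by rewrite !mxE.
rewrite gauge_00 in e0; rewrite gauge_01 in e1.
move=> X; rewrite /X (covD DD) e triangular_inv /kappa_of /mu_of e0 e1.
rewrite [Om1']mx2_eta; move: (Om1' 0 0) (Om1' 0 1) (Om1' 1 0) (Om1' 1 1) => w00 w01 w10 w11.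
rewrite /cov map_mx2 (der0 DD) !(mx2M, mx2N, mx2D) !mx2E.
by split; field; rewrite ?P0 ?q10.
Qed.
End FirstRow.

Section ApparentFrame.
Variable F : fieldType.
Local Notation L := (laurent F).

(** Here Q_1 = u X and Q_2 = t X + p near q, and n0, n1 expand the perturbed numerators. The two
    equations are the first-order conditions that q + eps dq stays a zero of B and that A takes the
    value p + eps dp there. They force mu to have polar part - dq/X and kappa + p mu - dp to vanish
    at q. *)
Lemma apparent_kappa_mu (u t n0 n1 : L) (p dp dq : F) :
  exactly 0 u -> regular t -> regular n0 -> regular n1 ->
  n1 0 + dq * u 0 = 0 -> n0 0 - dp + dq * t 0 = 0 ->
  let q1 := u * lX in let q2 := t * lX + lC p in
  let mu := n1 / q1 in let kappa := n0 - n1 * q2 / q1 in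
  regular (lX^-1 * (kappa + mu * lC p - lC dp)) /\ regular (mu + lX^-1 * lC dq).
Proof.
move=> hu ht h0 h1 e1 e0 q1 q2 mu kappa.
have u0 := exactly_neq0 hu; have x0 := @lX_neq0 F.
have vb1 (f : L) : regular f -> f 0 = 0 -> vb 1 f.
  by move=> hf f0 k hk; have [->|k0] := eqVneq k 0; [| apply: hf; lia].
have a1 : vb 1 (n1 + lC dq * u).
  apply: vb1; last by rewrite lcoefD lC_coefM.
  by apply: vbD => //; apply: reg_mul; [apply: reg_lC | case: hu].
have a2 : vb 1 (u^-1 * (n1 + lC dq * u)).
  by apply: (@vbM _ 0 1) => //; case: (exactlyV hu).
have a3 : vb 1 (n0 - lC dp + lC dq * t).
  apply: vb1; last by rewrite lcoefD lcoefB lC_coefM lC_coef.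
  by apply: vbD; [apply: vbB => //; apply: reg_lC | apply: reg_mul => //; apply: reg_lC].
have xi1 : vb (-1) (lX^-1 : L) by rewrite lXV; apply: vb_mono.
have e2 : mu + lX^-1 * lC dq = lX^-1 * (u^-1 * (n1 + lC dq * u)).
  by rewrite /mu /q1; field; rewrite x0 u0.
have e3 : kappa + mu * lC p - lC dp = n0 - lC dp + lC dq * t - (u^-1 * (n1 + lC dq * u)) * t.
  by rewrite /kappa /mu /q1 /q2; field; rewrite x0 u0.
split; last by rewrite e2; apply: (@vbM _ (-1) 1).
rewrite e3; apply: (@vbM _ (-1) 1) => //; apply: vbB => //.
exact: (@vbM _ 1 0).
Qed.
Lemma deriv_split (c : F) (p q : {poly F}) : p = q * ('X - c%:P) + p.[c]%:P -> p^`().[c] = q.[c].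
Proof.
move=> ->; rewrite derivD derivM derivC addr0 derivXsubC mulr1 hornerD hornerM.
by rewrite hornerXsubC subrr mulr0 add0r.
Qed.
End ApparentFrame.

Section RegAt.
Variable F : fieldType.
Hypothesis hF : all_split F.
Local Notation L := (laurent F).
Local Notation K := {fraction {poly F}}.
Implicit Types (u v : K) (c : F) (A B : 'M[K]_2).

Definition mreg_at c A := mregular (map_mx (lsubst (lC c + lX)) A).
Lemma reg_atD c u v : reg_at c u -> reg_at c v -> reg_at c (u + v).
Proof.
have [s sE] := lsubst_morph (transc_xfin c hF); rewrite /reg_at sE rmorphD => h1 h2.
exact: vbD.
Qed.
Lemma reg_atN c u : reg_at c u -> reg_at c (- u).
Proof.
have [s sE] := lsubst_morph (transc_xfin c hF); rewrite /reg_at sE rmorphN => h1.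
exact: vbN.
Qed.
Lemma reg_atM c u v : reg_at c u -> reg_at c v -> reg_at c (u * v).
Proof.
have [s sE] := lsubst_morph (transc_xfin c hF); rewrite /reg_at sE rmorphM => h1 h2.
exact: reg_mul.
Qed.
Lemma reg_at_tofrac c p : reg_at c (tofrac p).
Proof. by rewrite /reg_at (lsubst_tofrac _ (transc_xfin c hF)); apply/reg_ev/reg_xfin. Qed.
Lemma reg_at_inv c p : p.[c] != 0 -> reg_at c (tofrac p)^-1.
Proof.
have [s sE] := lsubst_morph (transc_xfin c hF); rewrite /reg_at sE fmorphV -sE => h.
rewrite (lsubst_tofrac _ (transc_xfin c hF)).
by have [] := exactlyV (ev_xfin_exact h).
Qed.
Lemma reg_at_sum c (I : Type) (r : seq I) (G : I -> K) :
  (forall i, reg_at c (G i)) -> reg_at c (\sum_(i <- r) G i).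
Proof.
move=> h; elim: r => [|i r IH]; last by rewrite big_cons; apply: reg_atD.
by rewrite big_nil -tofrac0; apply: reg_at_tofrac.
Qed.
Lemma mreg_at2 c (a b d e : K) : reg_at c a -> reg_at c b -> reg_at c d -> reg_at c e ->
  mreg_at c (mx2 a b d e).
Proof. by move=> ha hb hd he; rewrite /mreg_at map_mx2; apply: mvb2. Qed.
Lemma mreg_atM c A B : mreg_at c A -> mreg_at c B -> mreg_at c (A *m B).
Proof.
have [s sE] := lsubst_morph (transc_xfin c hF); rewrite /mreg_at sE map_mxM => h1 h2.
exact: mreg_mul.
Qed.
Lemma mreg_atD c A B : mreg_at c A -> mreg_at c B -> mreg_at c (A + B).
Proof.
have [s sE] := lsubst_morph (transc_xfin c hF); rewrite /mreg_at sE map_mxD => h1 h2.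
exact: mvbD.
Qed.
Lemma mreg_at_entry c A : mreg_at c A <-> forall a b, reg_at c (A a b).
Proof. by split=> h a b; have := h a b; rewrite mxE. Qed.
Lemma mreg_at_cov c A B : mreg_at c A -> mreg_at c B -> mreg_at c (cov (@rderiv F) A B).
Proof.
have ht := transc_xfin c hF; move=> hA hB.
have e1 : lderiv (lC c + lX) = 1 :> L by rewrite lderivD lderivC lderivX add0r.
have := @pullback_cov F (lC c + lX) A B ht.
rewrite /pullback e1 !scale1r /mreg_at => <-.
exact: (@mvb_cov _ 0).
Qed.
Lemma tr_reg_at c A : mreg_at c A -> reg_at c (\tr A).
Proof. by move=> /mreg_at_entry h; rewrite mxtrace2; apply: reg_atD. Qed.
End RegAt.

Lemma big_option (V : nmodType) (T : finType) (f : option T -> V) :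
  \sum_(i : option T) f i = f None + \sum_(t : T) f (Some t).
Proof.
rewrite (bigD1 None) //=; congr (_ + _).
rewrite (reindex_omap Some id) /=; first by apply: eq_bigl => t; rewrite eqxx.
by case.
Qed.
Lemma mx2_congr (T : Type) (a b c d a' b' c' d' : T) : a = a' -> b = b' -> c = c' -> d = d' ->
  mx2 a b c d = mx2 a' b' c' d'.
Proof. by move=> -> -> -> ->. Qed.
Lemma gauge_diag_01 (T : fieldType) (D : T -> T) (g a b c d : T) : D 0 = 0 -> g != 0 ->
  gauge D (mx2 1 0 0 g) (mx2 a b c d) 0 1 = b * g.
Proof.
move=> d0 g0; rewrite /gauge invmx2 ?mulr0 ?subr0 ?mul1r // map_mx2 d0.
by rewrite mx2Z !mx2M mx2D mx2E; field.
Qed.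
Lemma lower_frame (T : fieldType) (x y a b : T) : y != 0 ->
  invmx (mx2 1 0 0 y) *m mx2 1 0 a b *m mx2 1 0 0 x = mx2 1 0 (y^-1 * a) (y^-1 * b * x).
Proof.
move=> y0; rewrite invmx2 ?mulr0 ?subr0 ?mul1r // mx2Z !mx2M.
by congr mx2; field.
Qed.
Lemma lower_conj_diag (T : fieldType) (g c d : T) : g != 0 ->
  invmx (mx2 1 0 0 g) *m mx2 0 0 c d *m mx2 1 0 0 g = mx2 0 0 (g^-1 * c) d.
Proof.
move=> g0; rewrite invmx2 ?mulr0 ?subr0 ?mul1r // mx2Z !mx2M.
by congr mx2; field.
Qed.
Lemma gauge_solution (T : fieldType) (D : T -> T) (M A N : 'M[T]_2) : M \in unitmx ->
  gauge D M A = N -> map_mx D M + A *m M = M *m N.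
Proof. by move=> u <-; rewrite /gauge mulmxDr !mulmxA mulmxV // !mul1mx. Qed.
Lemma frame_conj (T : fieldType) (A A1 G H : 'M[T]_2) :
  A \in unitmx -> A1 \in unitmx -> G \in unitmx ->
  invmx A *m (G *m H *m invmx G) *m A =
  invmx A *m G *m A1 *m (invmx A1 *m H *m A1) *m invmx (invmx A *m G *m A1).
Proof.
move=> u u1 uG.
have -> : invmx (invmx A *m G *m A1) = invmx A1 *m invmx G *m A.
  have uu : invmx A *m G *m A1 \in unitmx by rewrite !unitmx_mul unitmx_inv u uG u1.
  apply: (can_inj (mulKmx uu)); rewrite mulmxV //.
  by rewrite !mulmxA mulmxK // mulmxK // mulVmx.
by rewrite !mulmxA mulmxK // mulmxK.
Qed.
Lemma apparent_frame_conj (T : fieldType) (A0 U G V X H dA dX : 'M[T]_2) :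
  A0 \in unitmx -> U \in unitmx -> X \in unitmx -> G = A0 *m U ->
  invmx A0 *m (G *m H *m invmx G + V - (dA *m X + A0 *m dX) *m invmx (A0 *m X)) *m A0 =
  U *m H *m invmx U - dX *m invmx X + invmx A0 *m (V *m A0 - dA).
Proof.
move=> u uU uX ->; have eV (B : 'M[T]_2) : B \in unitmx -> invmx (A0 *m B) = invmx B *m invmx A0.
  move=> uB; have uu : A0 *m B \in unitmx by rewrite unitmx_mul u uB.
  by apply: (can_inj (mulKmx uu)); rewrite mulmxV // !mulmxA mulmxK // mulmxV.
apply: (can_inj (mulKmx u)); rewrite !eV // !mulmxA mulmxV // mul1mx.
rewrite !(mulmxDl, mulmxDr, mulmxN, mulNmx) !mulmxA mulmxV // !mul1mx.
by rewrite !mulmxKV // (mulmxK uX); mxring.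
Qed.

Section ApparentRegular.
Variable F : fieldType.
Local Notation L := (laurent F).
Variables (p dp dq : F) (U H X dX : 'M[L]_2) (kappa mu : L).
Let A0 : 'M[L]_2 := mx2 1 0 (lC p) lX.
Let W := (mx2 0 0 (lC dp) (- lC dq) *m X + A0 *m dX) *m invmx (A0 *m X).
(** The lower row of the matrix multiplying [X] in [W] is the variation of (p, X), namely (dp, - dq)
    because delta(X) = - dq. In the frame [A0] it combines with (kappa, mu) into precisely the two
    quantities assumed regular. *)
Lemma apparent_frame_regular G : G = A0 *m U -> GLreg U -> GLreg X -> mregular H -> mregular dX ->
  regular (lX^-1 * (kappa + mu * lC p - lC dp)) -> regular (mu + lX^-1 * lC dq) ->
  mregular (invmx A0 *m (G *m H *m invmx G + mx2 0 0 kappa mu - W) *m A0).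
Proof.
move=> eG gU gX hH hdX h1 h2; have x0 := @lX_neq0 F.
have hd : 1 * lX - 0 * lC p != 0 :> L by rewrite mul0r subr0 mul1r.
have u : A0 \in unitmx by rewrite unitmx2.
have [uU _ _] := gU; have [uX _ rX] := gX.
rewrite (apparent_frame_conj _ _ _ _ u uU uX eG); apply: mvbD.
  by apply: mvbB; [apply: mreg_conj | apply: mreg_mul].
have -> : invmx A0 *m (mx2 0 0 kappa mu *m A0 - mx2 0 0 (lC dp) (- lC dq)) =
    mx2 0 0 (lX^-1 * (kappa + mu * lC p - lC dp)) (mu + lX^-1 * lC dq).
  rewrite invmx2 // mul0r subr0 mul1r -!scalemxAl !mx2M mx2N mx2D mx2M mx2Z.
  move: (lX : L) (lC p) (lC dp) (lC dq) x0 => x a b c x0.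
  by apply: mx2_congr; field.
by apply: mvb2 => //; apply: vb0.
Qed.
End ApparentRegular.

(** (1 0; p 1) equals (1 0; p x) diag(1, 1/x), so [B] is conjugated by diag(1, x). This puts the
    solution at q_j in the frame in which the apparent singularity disappears. *)
Lemma apparent_frame_split (T : fieldType) (p x : T) (B : 'M[T]_2) : x != 0 ->
  mx2 1 0 p 1 *m B *m mx2 1 0 0 x =
  mx2 1 0 p x *m mx2 (B 0 0) (x * B 0 1) (x^-1 * B 1 0) (B 1 1).
Proof.
move=> x0; rewrite {1}[B]mx2_eta !mx2M.
by apply: mx2_congr; field.
Qed.
Lemma apparent_frame_det (T : fieldType) (x : T) (B : 'M[T]_2) : x != 0 ->
  \det (mx2 (B 0 0) (x * B 0 1) (x^-1 * B 1 0) (B 1 1)) = \det B.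
Proof. by move=> x0; rewrite !det2 !mx2E; field. Qed.
Lemma conjD (T : fieldType) (A B X Y : 'M[T]_2) :
  A *m (X + Y) *m B = A *m X *m B + A *m Y *m B.
Proof. by rewrite mulmxDr mulmxDl. Qed.
Lemma dlog_mulr (T : fieldType) (A M dA dL : 'M[T]_2) : A \in unitmx -> M \in unitmx ->
  (dA *m M - A *m M *m dL) *m invmx (A *m M) = (dA - A *m (M *m dL *m invmx M)) *m invmx A.
Proof.
move=> uA uM; have u : A *m M \in unitmx by rewrite unitmx_mul uA uM.
apply: (can_inj (mulmxK u)); rewrite mulmxKV // [RHS]mulmxA mulmxKV //.
by rewrite mulmxBl !mulmxA mulmxKV.
Qed.
Lemma map_scale_entry (U : Type) (T : fieldType) (f : U -> T) (N : 'M[U]_2) (k : T) A a b :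
  map_mx f N = k *: A -> f (N a b) = k * A a b.
Proof. by move=> h; have := congr1 (fun B : 'M[T]_2 => B a b) h; rewrite !mxE. Qed.
Lemma conj_diag_lower (T : fieldType) (g : T) (A : 'M[T]_2) : g != 0 ->
  A = mx2 0 0 (A 1 0) (A 1 1) ->
  invmx (mx2 1 0 0 g) *m A *m mx2 1 0 0 g = mx2 0 0 (g^-1 * A 1 0) (A 1 1).
Proof. by move=> g0 e; rewrite {1}e lower_conj_diag. Qed.
Lemma tr_conjM (T : fieldType) (A X Z : 'M[T]_2) : A \in unitmx ->
  \tr (invmx A *m X *m A *m (invmx A *m Z *m A)) = \tr (X *m Z).
Proof.
by move=> u; rewrite -!mulmxA mulKVmx // mxtrace_mulC -!mulmxA mulmxV // mulmx1.
Qed.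
Lemma lmono_coef (F : fieldType) (a : F) d k : (lC a * lX ^ d : laurent F) k = if k == d then a else 0.
Proof. by rewrite -lmonoE. Qed.

(** * The parameter space *)

Lemma derive_affine (K : numFieldType) (V : normedModType K) (f : V -> K) (m v : V) :
  (forall h : K, f (h *: v + m) = h * f v + f m) -> 'D_v f m = f v.
Proof.
move=> e; rewrite /derive; apply: cvg_lim; first exact: norm_hausdorff.
apply: cvg_near_cst; near=> h.
have h0 : h != 0 by near: h; apply: nbhs_dnbhs_neq.
by rewrite /= e addrK -[_ *: _]/(h^-1 * (h * _)) mulKf.
Unshelve. all: by end_near. Qed.
Lemma near_neq_of_cvg (K : numFieldType) (V : normedModType K) (f : V -> K) (m : V) (k : K) :
  differentiable f m -> f m != k -> \forall p \near m, f p != k.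
Proof.
move=> /differentiable_continuous hc h.
have hc1 : {for m, continuous (fun p => f p - k)}.
  by apply: continuousB => //; apply: cst_continuous.
have h1 : f m - k != 0 by rewrite subr_eq0.
have H := cvgr_neq0 _ hc1 h1.
near=> p; rewrite -subr_eq0; near: p; exact: H.
Unshelve. all: by end_near. Qed.

Section Concrete.
Variables (R : realType) (S : setting R).
Local Notation C := (complex R).
Local Notation L := (laurent C).
Local Notation K := {fraction {poly C}}.
Local Notation I := (option 'I_(nu S)).
Local Notation pole := (@pole R S).
Local Notation kind := (@kind R S).
Local Notation V := (pspace S).
Local Notation n2 := (ntot S - 2)%N.
Local Notation sub xi := (map_mx (lsubst xi)).
Local Notation mx_sq := (map_mx (@lsquare C)).
Local Notation lcov := (cov (@lderiv C)).
Local Notation pz i := (pole i)%:Z.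
Local Notation n3 := (ntot S - 3)%N.
Local Notation ra i := (is_ra (kind i)).
Local Notation Omega_nf E := (fun p => Omega p (nf E p)).
Local Notation dLam D E i := (mx2 (ldint_at D (ddir D (Defs.center i)) (lamder E i true)) 0 0
  (ldint_at D (ddir D (Defs.center i)) (lamder E i false))).
Implicit Types v m : V.

Lemma all_split_complex : all_split C.
Proof. by move=> p; have [s e] := @closed_field_poly_normal (complex R : closedFieldType) p; exists s. Qed.
Lemma complex_char0 (k : int) : k != 0 -> k%:~R != 0 :> C.
Proof. by rewrite intr_eq0. Qed.

Let hF : all_split C. Proof. exact: all_split_complex. Qed.
Let ch0 : forall k : int, k != 0 -> k%:~R != 0 :> C. Proof. exact: complex_char0. Qed.
Definition differentiable_at (a : V -> C) m := differentiable (a : V -> C^o) m.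

Lemma cval_diff m k : differentiable_at (fun p => cval p k) m.
Proof. exact: (@differentiable_coord C 1 #|Defs.coord S| m ord0 (enum_rank k)). Qed.
Lemma dir_cval v m k : dir v (fun p => cval p k) m = cval v k.
Proof.
apply: (@derive_affine C V (fun p => cval p k)) => h.
by rewrite /cval !mxE.
Qed.
Lemma near_neq a m (k : C) : differentiable_at a m -> a m != k -> \forall p \near m, a p != k.
Proof. exact: (@near_neq_of_cvg C V a m k). Qed.
Definition dbl v m (a : V -> C) := derivable (a : V -> C^o) m v.
(** Germs at [m] with the derivative along [v]. Derivability in that one direction is already stable
    under the algebraic operations required. *)
Lemma derivation_exists v m : exists D : derivation_at C m,
  [/\ forall a, ddir D a = dir v a m,
      forall Q : V -> Prop, (\forall p \near m, Q p) -> near_pt D Q &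
      forall a, differentiable_at a m -> dble D a].
Proof.
have c1 (Q : V -> Prop) : (forall p, Q p) -> \forall p \near m, Q p.
  by move=> h; near=> x; apply: h.
have c2 (Q1 Q2 Q3 : V -> Prop) : (forall p, Q1 p -> Q2 p -> Q3 p) ->
    (\forall p \near m, Q1 p) -> (\forall p \near m, Q2 p) -> \forall p \near m, Q3 p.
  by move=> h h1 h2; near=> x; apply: h; near: x.
have c3 (Q : V -> Prop) : (\forall p \near m, Q p) -> Q m by apply: nbhs_singleton.
have c4 a b : (\forall p \near m, a p = b p) -> dbl v m a -> dbl v m b.
  by move=> h d; exact: (@near_eq_derivable _ V (C^o) a b m v h d).
have c5 a b : (\forall p \near m, a p = b p) -> dir v a m = dir v b m.
  by move=> h; exact: (@near_eq_derive _ V (C^o) a b m v h).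
have c6 (k : C) : dbl v m (fun _ => k) by exact: (@derivable_cst _ V (C^o) k m v).
have c7 (k : C) : dir v (fun _ => k) m = 0 by exact: (@derive_cst _ V (C^o) k m v).
have c8 a b : dbl v m a -> dbl v m b -> dbl v m (fun p => a p + b p).
  by move=> ha hb; exact: (@derivableD _ V (C^o) a b m v ha hb).
have c9 a b : dbl v m a -> dbl v m b ->
    dir v (fun p => a p + b p) m = dir v a m + dir v b m.
  by move=> ha hb; exact: (@deriveD _ V (C^o) a b m v ha hb).
have c10 a b : dbl v m a -> dbl v m b -> dbl v m (fun p => a p * b p).
  by move=> ha hb; exact: (@derivableM _ V a b m v ha hb).
have c11 a b : dbl v m a -> dbl v m b ->
    dir v (fun p => a p * b p) m = dir v a m * b m + a m * dir v b m.
  move=> ha hb; rewrite addrC [dir v a m * _]mulrC.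
  exact: (@deriveM _ V a b m v ha hb).
have c12 a : a m != 0 -> dbl v m a -> dbl v m (fun p => (a p)^-1).
  by move=> a0 ha; exact: (@derivableV _ V a m v a0 ha).
pose D := DerivationAt c1 c2 c3 c4 c5 c6 c7 c8 c9 c10 c11 c12.
exists D; split=> // a h; exact: (@diff_derivable _ V (C^o) a m v h).
Unshelve. all: by end_near. Qed.
Lemma cst_diff m (k : C) : differentiable_at (fun _ => k) m.
Proof. exact: (@differentiable_cst C V (C^o) k m). Qed.
Lemma tv_cases (i : 'I_(nu S)) :
  (exists k, (fun p : V => tv p i) = (fun p => cval p k) /\ is_time k) \/
  (exists t, (fun p : V => tv p i) = (fun _ => t)).
Proof.
rewrite /tv; case: (nat_of_ord i == 0%N); first by right; exists 0.
case: (nat_of_ord i == 1%N); first by right; exists 1.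
case: insub => [i'|]; last by right; exists (tra i).
by left; exists (ct i').
Qed.
Lemma tv_diff m i : differentiable_at (fun p => tv p i) m.
Proof.
by case: (tv_cases i) => [[k [-> _]]|[t ->]]; [apply: cval_diff | apply: cst_diff].
Qed.
Lemma thv_diff m i e l : differentiable_at (fun p => thv p i e l) m.
Proof. by rewrite /thv; case: insub => [l'|]; [apply: cval_diff | apply: cst_diff]. Qed.
Lemma thrav_diff m i l : differentiable_at (fun p => thrav p i l) m.
Proof. by rewrite /thrav; case: insub => [l'|]; [apply: cval_diff | apply: cst_diff]. Qed.
Lemma sub_diff m a b : differentiable_at a m -> differentiable_at b m ->
  differentiable_at (fun p => a p - b p) m.
Proof. by move=> ha hb; exact: (@differentiableB C V (C^o) a b m ha hb). Qed.
Lemma near_distinct m a b : differentiable_at a m -> differentiable_at b m -> a m <> b m ->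
  \forall p \near m, a p <> b p.
Proof.
move=> ha hb h.
have h0 : a m - b m != 0 by rewrite subr_eq0; apply/eqP.
near=> p; apply/eqP; rewrite -subr_eq0; near: p.
exact: (near_neq (sub_diff ha hb) h0).
Unshelve. all: by end_near. Qed.
Lemma near_forall (I : finType) m (Q : I -> V -> Prop) :
  (forall i, \forall p \near m, Q i p) -> \forall p \near m, forall i, Q i p.
Proof. by move=> h; exact: (@filter_forall _ _ Q (nbhs m) _ h). Qed.
Lemma near_if (P : Prop) m (Q : V -> Prop) :
  (P -> \forall p \near m, Q p) -> \forall p \near m, P -> Q p.
Proof.
move=> h; have [/h H|hp] := pselect P; last by near=> p.
by near=> p => _; near: p.
Unshelve. all: by end_near. Qed.
Lemma near_inj (J : finType) (f : J -> V -> C) m : (forall i, differentiable_at (f i) m) ->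
  injective (f^~ m) -> \forall p \near m, injective (f^~ p).
Proof.
move=> hf hm; have H : \forall p \near m, forall i j, i != j -> f i p <> f j p.
  apply: near_forall => i; apply: near_forall => j; apply: near_if => /eqP ij.
  by apply: near_distinct => // /hm.
near=> p; move=> i j e; apply/eqP/negPn/negP => ij.
by have /(_ i j ij) : forall i j, i != j -> f i p <> f j p by near: p.
Unshelve. all: by end_near. Qed.
Lemma near_in_dom m : in_dom m -> \forall p \near m, in_dom p.
Proof.
move=> [h1 h2 h3 h4 h5].
have H1 : \forall p \near m, injective (tv p) by apply: near_inj (tv_diff m) h1.
have H2 : \forall p \near m, injective (qv p).
  by apply: (near_inj (f := fun j p => qv p j)) h2 => j; apply: cval_diff.
have H3 : \forall p \near m, forall i j, qv p j <> tv p i.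
  apply: near_forall => i; apply: near_forall => j.
  exact: near_distinct (cval_diff m (cq j)) (tv_diff m i) (h3 i j).
have H4 : \forall p \near m, forall i, kind i = Un -> thv p i true 0 <> thv p i false 0.
  apply: near_forall => i; apply: near_if => k.
  exact: near_distinct (thv_diff m i true 0) (thv_diff m i false 0) (h4 i k).
have H5 : \forall p \near m, forall i, kind i = Ra -> thrav p i 1 <> 0.
  apply: near_forall => i; apply: near_if => k.
  exact: near_distinct (thrav_diff m i 1) (cst_diff m 0) (h5 i k).
by near=> p; split; near: p.
Unshelve. all: by end_near. Qed.

Record tangent_at m v (D : @derivation_at V C m) : Prop := TangentAt {
  tangent_dir : forall a, ddir D a = dir v a m;
  tangent_dom : near_pt D (@in_dom R S);
  tangent_neq : forall a k, differentiable_at a m -> a m != k -> near_pt D (fun p => a p != k);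
  tangent_dble : forall a, differentiable_at a m -> dble D a }.
Lemma tangent_exists m v : in_dom m -> exists D : @derivation_at V C m, tangent_at v D.
Proof.
move=> hm; have [D [h1 h2 h3]] := derivation_exists v m; exists D; split=> //.
  by apply: h2; apply: near_in_dom.
by move=> a k ha hk; apply: h2; apply: near_neq.
Qed.

Variable E : solutions S.
Hypothesis hE : admissible E.

(** * Variation of the normal form *)

Section NormalForm.
Variables (m v : pspace S).
Hypothesis hm : in_dom m.
Variable D : @derivation_at V C m.
Hypothesis htan : tangent_at v D.
Let hnear : near_pt D (@in_dom R S). Proof. exact: tangent_dom htan. Qed.
Let hneq a k : differentiable_at a m -> a m != k -> near_pt D (fun p => a p != k).
Proof. exact: (tangent_neq htan). Qed.
Let hdble a : differentiable_at a m -> dble D a. Proof. exact: (tangent_dble htan). Qed.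
Lemma dble_hol a : holomorphic a -> dble D a.
Proof. by move=> h; apply: hdble; apply: h. Qed.
Definition pts (i : 'I_(nu S) + 'I_n3) (p : V) : C :=
  match i with inl i => tv p i | inr j => qv p j end.
Lemma pts_diff i : differentiable_at (pts i) m.
Proof. by case: i => [i|j]; [apply: tv_diff | apply: cval_diff]. Qed.
Lemma dpts i : dble D (pts i).
Proof. exact/hdble/pts_diff. Qed.
Lemma pts_distinct i j : i <> j -> near_pt D (fun p => pts i p <> pts j p).
Proof.
move=> ij; apply: (nearS _ hnear) => p [h1 h2 h3 _ _].
case: i j ij => [i|i] [j|j] ij /=.
- by move=> /h1 e; apply: ij; rewrite e.
- by move=> e; apply: (h3 i j).
- exact: h3.
- by move=> /h2 e; apply: ij; rewrite e.
Qed.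

Local Notation chart := (chart D pts).
Local Notation kf := (kf D pts).
Local Notation hkf := (hkf D pts).
Local Notation mkf := (mkf D pts).

(** The last hypothesis is delta(x) = 0 for x = a + h. Taking h = X gives the coordinate at a moving
    point, h = X^2 the one at a fixed ramified point. A singular point either is [a] identically or
    stays away from it near [m], so the valuation of its distance to x is constant. *)
Lemma chart_affine (a : V -> C) (h : L) (N : int) c : dble D a -> exactly N h -> 0 < N ->
  (forall p, transc (lC (a p) + h)) ->
  (forall i, (forall p, pts i p = a p) \/ near_pt D (fun p => pts i p <> a p)) ->
  lC (ddir D a) = lC c * lderiv h -> chart (fun p => lC (a p) + h) c.
Proof.
move=> da hh N0 ht hp e; have ga := good_lC da; have gh := good_cst D h.
have gx := goodD ga gh.
split=> // [|i].
  by rewrite ldeltaD // ldelta_lC // ldelta_cst e subrr.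
case: (hp i) => [ei|ne].
  apply: (@ugood_near _ _ _ D (fun _ => h)); first by apply: nearT => p; rewrite ei; ring.
  exact/ugood_cst/(exactly_neq0 hh).
split; first by apply: goodB => //; apply/good_lC/dpts.
exists 0; apply: (nearS _ ne) => p np.
have -> : lC (a p) + h - lC (pts i p) = lC (a p - pts i p) + h by rewrite rmorphB /=; ring.
apply: exactlyD_small; first by apply: exactly_mono; rewrite subr_eq0; apply/eqP => /esym.
by case: hh => hh _; apply: vb_le hh; lia.
Qed.
Lemma chart_const (h : L) (N : int) : exactly N h -> N < 0 -> transc h -> chart (fun _ => h) 0.
Proof.
move=> hh N0 ht; split=> //; first exact: good_cst.
  by rewrite ldelta_cst rmorph0 mul0r oppr0.
move=> i; split; first by apply: goodB; [apply: good_cst | apply/good_lC/dpts].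
exists N; apply: nearT => p; apply: exactlyD_small => //.
by apply: vbN; apply: vb_le (reg_lC _); lia.
Qed.
Lemma exactlyX : exactly 1 (lX : L). Proof. exact: (exactlyXz C 1). Qed.
Lemma exactlyX2 : exactly 2 (lX ^+ 2 : L). Proof. exact: (exactlyXz C 2). Qed.
Lemma chart_pt k : chart (fun p => lC (pts k p) + lX) (ddir D (pts k)).
Proof.
apply: (chart_affine (dpts k) exactlyX) => //.
- by move=> p; apply: transc_xfin.
- by move=> i; have [->|ik] := pselect (i = k); [left | right; apply: pts_distinct].
- by rewrite lderivX mulr1.
Qed.
Lemma chart_xloc i : chart (fun p => xloc p i) (ddir D (Defs.center i)).
Proof.
case: i => [k|]; first exact: (chart_pt (inl k)).
rewrite (_ : ddir D (Defs.center None) = 0); last exact: dir_cst.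
apply: (chart_const (exactlyV exactlyX)) => //; exact: transc_inf.
Qed.
Lemma chart_q j : chart (fun p => xfin (qv p j)) (ddir D (fun p => qv p j)).
Proof. exact: (chart_pt (inr j)). Qed.
(** Only unramified points are free, so a ramified point has zero speed and zeta can be held fixed
    together with x. *)
Lemma tv_ra k (p : V) : kind (Some k) = Ra -> tv p k = tv m k.
Proof.
move=> hk; rewrite /tv; case: (nat_of_ord k == 0%N) => //; case: (nat_of_ord k == 1%N) => //.
by case: insubP => // u; rewrite hk andbF.
Qed.
Lemma chart_xram i : kind i = Ra -> chart (fun p => xram p i) 0.
Proof.
case: i => [k|] hk; last first.
  by apply: (chart_const (exactlyV exactlyX2)) => //; apply: transc_inf2.
apply: (chart_affine (dpts (inl k)) exactlyX2) => //.
- by move=> p; apply: transc_xfin2.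
- by move=> i; have [->|ik] := pselect (i = inl k); [left | right; apply: pts_distinct].
rewrite rmorph0 mul0r (@dir_near _ _ _ D _ (fun _ => tv m k)) ?dir_cst ?rmorph0 //.
by apply: nearT => p /=; apply: tv_ra.
Qed.
(** Charts at ordinary points; they show that the variation of Omega acquires no pole outside the
    t_i and q_j. *)
Lemma chart_gen c : (forall i, pts i m <> c) -> chart (fun _ => lC c + lX) 0.
Proof.
move=> hc; apply: (@chart_affine (fun _ => c) lX 1) => //.
- exact: dble_cst.
- exact: exactlyX.
- by move=> p; apply: transc_xfin.
- move=> i; right; have h : pts i m != c by apply/eqP/hc.
  by apply: (nearS _ (hneq (pts_diff i) h)) => p /eqP.
by rewrite dir_cst rmorph0 mul0r.
Qed.
Lemma kf_uniq f d1 d2 : kf f d1 -> kf f d2 -> d1 = d2.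
Proof.
move=> h1 h2; have hx := chart_xloc None.
have [_ e1] := h1 _ _ hx; have [_ e2] := h2 _ _ hx.
have [s sE] := lsubst_morph (chart_transc hx m).
by apply: (fmorph_inj s); rewrite -sE -e1 -e2.
Qed.
Lemma hkf_poly (q : V -> {poly C}) n : holomorphic_poly q ->
  (forall p, in_dom p -> (size (q p) <= n)%N) -> hkf (fun p => tofrac (q p)).
Proof.
move=> hq hs; eexists; apply: (@kf_poly _ _ _ D _ pts q n).
  by apply: (nearS _ hnear).
by move=> k; apply: dble_hol.
Qed.
Lemma hkf_ext f g : (forall p, f p = g p) -> hkf f -> hkf g.
Proof. by move=> e [d h]; exists d; apply: kf_near h; apply: nearT. Qed.
Lemma hkf_const (q : {poly C}) : hkf (fun _ => tofrac q).
Proof.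
eexists; apply: (@kf_poly _ _ _ D _ pts (fun _ => q) (size q)); first exact: nearT.
by move=> k; apply: dble_cst.
Qed.
Lemma hkfN f : hkf f -> hkf (fun p => - f p).
Proof.
move=> h; apply: (hkf_ext _ (hkfM (hkf_const (-1)) h)) => p.
by rewrite tofracN tofrac1 mulN1r.
Qed.
Lemma hkf_pole k n : hkf (fun p => (tofrac ('X - (pts k p)%:P) ^+ n)^-1).
Proof. exact: (hkf_linV dpts). Qed.
Lemma nf_P p : in_dom p -> nf_size (nf E p).
Proof. by move=> hp; have [_ _ _ /(_ p hp)[[]]] := hE. Qed.
Lemma hol_nf : holomorphic_nf E. Proof. by case: hE. Qed.
Lemma hol_sol : holomorphic_solutions E. Proof. by case: hE. Qed.
Lemma hkf_c0 : hkf (fun p => c0 p (nf E p)).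
Proof.
have [hCD hT hI _] := hol_nf; rewrite /c0.
apply: hkfD; first apply: hkfD; first apply: hkfD.
- apply: hkf_sum => i; apply: hkfM; last exact: (hkf_pole (inl i)).
  apply: (@hkf_poly _ (pole (Some i))); first by case: (hCD i).
  by move=> p /nf_P[h _ _ _]; case: (h i).
- apply: hkf_sum => j; apply: hkfM.
    apply: (@hkf_poly _ 1) => [k p hp|p _]; last by rewrite size_polyC; case: (_ != _).
    case: k => [|k]; last first.
      rewrite (_ : (fun _ => _) = fun _ => 0); first exact: cst_diff.
      by apply: funext => p'; rewrite coefC.
    rewrite (_ : (fun _ => _) = fun p' => pv p' j); first exact: cval_diff.
    by apply: funext => p'; rewrite coefC.
  by apply: hkf_ext (hkf_pole (inr j) 1) => p; rewrite expr1.
- by apply: (@hkf_poly _ (ntot S - 3)) => // p /nf_P[].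
apply: (@hkf_ext (fun p => tofrac ('X ^+ (ntot S - 3)) * tofrac (Cinf (nf E p)))).
  by move=> p; rewrite tofracM.
apply: hkfM; first exact: hkf_const.
by apply: (@hkf_poly _ (pole None)) => // p /nf_P[].
Qed.
Lemma hkf_d0 : hkf (fun p => d0 p (nf E p)).
Proof.
have [hCD _ _ hD] := hol_nf; rewrite /d0.
apply: hkfD; first apply: hkfD.
- apply: hkf_sum => i; apply: hkfM; last exact: (hkf_pole (inl i)).
  apply: (@hkf_poly _ (pole (Some i))); first by case: (hCD i).
  by move=> p /nf_P[h _ _ _]; case: (h i).
- apply: hkfN; apply: hkf_sum => j.
  by apply: hkf_ext (hkf_pole (inr j) 1) => p; rewrite expr1.
by apply: (@hkf_poly _ (pole None).-1) => // p /nf_P[].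
Qed.
Lemma tofrac_Ppoly (p : V) : tofrac (Ppoly p) = \prod_(i < nu S) tofrac ('X - (tv p i)%:P) ^+ pole (Some i).
Proof. by rewrite /Ppoly rmorph_prod; apply: eq_bigr => i _; rewrite rmorphXn. Qed.
Lemma Ppoly_neq0 (p : V) : tofrac (Ppoly p) != 0 :> K.
Proof.
rewrite tofrac_Ppoly; apply/prodf_neq0 => i _.
by rewrite expf_neq0 // tofrac_eq0 polyXsubC_eq0.
Qed.
Lemma ugood_Ppoly xi c : chart xi c -> ugood D (fun p => lsubst (xi p) (tofrac (Ppoly p))).
Proof.
move=> hx; apply: (@ugood_near _ _ _ D (fun p => \prod_(i < nu S)
    lsubst (xi p) (lin pts (inl i) p) ^+ pole (Some i))).
  apply: nearT => p; have [s ->] := lsubst_morph (chart_transc hx p).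
  by rewrite tofrac_Ppoly rmorph_prod; apply: eq_bigr => i _; rewrite rmorphXn.
apply: ugood_prod => i; apply: ugoodXn; exact: ugood_lin hx.
Qed.
Lemma hkf_Ppoly : hkf (fun p => tofrac (Ppoly p)).
Proof.
apply: (@hkf_ext (fun p => \prod_(i <- index_enum 'I_(nu S)) lin pts (inl i) p ^+ pole (Some i))).
  by move=> p; rewrite tofrac_Ppoly.
elim: (index_enum _) => [|i r IH].
  by apply: hkf_ext (hkf_const 1) => p; rewrite big_nil tofrac1.
apply: (@hkf_ext (fun p => lin pts (inl i) p ^+ pole (Some i) *
    \prod_(j <- r) lin pts (inl j) p ^+ pole (Some j))).
  by move=> p; rewrite big_cons.
have h1 : hkf (fun p => lin pts (inl i) p ^+ pole (Some i)).
  by eexists; exact: (kf_Xn (pole (Some i)) (kf_lin dpts (inl i))).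
exact: hkfM h1 IH.
Qed.
(** Only the first row of the variation is made explicit; its lower row exists by holomorphy of the
    coefficients and stays unspecified. *)
Lemma mkf_Omega dP : kf (fun p => tofrac (Ppoly p)) dP ->
  exists dOm, [/\ mkf (Omega_nf E) dOm, dOm 0 0 = 0 &
    dOm 0 1 = - dP / tofrac (Ppoly m) ^+ 2].
Proof.
move=> hP; have [dc hc] := hkf_c0; have [dd hd] := hkf_d0.
exists (mx2 0 (- dP / tofrac (Ppoly m) ^+ 2) dc dd); rewrite !mx2E; split=> //.
apply: mkf2 => //; first exact: kf0.
by apply: kfV => // xi c; apply: ugood_Ppoly.
Qed.
End NormalForm.

(** * Variation of the formal solutions *)

Section Frames.

(** Treats infinity like the finite points: passage to the frame used at t_i is conjugation by this
    matrix, trivial at finite t_i. *)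
Definition frame (k : nat) (i : I) : 'M[K]_2 := if i is None then Gmx k else 1%:M.
Lemma Gmx_unit (k : nat) : (Gmx k : 'M[K]_2) \in unitmx.
Proof.
apply: unitmx_diag; apply: expf_neq0; by rewrite tofrac_eq0 polyX_eq0.
Qed.
Lemma frame_unit k i : frame k i \in unitmx.
Proof. by case: i => [i|]; [apply: unitmx1 | apply: Gmx_unit]. Qed.
Lemma conn_atE k i (A : 'M[K]_2) : conn_at k i A = gauge (@rderiv C) (frame k i) A.
Proof.
case: i => [i|]; last exact: erefl.
by symmetry; apply: gauge1; [apply: der0 (rderivD hF) | apply: der1 (rderivM hF)].
Qed.
Lemma endo_atE i (H : 'M[K]_2) : endo_at i H = invmx (frame 1 i) *m H *m frame 1 i.
Proof. by case: i => [i|] //=; rewrite invmx1 mul1mx mulmx1. Qed.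
Lemma Gtilde_atE Q2 (m : pspace S) i :
  Gtilde_at Q2 m i = invmx (frame (ntot S - 2) i) *m Gtilde Q2 m *m frame 1 i.
Proof. by case: i => [i|] //=; rewrite invmx1 mul1mx mulmx1. Qed.
End Frames.
Local Notation conjf i X := (invmx (frame n2 i) *m X *m frame n2 i).
Local Notation dc D i := (ddir D (Defs.center i)).

Section FormalSolutions.
Variables (m v : pspace S).
Hypothesis hm : in_dom m.
Variable D : @derivation_at V C m.
Hypothesis htan : tangent_at v D.
Let hnear : near_pt D (@in_dom R S). Proof. exact: tangent_dom htan. Qed.
Local Notation chart := (chart D pts).
Local Notation mkf := (mkf D pts).
Implicit Types (i : I) (p : V) (j : 'I_n3).

Lemma mdelta_cst0 (M : 'M[L]_2) : mdelta_at D 0 (fun _ => M) = 0.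
Proof. by apply/matrixP => a b; rewrite !mxE ldelta_cst rmorph0 mul0r oppr0. Qed.
(** At infinity the term M^-1 dM of the change of frame does not depend on the parameters, so the
    variation of the connection is merely conjugated. *)
Lemma delta_conn dOm xi c i : mkf (Omega_nf E) dOm -> chart xi c ->
  (i = None -> c = 0 /\ forall p, xi p = xi m) ->
  mgood D (fun p => pullback (xi p) (conn_at n2 i (Omega p (nf E p)))) /\
  mdelta_at D c (fun p => pullback (xi p) (conn_at n2 i (Omega p (nf E p)))) =
    pullback (xi m) (conjf i dOm).
Proof.
move=> hO hx hi; have [g1 g2] := mkf_pullback hx hO.
case: i hi => [i|] hi; first by rewrite /= invmx1 mul1mx mulmx1.
have [c0 hxi] := hi erefl; rewrite c0 in g2 *.
have ht := chart_transc hx m.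
pose G := map_mx (lsubst (xi m)) (Gmx n2).
have uG : G \in unitmx by apply: sub_unit => //; apply: Gmx_unit.
pose M1 := invmx G *m map_mx (@lderiv C) G.
have e : near_pt D (fun p => M1 + invmx G *m pullback (xi p) (Omega p (nf E p)) *m G =
    pullback (xi p) (conn_at n2 (None : I) (Omega p (nf E p)))).
  apply: nearT => p; rewrite hxi.
  rewrite -[conn_at n2 None _]/(gauge (@rderiv C) (Gmx n2) _).
  rewrite (pullback_gauge _ ht (Gmx_unit _)).
  by rewrite /gauge.
have gc M := @mgood_cst _ _ _ D M.
have g3 := mgoodM (mgoodM (gc (invmx G)) g1) (gc G).
have g4 := mgoodD (gc M1) g3.
split; first exact: mgood_near e g4.
rewrite -(mdelta_near _ g4 e) mdeltaD // !mdeltaM //; last exact: mgoodM.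
rewrite !mdelta_cst0 !mul0mx !mulmx0 !add0r !addr0 g2.
exact: esym (pullback_conj _ _ ht).
Qed.
Lemma delta_OmL dOm i : mkf (Omega_nf E) dOm ->
  mgood D (OmL E i) /\ mdelta_at D (dc D i) (OmL E i) =
    pullback (xloc m i) (conjf i dOm).
Proof.
move=> hO; apply: (delta_conn hO (chart_xloc htan i)) => ei.
split; last by rewrite ei.
by rewrite ei; apply: dir_cst.
Qed.
Lemma delta_OmL_ram dOm i : mkf (Omega_nf E) dOm -> kind i = Ra ->
  mgood D (OmL_ram E i) /\ mdelta_at D 0 (OmL_ram E i) =
    pullback (xram m i) (conjf i dOm).
Proof.
move=> hO ki; apply: (delta_conn hO (chart_xram htan ki)) => ei.
by split=> //; rewrite ei.
Qed.
Lemma delta_OmL_q dOm j : mkf (Omega_nf E) dOm ->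
  mgood D (OmL_q E j) /\ mdelta_at D (ddir D (fun p => qv p j)) (OmL_q E j) =
    pullback (xfin (qv m j)) dOm.
Proof. by move=> hO; apply: (mkf_pullback (chart_q htan j) hO). Qed.
Lemma hol_good (f : V -> L) N : (forall k, holomorphic (fun p => f p k)) ->
  (forall p, in_dom p -> vb N (f p)) -> good D f.
Proof.
move=> hf hN; split; first by exists N; apply: (nearS _ hnear).
by move=> k; apply: (dble_hol hm htan).
Qed.
Lemma hol_mgood (f : V -> 'M[L]_2) : holomorphic_mx f ->
  (forall p, in_dom p -> mregular (f p)) -> mgood D f.
Proof. by move=> hf hN a b; apply: (@hol_good _ 0) => [k|p hp]; [apply: hf | apply: hN]. Qed.
Lemma pole_gt0 i : (0 < pole i)%N.
Proof.
case ki: (kind i); first by rewrite (pole_reg ki).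
  by apply: ltnW; apply: pole_irr; rewrite ki.
by apply: ltnW; apply: pole_irr; rewrite ki.
Qed.
Lemma unram_sol p i : in_dom p -> ~~ ra i -> unram_solution E i p.
Proof. by move=> hp ki; have [_ _ _ /(_ p hp)[_ _ h _ _]] := hE; apply: h. Qed.
Lemma ram_sol p i : in_dom p -> ra i -> ram_solution E i p.
Proof. by move=> hp ki; have [_ _ _ /(_ p hp)[_ _ _ h _]] := hE; apply: h. Qed.
Lemma Xi_series p i : in_dom p -> mregular (Xi E i p) /\ mcoef 0 (Xi E i p) = 1%:M.
Proof.
move=> hp; case ki: (ra i); last first.
  have [_ h1 h2 _] := unram_sol hp (negbT ki); split=> [a b|].
    have [<-|ab] := eqVneq a b; first by rewrite h1; apply: reg_lC.
    by apply: vb_le (h2 a b ab).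
  apply/matrixP => a b; rewrite !mxE; have [<-|ab] := eqVneq a b; first by rewrite h1.
  by rewrite (h2 a b ab).
by have [_ h _ _] := ram_sol hp ki.
Qed.
Lemma Phi_unit p i : in_dom p -> Phi E i p \in unitmx.
Proof. by move=> hp; have [_ _ _ /(_ p hp)[_ /(_ i)[]]] := hE. Qed.
Lemma PhiXi_GL p i : in_dom p -> GLreg (PhiXi E i p).
Proof.
move=> hp; apply: GLreg_mul; first exact/GLreg_lmx/Phi_unit.
have [h1 h2] := Xi_series i hp; apply: GLreg_series; split=> //.
by rewrite h2 unitmx1.
Qed.
Lemma good_PhiXi i : mgood D (PhiXi E i).
Proof.
have [hPhi hXi _ _ _] := hol_sol; apply: mgoodM.
  move=> a b; apply: (@good_near _ _ _ D (fun p => lC (Phi E i p a b))).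
    by apply: nearT => p; rewrite mxE.
  by apply: good_lC; apply: (dble_hol hm htan); apply: hPhi.
by apply: hol_mgood => // p hp; case: (Xi_series i hp).
Qed.
Lemma ths_thv p i e l : in_dom p -> ~~ ra i -> (l < pole i)%N -> ths E i e l p = thv p i e l.
Proof. by move=> hp ki; have [h _ _ _] := unram_sol hp ki; apply: h. Qed.
(** The coordinates stop at l = n_i - 2, so at n_i - 1 the lookup falls back on the fixed constant:
    residue exponents do not vary, as differentiating primitives with logarithms requires. *)
Lemma thv_last p i e : ~~ ra i -> thv p i e (pole i).-1 = th0 i e.
Proof.
move=> ki; rewrite /thv; case: insubP => // u hu _; exfalso; clear u; move: hu.
by rewrite /dim_un; case: (kind i) ki => //; rewrite ltnn.
Qed.
Lemma good_lamder i e : ~~ ra i -> good D (lamder E i e).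
Proof.
have [_ _ hths _ _] := hol_sol; move=> ki.
apply: (@hol_good _ (- pz i)) => [k|p _ k hk]; last by rewrite lsumE leNgt hk.
rewrite (_ : (fun _ => _) = fun p => if - pz i <= k then ths E i e (absz (k + pz i)%R) p else 0).
  by case: (- pz i <= k); [apply: hths | move=> p _; apply: cst_diff].
by apply: funext => p; rewrite lsumE opprK.
Qed.
Lemma res_lamder i e : ~~ ra i -> ddir D (fun p => lres (lamder E i e p)) = 0.
Proof.
move=> ki; rewrite (@dir_near _ _ _ D _ (fun _ => th0 i e)) ?dir_cst //.
apply: (nearS _ hnear) => p hp; have n0 := pole_gt0 i.
rewrite /lres lsumE ifT; last by lia.
have -> : absz (-1 - - pz i)%R = (pole i).-1 by lia.
by rewrite ths_thv ?thv_last //; lia.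
Qed.
Lemma cov_unram dOm i : mkf (Omega_nf E) dOm -> ~~ ra i ->
  lcov (OmL E i m)
    (dlog_at D (dc D i) (PhiXi E i) (lamder E i true) (lamder E i false)) =
  - pullback (xloc m i) (conjf i dOm).
Proof.
move=> hO ki; have [g1 <-] := delta_OmL i hO.
apply: cov_dlog => //; try exact: good_lamder; try exact: res_lamder.
- exact: good_PhiXi.
- by case: (PhiXi_GL i hm).
by apply: (nearS _ hnear) => p hp; have [_ _ _ h] := unram_sol hp ki.
Qed.
Lemma lsquare_xloc p i : lsquare (xloc p i) = xram p i.
Proof.
case: i => [k|]; first by rewrite /= /xfin rmorphD /= lsquare_C lsquare_X.
by rewrite /= fmorphV /= lsquare_X.
Qed.
Lemma OmL_ramE p i : OmL_ram E i p = (lC 2%:R * lX) *: mx_sq (OmL E i p).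
Proof. by rewrite /OmL_ram -lsquare_xloc pullback_lsquare. Qed.
Lemma psi_ramE p i : psi_ram E i p = mx_sq (PhiXi E i p) *m Mzeta R.
Proof.
rewrite /psi_ram /PhiXi map_mxM.
have -> // : mx_sq (lmx (Phi E i p)) = lmx (Phi E i p).
by apply/matrixP => a b; rewrite !mxE /= lsquare_C.
Qed.
(** Separation of even and odd exponents: the derivative of the exponent in zeta is 2 zeta (alpha +
    s zeta beta) evaluated at x = zeta^2. *)
Lemma lamder_ramE p i (s : C) : s ^+ 2 = 1 -> lamder_ram E i s p =
  lC 2%:R * lX * (lsquare (lsum (- pz i) (fun l => thras E i (2 * l) p / 2%:R))
    + lC s * lX * lsquare (lsum (- pz i) (fun l => thras E i (2 * l).+1 p / 2%:R))).
Proof.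
move=> hs; apply: laurentP => k; have n0 := pole_gt0 i.
have h2 : 2%:R != 0 :> C by rewrite pnatr_eq0.
rewrite -mulrA lC_coefM lX_coefM lcoefD -mulrA lC_coefM lX_coefM !lsquareE !lsumE.
case: (boolP (2 %| k - 1)%Z) => hk.
  have -> : (2 %| k - 1 - 1)%Z = false by lia.
  rewrite mulr0 addr0; case: (leP (1 - 2 * pz i) k) => hle.
    rewrite ifT; last by lia.
    have -> : absz (k - (1 - 2 * pz i))%R = (2 * absz (((k - 1) %/ 2)%Z - - pz i)%R)%N by lia.
    by rewrite exprM hs expr1n mul1r mulrC divfK.
  by rewrite ifF ?mulr0 //; lia.
have -> : (2 %| k - 1 - 1)%Z by lia.
rewrite add0r; case: (leP (1 - 2 * pz i) k) => hle.
  rewrite ifT; last by lia.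
  have -> : absz (k - (1 - 2 * pz i))%R = (2 * absz (((k - 1 - 1) %/ 2)%Z - - pz i)%R).+1 by lia.
  by rewrite exprSr exprM hs expr1n mul1r mulrCA [2%:R * _]mulrC divfK.
by rewrite ifF ?mulr0 //; lia.
Qed.
Lemma ram_eq p i : in_dom p -> ra i ->
  map_mx (@lderiv C) (psi_ram E i p) + OmL_ram E i p *m psi_ram E i p =
  psi_ram E i p *m mx2 (lamder_ram E i 1 p) 0 0 (lamder_ram E i (-1) p).
Proof.
move=> hp ki; have [_ _ h _] := ram_sol hp ki; have [u _ _] := PhiXi_GL i hp.
rewrite psi_ramE OmL_ramE (ram_equation ch0 u h) !lamder_ramE ?expr1n ?sqrrN ?expr1n //.
by rewrite rmorphN rmorph1 !mul1r mulN1r mulNr.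
Qed.
Lemma lsquare_GL (A : 'M[L]_2) : GLreg A -> GLreg (mx_sq A).
Proof.
have h (f : L) : regular f -> regular (lsquare f) by move=> hf; apply: (@vb_lsquare _ 0).
move=> [u h1 h2]; split; first by rewrite map_unitmx.
  by move=> a b; rewrite mxE; apply: h.
by rewrite -map_invmx => a b; rewrite mxE; apply: h.
Qed.
Lemma good_psi_ram i : mgood D (psi_ram E i).
Proof.
apply: (@mgood_near _ _ _ D (fun p => mx_sq (PhiXi E i p) *m Mzeta R)).
  by apply: nearT => p; rewrite psi_ramE.
apply: mgoodM; last exact: mgood_cst.
move=> a b; apply: (@good_near _ _ _ D (fun p => lsquare (PhiXi E i p a b))).
  by apply: nearT => p; rewrite [RHS]mxE.
exact/good_lsquare/good_PhiXi.
Qed.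
Lemma good_lamder_ram i s : ra i -> good D (lamder_ram E i s).
Proof.
have [_ _ _ hth _] := hol_sol; move=> ki.
have hb p : vb (1 - 2 * pz i) (lamder_ram E i s p).
  by move=> k hk; rewrite lsumE leNgt hk.
split; first by exists (1 - 2 * pz i); apply: nearT.
move=> k; case: (leP (1 - 2 * pz i) k) => hk; last first.
  apply: (@dble_near _ _ _ _ (fun _ => 0)); last exact: dble_cst.
  by apply: nearT => p; rewrite hb.
pose l := absz (k - (1 - 2 * pz i))%R.
apply: (@dble_near _ _ _ _ (fun p => s ^+ l * thras E i l p)).
  by apply: nearT => p; rewrite lsumE hk.
by apply: dbleM; [apply: dble_cst | apply: (dble_hol hm htan); apply: hth].
Qed.
Lemma thras_thrav p i l : in_dom p -> ra i -> (l <= 2 * pole i - 2)%N ->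
  thras E i l p = thrav p i l.
Proof. by move=> hp ki; have [h _ _ _] := ram_sol hp ki; apply: h. Qed.
Lemma thrav_last p i : ra i -> thrav p i (2 * pole i - 2) = thra0 i.
Proof.
move=> ki; rewrite /thrav; case: insubP => // u hu _; exfalso; clear u; move: hu.
by rewrite /dim_ra ki ltnn.
Qed.
Lemma res_lamder_ram i s : ra i -> ddir D (fun p => lres (lamder_ram E i s p)) = 0.
Proof.
move=> ki; rewrite (@dir_near _ _ _ D _ (fun _ => s ^+ (2 * pole i - 2) * thra0 i)) ?dir_cst //.
apply: (nearS _ hnear) => p hp; have n0 := pole_gt0 i.
rewrite /lres lsumE ifT; last by lia.
have -> : absz (-1 - (1 - 2 * pz i))%R = (2 * pole i - 2)%N by lia.
by rewrite thras_thrav ?thrav_last.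
Qed.
Lemma ra_kind i : ra i -> kind i = Ra. Proof. by case: (kind i). Qed.
Lemma psi_ram_unit p i : in_dom p -> psi_ram E i p \in unitmx.
Proof.
move=> hp; rewrite psi_ramE unitmx_mul; have [u _ _] := lsquare_GL (PhiXi_GL i hp).
by rewrite u (Mzeta_unit ch0).
Qed.
Lemma cov_ram dOm i : mkf (Omega_nf E) dOm -> ra i ->
  lcov (OmL_ram E i m)
    (dlog_at D 0 (psi_ram E i) (lamder_ram E i 1) (lamder_ram E i (-1))) =
  - pullback (xram m i) (conjf i dOm).
Proof.
move=> hO ki; have [g1 <-] := delta_OmL_ram hO (ra_kind ki).
apply: cov_dlog => //; try exact: good_lamder_ram; try exact: res_lamder_ram.
- exact: good_psi_ram.
- exact: psi_ram_unit.
by apply: (nearS _ hnear) => p hp; apply: ram_eq.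
Qed.
Lemma app_sol p j : in_dom p -> apparent_solution E j p.
Proof. by move=> hp; have [_ _ _ /(_ p hp)[_ _ _ _ h]] := hE; apply: h. Qed.
Lemma Xiq_GL p j : in_dom p -> GLreg (Xiq E j p).
Proof.
move=> hp; have [h1 h2 _] := app_sol j hp; apply: GLreg_series; split.
  by move=> a b; case: (h1 a b).
by rewrite h2 unitmx1.
Qed.
Lemma good_Xiq j : mgood D (Xiq E j).
Proof.
have [_ _ _ _ h] := hol_sol; apply: hol_mgood => // p hp.
by case: (Xiq_GL j hp).
Qed.
Lemma good_pv j : good D (fun p => lC (pv p j)).
Proof. by apply: good_lC; apply: (tangent_dble htan); apply: cval_diff. Qed.
Lemma good_psi_q j : mgood D (psi_q E j).
Proof.
apply: mgoodM; last exact: mgood_cst.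
apply: mgoodM; last exact: good_Xiq.
by apply: mgood2; try exact: good_cst; apply: good_pv.
Qed.
Lemma cov_q dOm j : mkf (Omega_nf E) dOm ->
  lcov (OmL_q E j m)
    (dlog_at D (ddir D (fun p => qv p j)) (psi_q E j) (fun _ => 0) (fun _ => 0)) =
  - pullback (xfin (qv m j)) dOm.
Proof.
move=> hO; have [g1 <-] := delta_OmL_q j hO.
apply: cov_dlog => //; try exact: good_cst; try exact: dir_cst.
- exact: good_psi_q.
- rewrite !unitmx_mul !unitmx2 !mul0r !subr0 !mul1r oner_neq0 lX_neq0 /= andbT.
  by have [] := Xiq_GL j hm.
apply: (nearS _ hnear) => p hp; have [_ _ ->] := app_sol j hp.
by rewrite (_ : mx2 0 0 0 0 = 0) ?mulmx0 //; apply: mx2P; rewrite mx2E mxE.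
Qed.
End FormalSolutions.

(** * Pole orders *)

Section Poles.
Variable m : pspace S.
Hypothesis hm : in_dom m.
Implicit Types (i : I) (j : 'I_n3).

Lemma ntotE : ntot S = (pole None + \sum_(k < nu S) pole (Some k))%N.
Proof. exact: big_option. Qed.
Lemma ntot_ge3 : (3 <= ntot S)%N.
Proof.
rewrite ntotE; have h0 := @pole_gt0 None; have hn := nu_ge2 S.
suff : (nu S <= \sum_(k < nu S) pole (Some k))%N by lia.
rewrite -{1}[nu S]card_ord -sum1_card; apply: leq_sum => k _; exact: pole_gt0.
Qed.
Lemma lsum_vb N (a : nat -> C) : vb N (lsum N a).
Proof. by move=> k hk; rewrite lsumE leNgt hk. Qed.
(** The order is read off the formal normal form: Om = A N A^-1 - A' A^-1 with [A] invertible over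
    power series and [N] of pole order at most n_i. *)
Lemma OmL_mvb i : mvb (- pz i) (OmL E i m).
Proof.
have n0 := @pole_gt0 i; have [u rA rA'] := PhiXi_GL i hm.
have key (N : 'M[L]_2) : mvb (- pz i) N ->
    map_mx (@lderiv C) (PhiXi E i m) + OmL E i m *m PhiXi E i m = PhiXi E i m *m N ->
    mvb (- pz i) (OmL E i m).
  move=> hN e.
  have -> : OmL E i m = PhiXi E i m *m N *m invmx (PhiXi E i m)
     - map_mx (@lderiv C) (PhiXi E i m) *m invmx (PhiXi E i m).
    by rewrite -e mulmxDl mulmxK // addrAC subrr add0r.
  apply: mvbB.
    rewrite -[- _]addr0; apply: mvbM => //; rewrite -[- _]add0r; exact: mvbM.
  by apply: (mvb_le (M := 0)); [lia | apply: mreg_mul => //; apply: mreg_lderiv].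
case ki: (ra i).
  have [_ _ h _] := ram_sol hm ki.
  apply: (key _ _ (gauge_solution u h)).
  have k1 : (1 < pole i)%N by apply: pole_irr; rewrite (ra_kind ki).
  apply: mvb2; try exact: lsum_vb.
    apply: vb_le (vbM (@vb_mono _ 1 1) (lsum_vb _)); lia.
  apply: vbB; first exact: lsum_vb.
  have h1 : vb (0 + -1) (lC 2^-1 * lX^-1 : L).
    by apply: vbM; [apply: reg_lC | rewrite lXV; apply: vb_mono].
  by apply: vb_le h1; lia.
have [_ _ _ h] := unram_sol hm (negbT ki).
by apply: key h; apply: mvb2 => //; apply: lsum_vb.
Qed.
Lemma ev_Ppoly (xi : L) : ev xi (Ppoly m) = \prod_(k < nu S) (xi - lC (tv m k)) ^+ pole (Some k).
Proof.
rewrite /Ppoly rmorph_prod; apply: eq_bigr => k _.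
by rewrite rmorphXn rmorphB /= evX evC.
Qed.
Lemma lsubst_Pinv (xi : L) : transc xi -> lsubst xi (tofrac (Ppoly m))^-1 = (ev xi (Ppoly m))^-1.
Proof. by move=> h; have [s sE] := lsubst_morph h; rewrite sE fmorphV -sE lsubst_tofrac. Qed.
Lemma exactly_Ppoly k : exactly (pole (Some k))%:Z (ev (lC (tv m k) + lX) (Ppoly m)).
Proof.
have [tinj _ _ _ _] := hm; rewrite ev_Ppoly.
have := @exactly_prod C _ (index_enum 'I_(nu S)) xpredT
  (fun l => (if l == k then 1 else 0 : int) *+ pole (Some l))
  (fun l => (lC (tv m k) + lX - lC (tv m l)) ^+ pole (Some l)).
rewrite (bigD1 k) //= eqxx big1 ?addr0 => [|l /negPf ->]; last by rewrite mul0rn.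
rewrite natz; apply=> l _; apply: exactlyXn.
have -> : lC (tv m k) + lX - lC (tv m l) = lC (tv m k - tv m l) + lX :> L by rewrite rmorphB /=; ring.
case: eqP => [->|kl]; first by rewrite subrr rmorph0 add0r; apply: exactlyX.
apply: exactlyD_small; last exact: vb_mono.
by apply: exactly_mono; rewrite subr_eq0; apply/eqP => /tinj e; apply: kl.
Qed.
Lemma exactly_Ppoly_inf : exactly (- (\sum_(k < nu S) pole (Some k))%N%:Z) (ev lX^-1 (Ppoly m)).
Proof.
rewrite ev_Ppoly.
have := @exactly_prod C _ (index_enum 'I_(nu S)) xpredT
  (fun l => (-1 : int) *+ pole (Some l)) (fun l => (lX^-1 - lC (tv m l)) ^+ pole (Some l)).
rewrite -(big_morph (fun n : nat => (-1 : int) *+ n) (mulrnDr (-1 : int)) (mulr0n (-1 : int))).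
rewrite mulNrn natz; apply=> l _; apply: exactlyXn.
apply: exactlyD_small; first by rewrite lXV; apply/exactly_mono/oner_neq0.
by apply/vbN/reg_lC.
Qed.
Lemma Gmx_sub k : map_mx (lsubst lX^-1) (Gmx k) = mx2 1 0 0 (lX^-1 ^+ k) :> 'M[L]_2.
Proof.
have ht := transc_inf hF; have [s sE] := lsubst_morph ht.
have e1 : lsubst lX^-1 (1 : K) = 1 by rewrite sE rmorph1.
have e0 : lsubst lX^-1 (0 : K) = 0 by rewrite sE rmorph0.
have ek : lsubst lX^-1 (tofrac 'X ^+ k : K) = lX^-1 ^+ k.
  by rewrite -tofracXn (lsubst_tofrac _ ht) rmorphXn /= evX.
rewrite map_mx2; exact: (mx2_congr e1 e0 e0 ek).
Qed.
Lemma OmL_01 i : exactly (- pz i) (OmL E i m 0 1).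
Proof.
case: i => [k|].
  have -> : OmL E (Some k) m 0 1 = (ev (lC (tv m k) + lX) (Ppoly m))^-1.
    rewrite -lsubst_Pinv; last exact: transc_xfin.
    by rewrite !mxE /= lderivD lderivC lderivX add0r mul1r.
  exact/exactlyV/exactly_Ppoly.
have ht := transc_inf hF.
have -> : OmL E None m 0 1 = (lderiv lX^-1 * (ev lX^-1 (Ppoly m))^-1) * lX^-1 ^+ n2.
  rewrite /OmL /Omega_loc /Omega_at /= (pullback_gauge _ ht (Gmx_unit _)).
  rewrite Gmx_sub /Omega (pullback_mx2) gauge_diag_01 ?lsubst_Pinv //.
    exact: der0 (@lderivD C).
  by rewrite expf_neq0 // invr_eq0 lX_neq0.
rewrite (lderiv_Xinv C).
have e2 : exactly (-2) (- lX ^ (-2) : L).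
  by have [h1 h2] := exactlyXz C (-2); split; [apply: vbN | rewrite lcoefN oppr_eq0].
have := exactlyM (exactlyM e2 (exactlyV exactly_Ppoly_inf)) (exactlyXn n2 (exactlyV exactlyX)).
have := ntot_ge3; have := ntotE; set a := (\sum_(k < _) _)%N => e h.
rewrite mulNrn !natz opprK.
(* The three terms come from dx, from 1/P and from the twist of E_(n-2); their sum is minus the pole
   order at infinity because [ntot] is the sum of all n_i. *)
by have -> : -2 + a%:Z - n2%:Z = - (pole None)%:Z by lia.
Qed.
Lemma exactly_lsquare N (f : L) : exactly N f -> exactly (2 * N) (lsquare f).
Proof. by move=> [h h0]; split; [apply: vb_lsquare | rewrite lsquare_even]. Qed.
Lemma exactly_2X : exactly 1 (lC 2%:R * lX : L).
Proof.
have h : exactly 0 (lC 2%:R : L) by apply: exactly_mono; rewrite pnatr_eq0.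
exact: (exactlyM h exactlyX).
Qed.
Lemma mvb_lsquare N (A : 'M[L]_2) : mvb N A -> mvb (2 * N) (mx_sq A).
Proof. by move=> h a b; rewrite mxE; apply: vb_lsquare. Qed.
Lemma scale_lsquareE (t : L) (A : 'M[L]_2) a b :
  (t *: mx_sq A) a b = t * lsquare (A a b).
Proof. by rewrite !mxE. Qed.
Lemma OmL_ram_mvb i : mvb (- (2 * pz i - 1)) (OmL_ram E i m).
Proof.
have h := mvbZ (proj1 exactly_2X) (mvb_lsquare (@OmL_mvb i)).
have e : 1 + 2 * - pz i = - (2 * pz i - 1) by lia.
by rewrite e -OmL_ramE in h.
Qed.
Lemma OmL_ram_01 i : exactly (- (2 * pz i - 1)) (OmL_ram E i m 0 1).
Proof.
rewrite OmL_ramE scale_lsquareE.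
have := exactlyM exactly_2X (exactly_lsquare (OmL_01 i)).
by have -> : 1 + 2 * - pz i = - (2 * pz i - 1) by lia.
Qed.
Definition Q1poly : {poly C} := \prod_(j < ntot S - 3) ('X - (qv m j)%:P).
Lemma Q1_root c : (Q1poly.[c] == 0) = [exists j, c == qv m j].
Proof.
rewrite /Q1poly horner_prod; apply/prodf_eq0/existsP => [[j _]|[j hj]].
  by rewrite hornerXsubC subr_eq0; exists j.
by exists j => //; rewrite hornerXsubC subr_eq0.
Qed.
Lemma Q1_neq0 : Q1poly != 0. Proof. by apply/monic_neq0/monic_prod_XsubC. Qed.
Lemma size_Q1 : size Q1poly = (ntot S - 3).+1.
Proof.
rewrite /Q1poly size_prod_XsubC; congr _.+1.
by rewrite -[RHS](size_enum_ord (ntot S - 3)) enumT.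
Qed.

Variable Q2 : {poly C}.
Hypothesis hQ2 : (size Q2 <= ntot S - 3)%N.
Lemma Gtilde_sub (xi : L) : transc xi ->
  map_mx (lsubst xi) (Gtilde Q2 m) = mx2 1 0 (ev xi Q2) (ev xi Q1poly).
Proof.
move=> ht; have [s sE] := lsubst_morph ht.
have e1 : lsubst xi (1 : K) = 1 by rewrite sE rmorph1.
have e0 : lsubst xi (0 : K) = 0 by rewrite sE rmorph0.
rewrite /Gtilde map_mx2; exact: (mx2_congr e1 e0 (lsubst_tofrac _ ht) (lsubst_tofrac _ ht)).
Qed.
Lemma det_low (a b : L) : \det (mx2 1 0 a b) = b.
Proof. by rewrite det2 !mx2E; ring. Qed.
Lemma GLreg_low (a b : L) : regular a -> exactly 0 b -> GLreg (mx2 1 0 a b).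
Proof.
move=> ha hb; apply: GLreg_det; last by rewrite det_low.
by apply: mvb2 => //; [apply: reg_lC | case: hb].
Qed.
Lemma GLreg_Gtilde c : (forall j, c <> qv m j) -> GLreg (map_mx (lsubst (lC c + lX)) (Gtilde Q2 m)).
Proof.
move=> hc; rewrite Gtilde_sub; last exact: transc_xfin.
apply: GLreg_low; first by apply/reg_ev/reg_xfin.
apply: ev_xfin_exact; rewrite Q1_root; apply/existsP => -[j /eqP]; exact: hc.
Qed.
(** The zeros of the determinant Q_1 are the q_j, which avoid the finite t_i. At infinity the lower
    right entry is X^(n-2) Q_1(1/X)/X, of valuation (n-2) - (n-3) - 1 = 0: this is how the twist n -
    2 drops to 1. *)
Lemma GLreg_Gtilde_at i : GLreg (map_mx (lsubst (xloc m i)) (Gtilde_at Q2 m i)).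
Proof.
case: i => [k|].
  by apply: GLreg_Gtilde => j; have [_ _ h _ _] := hm; move=> e; apply: (h k j).
have ht := transc_inf hF; have [s sE] := lsubst_morph ht.
rewrite /Gtilde_at sE !map_mxM map_invmx -sE Gtilde_sub //.
rewrite !Gmx_sub expr1.
have x0 : lX^-1 != 0 :> L by rewrite invr_eq0 lX_neq0.
have -> : invmx (mx2 1 0 0 (lX^-1 ^+ n2)) *m mx2 1 0 (ev lX^-1 Q2) (ev lX^-1 Q1poly) *m mx2 1 0 0 lX^-1 =
    mx2 1 0 (lX ^+ n2 * ev lX^-1 Q2) (lX ^+ n2 * ev lX^-1 Q1poly * lX^-1) :> 'M[L]_2.
  have e1 : (lX^-1 ^+ n2)^-1 = lX ^+ n2 :> L by rewrite -exprVn invrK.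
  have y0 : lX^-1 ^+ n2 != 0 :> L by rewrite expf_neq0.
  by rewrite lower_frame // e1.
have ge3 := ntot_ge3.
have ex2 : exactly n2%:Z (lX ^+ n2 : L) by have := exactlyXn n2 exactlyX; rewrite natz.
have vbev (p : {poly C}) n : (size p <= n.+1)%N -> vb (- n%:Z) (ev lX^-1 p : L).
  move=> hp k hk; rewrite ev_inf; case: leP => // _.
  by rewrite nth_default //; apply: leq_trans hp _; lia.
apply: GLreg_low.
  have h : vb (- n3%:Z) (ev lX^-1 Q2 : L).
    by apply: vbev; apply: leq_trans hQ2 _.
  have e : 0 <= n2%:Z + - n3%:Z by lia.
  exact: (vb_le e (vbM (proj1 ex2) h)).
have h : exactly (- n3%:Z) (ev lX^-1 Q1poly : L).
  split; first by apply: vbev; rewrite size_Q1.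
  rewrite ev_inf ifT; last by lia.
  have -> : absz (- n3%:Z)%R = (size Q1poly).-1 by rewrite size_Q1; lia.
  by rewrite -lead_coefE lead_coef_eq0 Q1_neq0.
have := exactlyM (exactlyM ex2 h) (exactlyV exactlyX).
by have -> : n2%:Z + - n3%:Z + -1 = 0 by lia.
Qed.
End Poles.

Section GenericPoint.
Variables (m v : pspace S).
Variable D : @derivation_at V C m.
Hypothesis htan : tangent_at v D.

Lemma Omega_reg (p : V) c : (forall i, pts i p <> c) -> mreg_at c (Omega p (nf E p)).
Proof.
move=> hc.
have hx k : ('X - (pts k p)%:P).[c] != 0.
  by rewrite hornerXsubC subr_eq0; apply/eqP => e; apply: (hc k).
have hxn k n : reg_at c (tofrac ('X - (pts k p)%:P) ^+ n)^-1.
  by rewrite -tofracXn; apply: (reg_at_inv hF); rewrite horner_exp expf_neq0.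
have hx1 k : reg_at c (tofrac ('X - (pts k p)%:P))^-1 by apply: (reg_at_inv hF).
have hp q : reg_at c (tofrac q) by apply: (reg_at_tofrac hF).
apply: mreg_at2.
- by rewrite -tofrac0.
- apply: (reg_at_inv hF); rewrite horner_prod; apply/prodf_neq0 => k _.
  by rewrite horner_exp expf_neq0 //; apply: (hx (inl k)).
- apply: (reg_atD hF) => //; apply: (reg_atD hF) => //; apply: (reg_atD hF).
    by apply: (reg_at_sum hF) => k; apply: (reg_atM hF) => //; apply: (hxn (inl k)).
  by apply: (reg_at_sum hF) => j; apply: (reg_atM hF) => //; apply: (hx1 (inr j)).
- apply: (reg_atD hF) => //; apply: (reg_atD hF).
    by apply: (reg_at_sum hF) => k; apply: (reg_atM hF) => //; apply: (hxn (inl k)).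
  by apply: (reg_atN hF); apply: (reg_at_sum hF) => j; apply: (hx1 (inr j)).
Qed.
(** The entries of Omega are regular at [c] for all parameters near [m], and differentiation with a
    fixed center creates no pole. *)
Lemma mkf_reg dOm c : mkf D pts (Omega_nf E) dOm ->
  (forall i, pts i m <> c) -> mreg_at c dOm.
Proof.
move=> hO hc; have hx := chart_gen htan hc; apply/mreg_at_entry => a b.
have [h1 h2] := hO a b _ _ hx; rewrite /reg_at -h2; apply: reg_ldelta => //.
have hn : near_pt D (fun p => forall i, pts i p != c).
  apply: near_all => i; apply: (tangent_neq htan); first exact: pts_diff.
  by apply/eqP/hc.
apply: (nearS _ hn) => p hp.
have h : forall i, pts i p <> c by move=> i; apply/eqP/hp.
by have /mreg_at_entry := Omega_reg h; apply.
Qed.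
End GenericPoint.

Section ApparentDlog.
Variables (m v : pspace S).
Hypothesis hm : in_dom m.
Variable D : @derivation_at V C m.
Hypothesis htan : tangent_at v D.
Implicit Types (j : 'I_n3) (p : V).

Definition Xq j p : 'M[L]_2 := mx2 (Xiq E j p 0 0) (lX * Xiq E j p 0 1)
  (lX^-1 * Xiq E j p 1 0) (Xiq E j p 1 1).
Lemma psi_qE j p : psi_q E j p = mx2 1 0 (lC (pv p j)) lX *m Xq j p.
Proof. exact: apparent_frame_split (@lX_neq0 C). Qed.
Lemma Xq_GL j p : in_dom p -> GLreg (Xq j p).
Proof.
move=> hp; have gX := Xiq_GL j hp; have [_ rX _] := gX; have x0 := @lX_neq0 C.
have [_ h1 _] := app_sol j hp; apply: GLreg_det.
  apply: mvb2; try exact: rX.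
    by apply: reg_mul; [apply: reg_X | apply: rX].
  apply: (@vbM _ (-1) 1); first by rewrite lXV; apply: vb_mono.
  (* [Xiq] is the identity at q_j, so its lower left entry is divisible by X. *)
  move=> k hk; have [->|k0] := eqVneq k 0; last by apply: rX; lia.
  by have := congr1 (fun M : 'M[C]_2 => M 1 0) h1; rewrite !mxE.
have -> : \det (Xq j p) = \det (Xiq E j p).
  exact: apparent_frame_det.
exact: GLreg_exact.
Qed.
Lemma good_Xq j : mgood D (Xq j).
Proof.
have h := good_Xiq hm htan j.
by apply: mgood2 => //; apply: goodM => //; apply: good_cst.
Qed.
Lemma mreg_dXq j c : mregular (mdelta_at D c (Xq j)).
Proof.
apply: mreg_mdelta; first exact: good_Xq.
by apply: (nearS _ (tangent_dom htan)) => p hp; case: (Xq_GL j hp).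
Qed.
Lemma ldint_0 c : ldint_at D c (fun _ => 0 : L) = 0.
Proof.
apply: laurentP => k; rewrite (ldintE ch0 _ _ (good_cst D 0)) lcoef0 mulr0 subr0.
by case: (k == 0) => //; rewrite dir_cst mul0r.
Qed.
Lemma dlog_q j (A0 : 'M[L]_2 := mx2 1 0 (lC (pv m j)) lX) :
  dlog_at D (ddir D (fun p => qv p j)) (psi_q E j) (fun _ => 0) (fun _ => 0) =
  (mx2 0 0 (lC (pv v j)) (- lC (qv v j)) *m Xq j m +
   A0 *m mdelta_at D (ddir D (fun p => qv p j)) (Xq j)) *m invmx (A0 *m Xq j m).
Proof.
have z0 : mx2 0 0 0 0 = 0 :> 'M[L]_2 by apply: mx2P; rewrite mx2E mxE.
rewrite /dlog_at !ldint_0 z0 mulmx0 subr0 psi_qE.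
set c := ddir D _; have ec : c = qv v j by rewrite /c (tangent_dir htan) dir_cval.
have ep : ddir D (fun p => pv p j) = pv v j by rewrite (tangent_dir htan) dir_cval.
have gp : mgood D (fun p => mx2 1 0 (lC (pv p j)) lX).
  by apply: mgood2; try exact: good_cst; apply: (good_pv htan).
have -> : mdelta_at D c (psi_q E j) =
    mdelta_at D c (fun p => mx2 1 0 (lC (pv p j)) lX) *m Xq j m + A0 *m mdelta_at D c (Xq j).
  have gX := good_Xq j; rewrite -[RHS](mdeltaM c gp gX).
  rewrite -(@mdelta_near _ _ _ _ _ (fun p => mx2 1 0 (lC (pv p j)) lX *m Xq j p)) //.
    exact: mgoodM.
  by apply: nearT => p; rewrite psi_qE.
rewrite mdelta2; try exact: good_cst; last exact: (good_pv htan).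
have dp : dble D (fun p => pv p j) by apply: (tangent_dble htan); apply: cval_diff.
rewrite !ldelta_cst (ldelta_lC _ dp) ep lderivX mulr1 -ec.
by rewrite (der0 (@lderivD C)) (der1 (@lderivM C)) !mulr0 !oppr0.
Qed.
End ApparentDlog.

(** * The rational potential *)

Section Potential.
Variables (m v : pspace S).
Hypothesis hm : in_dom m.
Variable D : @derivation_at V C m.
Hypothesis htan : tangent_at v D.
Implicit Types (i : I) (j : 'I_n3).

Variables (Q2 : {poly C}) (H : 'M[K]_2) (N0 N1 : 'M[{poly C}]_2) (i0 : I) (B : 'M[L]_2) (dP : {poly C}).
Let Om := Omega m (nf E m).
Let G := Gtilde Q2 m.
Let Om1 := gauge (@rderiv C) G Om.
Let Om1' := - (map_mx (@rderiv C) H + (Om1 *m H - H *m Om1)).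
Let PF : K := tofrac (Ppoly m).
Hypothesis hQ2s : (size Q2 <= ntot S - 3)%N.
Hypothesis hQ2 : forall j, Q2.[qv m j] = pv m j.
Hypothesis hH1 : forall c : C, (forall k : 'I_(nu S), i0 = Some k -> c <> tv m k) -> mreg_at c H.
Hypothesis hH2 : i0 <> None -> mregular (sub lX^-1 (endo_at (None : I) H)).
Hypothesis hH3 : mregular (sub (xloc m i0) (endo_at i0 H) +
  Pmx E Q2 i0 m *m B *m invmx (Pmx E Q2 i0 m)).
Hypothesis hN0 : map_mx (@tofrac {poly C}) N0 = PF *: Om1.
Hypothesis hN1 : map_mx (@tofrac {poly C}) N1 = PF *: Om1' + tofrac dP *: Om1.
Hypothesis hev : forall j,
  eps_eval (N0 0 1) (N1 0 1) (qv m j) (qv v j) = (0, 0) /\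
  eps_eval (N0 0 0) (N1 0 0) (qv m j) (qv v j) = (pv m j, pv v j).
Hypothesis hi0 : ~~ ra i0.
Hypothesis hB : mvb (- (pole i0)%:Z) B.
Hypothesis hL0 : mregular (dLam D E i0 - B).
Hypothesis hL : forall i, i <> i0 -> ~~ ra i -> mregular (dLam D E i).
Hypothesis hP : kf D pts (fun p => tofrac (Ppoly p)) (tofrac dP).
Hypothesis hLr : forall i s, ra i ->
  vb 1 (ldint_at D 0 (lamder_ram E i s)).
Variable dOm : 'M[K]_2.
Hypothesis hO : mkf D pts (Omega_nf E) dOm.

Let q1 : K := tofrac (Q1poly m).
Let q2 : K := tofrac Q2.
Let N1K := map_mx (@tofrac {poly C}) N1.
Let kap := kappa_of q1 q2 N1K.
Let mu := mu_of q1 N1K.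
Let Y0 := G *m H *m invmx G.
Let Y := Y0 + mx2 0 0 kap mu.
Let Del := dOm + cov (@rderiv C) Om Y.

Lemma PF_neq0 : PF != 0. Proof. exact: Ppoly_neq0. Qed.
Lemma q1_neq0 : q1 != 0. Proof. by rewrite tofrac_eq0 Q1_neq0. Qed.
Lemma G_unit : G \in unitmx. Proof. exact: (triangular_unit _ q1_neq0). Qed.
Lemma dOm_row : dOm 0 0 = 0 /\ dOm 0 1 = - tofrac dP / PF ^+ 2.
Proof.
have [d [hd e0 e1]] := mkf_Omega hm htan hP.
have h a b : dOm a b = d a b by apply: (kf_uniq htan (hO a b) (hd a b)).
by rewrite !h e0 e1.
Qed.
(** The variation - dP/P^2 of 1/P cancels the dP/P^2 produced by [first_row]. *)
Lemma Del_row : Del 0 0 = 0 /\ Del 0 1 = 0.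
Proof.
have [e0 e1] := dOm_row.
have [] := first_row (rderivD hF) (rderivM hF) q2 (c0 m (nf E m)) (d0 m (nf E m))
  (tofrac dP) H PF_neq0 q1_neq0.
rewrite -[PF *: _ + _]hN1 => r0 r1.
rewrite /Del; split; rewrite mx_addE.
  by rewrite e0 add0r; exact: r0.
rewrite e1; apply/eqP; rewrite addrC addr_eq0 mulNr opprK; apply/eqP; exact: r1.
Qed.
Lemma DelE : Del = mx2 0 0 (Del 1 0) (Del 1 1).
Proof. by have [e0 e1] := Del_row; rewrite {1}[Del]mx2_eta e0 e1. Qed.
Lemma frame_lower i (g h : K) : exists g', invmx (frame n2 i) *m mx2 0 0 g h *m frame n2 i = mx2 0 0 g' h.
Proof.
case: i => [k|]; first by exists g; rewrite /= invmx1 mul1mx mulmx1.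
exists ((tofrac 'X ^+ n2)^-1 * g); apply: lower_conj_diag.
by rewrite expf_neq0 // tofrac_eq0 polyX_eq0.
Qed.
Lemma frame_Y0 i : conjf i Y0 =
  Gtilde_at Q2 m i *m endo_at i H *m invmx (Gtilde_at Q2 m i).
Proof.
rewrite Gtilde_atE endo_atE.
exact: (frame_conj H (frame_unit n2 i) (frame_unit 1 i) G_unit).
Qed.
(** [W] is any local solution of the variation equation, in x or in zeta. The covariant derivative
    of Y - W is then the defect, and Y - W is regular up to a lower row of unknown order, which is
    the situation of [local_regular]. *)
Lemma local_Delta (xi : L) (N : int) (W : 'M[L]_2) i : transc xi -> 0 <= N ->
  let Oml := pullback xi (conn_at n2 i Om) in
  mvb (- N) Oml -> exactly (- N) (Oml 0 1) ->
  lcov Oml W = - pullback xi (conjf i dOm) ->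
  mregular (sub xi (Gtilde_at Q2 m i) *m sub xi (endo_at i H) *m invmx (sub xi (Gtilde_at Q2 m i)) - W) ->
  mregular (pullback xi (conjf i Del)).
Proof.
move=> ht Nge Oml hO1 hO2 eW hZ; have u := frame_unit n2 i.
have [s sE] := lsubst_morph ht.
have [k' ek] := frame_lower i kap mu.
have [g' eg] := frame_lower i (Del 1 0) (Del 1 1); rewrite -DelE in eg.
set Z0 := (X in mregular X) in hZ.
have eY : sub xi (conjf i Y) - W =
    Z0 + mx2 0 0 (lsubst xi k') (lsubst xi mu).
  have e0 : lsubst xi (0 : K) = 0 by rewrite sE rmorph0.
  have e2 : sub xi (mx2 0 0 k' mu) = mx2 0 0 (lsubst xi k') (lsubst xi mu).
    by rewrite map_mx2; apply: (mx2_congr e0 e0).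
  have e3 (A X : 'M[K]_2) : sub xi (A + X) = sub xi A + sub xi X by rewrite sE map_mxD.
  rewrite /Y mulmxDr mulmxDl frame_Y0 ek -e2 e3 (sub_conjV _ _ ht).
  exact: addrAC.
have eD : conjf i Del = conjf i dOm
    + invmx (frame n2 i) *m cov (@rderiv C) Om Y *m frame n2 i by apply: conjD.
have eX : lcov Oml (Z0 + mx2 0 0 (lsubst xi k') (lsubst xi mu)) =
    pullback xi (conjf i Del).
  have e3 (A X : 'M[K]_2) : pullback xi (A + X) = pullback xi A + pullback xi X.
    by rewrite /pullback sE map_mxD scalerDr.
  apply: etrans (esym (etrans (congr1 (pullback xi) eD) (e3 _ _))).
  rewrite -eY (covB (@lderivD C)) eW opprK addrC; congr (_ + _).
  rewrite /Oml conn_atE; apply: etrans (pullback_cov _ _ ht) _.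
  exact: (congr1 (pullback xi) (cov_gauge (rderivD hF) (rderivM hF) Om Y u)).
have e0 : lsubst xi (0 : K) = 0 by rewrite sE rmorph0.
have := @local_regular C N Oml Z0 (lsubst xi k') (lsubst xi mu) Nge hO1 hO2 hZ.
rewrite /= eX; apply; by rewrite eg pullback_mx2 mx2E e0 mulr0.
Qed.
Lemma mreg_dPhiXi i : mregular (mdelta_at D (dc D i) (PhiXi E i)).
Proof.
apply: mreg_mdelta; first exact: (good_PhiXi hm htan).
by apply: (nearS _ (tangent_dom htan)) => p hp; case: (PhiXi_GL i hp).
Qed.
Lemma endo_reg i : i <> i0 -> mregular (sub (xloc m i) (endo_at i H)).
Proof.
move=> ii0; have [tinj _ _ _ _] := hm; case: i ii0 => [k|] ii0.
  by apply: hH1 => k' e /tinj ek; apply: ii0; rewrite e ek.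
by apply: hH2 => e; apply: ii0.
Qed.
Lemma Delta_unram i : ~~ ra i ->
  mregular (pullback (xloc m i) (conjf i Del)).
Proof.
move=> ki; have ht : transc (xloc m i) by apply: (chart_transc (chart_xloc htan i)).
apply: (@local_Delta _ (pz i) _ i ht (le0z_nat _) (OmL_mvb (i := i) hm) (OmL_01 hm i) (cov_unram hm htan hO ki)).
have gA := PhiXi_GL i hm; have gG := GLreg_Gtilde_at hm hQ2s i.
have [ii0|ii0] := pselect (i = i0).
  rewrite ii0 in gA gG *.
  exact: (special_regular (pole_gt0 i0) gA gG hB hH3 (@mreg_dPhiXi i0) hL0).
exact: (plain_regular gA gG (@endo_reg i ii0) (@mreg_dPhiXi i) (hL ii0 ki)).
Qed.
Lemma near_lsquare_GL i : near_pt D (fun p => mregular (mx_sq (PhiXi E i p))).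
Proof.
apply: (nearS _ (tangent_dom htan)) => p hp.
by case: (lsquare_GL (PhiXi_GL i hp)).
Qed.
Lemma ram_dlog_regular i (G' H' A dA dL : 'M[L]_2) : GLreg A -> GLreg G' -> mregular H' ->
  mregular dA -> mregular (Mzeta R *m dL *m invmx (Mzeta R)) ->
  mregular (G' *m H' *m invmx G' -
    (dA *m Mzeta R - A *m Mzeta R *m dL) *m invmx (A *m Mzeta R)).
Proof.
move=> gA gG hH hA hL'; have uM := Mzeta_unit ch0; have [uA _ _] := gA.
have e : (dA *m Mzeta R - A *m Mzeta R *m dL) *m invmx (A *m Mzeta R) =
    (dA - A *m (Mzeta R *m dL *m invmx (Mzeta R))) *m invmx A.
  exact: dlog_mulr.
by rewrite e; apply: plain_regular.
Qed.
(** The deformed point is unramified, so here the exponents do not vary in their polar part and H is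
    regular; all is done in zeta, where the formal solution is diagonal. *)
Lemma Delta_ram i : ra i ->
  mregular (pullback (xram m i) (conjf i Del)).
Proof.
move=> ki; have ht : transc (xram m i) by apply: (chart_transc (chart_xram htan (ra_kind ki))).
have hle : 0 <= 2 * pz i - 1 by have := pole_gt0 i; lia.
apply: (@local_Delta _ (2 * pz i - 1) _ i ht hle (OmL_ram_mvb (i := i) hm)
  (OmL_ram_01 hm i) (cov_ram hm htan hO ki)).
have ii0 : i <> i0 by move=> e; move: hi0; rewrite -e ki.
have gA := lsquare_GL (PhiXi_GL i hm).
have gG := lsquare_GL (GLreg_Gtilde_at hm hQ2s i).
have hH : mregular (mx_sq (sub (xloc m i) (endo_at i H))).
  by move=> a b; rewrite mxE; apply: (@vb_lsquare _ 0); apply: endo_reg.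
have gp : mgood D (fun p => mx_sq (PhiXi E i p)).
  move=> a b; apply: (@good_near _ _ _ D (fun p => lsquare (PhiXi E i p a b))).
    by apply: nearT => p; rewrite [RHS]mxE.
  exact/good_lsquare/(good_PhiXi hm htan).
have hdA := mreg_mdelta 0 gp (near_lsquare_GL i).
have ed : mdelta_at D 0 (psi_ram E i) =
    mdelta_at D 0 (fun p => mx_sq (PhiXi E i p)) *m Mzeta R.
  have gM := @mgood_cst _ _ _ D (Mzeta R).
  rewrite -[LHS](@mdelta_near _ _ _ _ _ (fun p => mx_sq (PhiXi E i p) *m Mzeta R)).
  - by rewrite mdeltaM // mdelta_cst0 mulmx0 addr0.
  - exact: mgoodM.
  - by apply: nearT => p; rewrite psi_ramE.
rewrite /dlog_at ed psi_ramE -lsquare_xloc !sub_lsquare.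
apply: ram_dlog_regular => //.
by apply: Mzeta_conj => //; apply: hLr.
Qed.
Lemma Delta_loc i :
  mregular (pullback (xloc m i) (conjf i Del)).
Proof.
case ki: (ra i); last by apply: Delta_unram; rewrite ki.
have h := Delta_ram ki; rewrite -lsquare_xloc pullback_lsquare in h => a b.
(* Removing the factor 2 zeta costs one order in zeta, but a function of zeta^2 cannot have a simple
   pole. *)
apply: (@vb_lsquareV _ (0 - 1)) => //.
have h1 := h a b; rewrite scale_lsquareE in h1.
exact: (vb_cancel exactly_2X h1).
Qed.
(** The unperturbed numerators are A = Q_2 and B = Q_1, so the conditions at q_j^eps linearise with
    the derivatives of these two polynomials. *)
Lemma N0_entries : N0 0 0 = Q2 /\ N0 0 1 = Q1poly m.
Proof.
have e a b : tofrac (N0 a b) = PF * Om1 a b.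
  exact: map_scale_entry hN0.
have h0 := gauge_00 (rderivD hF) (rderivM hF) q2 (c0 m (nf E m)) (d0 m (nf E m)) PF_neq0 q1_neq0.
have h1 := gauge_01 (rderivD hF) (rderivM hF) q2 (c0 m (nf E m)) (d0 m (nf E m)) PF_neq0 q1_neq0.
have c2 (x y : K) : y != 0 -> y * (x / y) = x by move=> y0; rewrite mulrC divfK.
split; apply/eqP; rewrite -tofrac_eq; apply/eqP; apply: etrans (e _ _) _.
  by apply: etrans (congr1 ( *%R PF) h0) _; apply: c2; apply: PF_neq0.
by apply: etrans (congr1 ( *%R PF) h1) _; apply: c2; apply: PF_neq0.
Qed.
Lemma Delta_q j : regular (lsubst (xfin (qv m j)) (Del 1 1)) /\
  vb 1 (lsubst (xfin (qv m j)) (Del 1 0) + lsubst (xfin (qv m j)) (Del 1 1) * lC (pv m j)).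
Proof.
set c := qv m j; set xi := xfin c; have ht : transc xi by apply: transc_xfin.
have [s sE] := lsubst_morph ht; have [eN0 eN1] := N0_entries.
have [u hu eu] := ev_xfin_split c (Q1poly m); have [t et0 et] := ev_xfin_split c Q2.
have [tinj qinj hqt _ _] := hm.
have c1 : (Q1poly m).[c] = 0 by apply/eqP; rewrite Q1_root; apply/existsP; exists j.
(* The q_j are distinct, so q_j is a simple zero of Q_1 and its motion is determined. *)
have uc0 : u.[c] != 0.
  have -> : u = \prod_(k < ntot S - 3 | k != j) ('X - (qv m k)%:P).
    apply: (mulIf (negbT (polyXsubC_eq0 c))); rewrite c1 addr0 in hu; rewrite -hu mulrC.
    by rewrite /Q1poly (bigD1 j).
  rewrite horner_prod; apply/prodf_neq0 => k kj; rewrite hornerXsubC subr_eq0.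
  by apply/eqP => /qinj e; rewrite e eqxx in kj.
have [[_ e1] [_ e0]] := hev j; rewrite -/c in e1 e0.
rewrite eN1 (deriv_split hu) in e1; rewrite eN0 (deriv_split et0) in e0.
rewrite c1 rmorph0 addr0 in eu; rewrite hQ2 in et.
have rx := reg_xfin c.
have exu : exactly 0 (ev xi u) by apply: ev_xfin_exact.
have a1 : ev xi (N1 0 1) 0 + qv v j * ev xi u 0 = 0.
  by rewrite !ev_xfin0 addrC mulrC.
have a0 : ev xi (N1 0 0) 0 - pv v j + qv v j * ev xi t 0 = 0.
  by rewrite !ev_xfin0 -e0; ring.
have [b1 b2] := apparent_kappa_mu (pv m j) (dp := pv v j) (dq := qv v j) exu
  (reg_ev _ rx) (reg_ev _ rx) (reg_ev _ rx) a1 a0.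
have eM a b : N1K a b = tofrac (N1 a b) by rewrite mxE.
have ek : lsubst xi kap = ev xi (N1 0 0) - ev xi (N1 0 1) * (ev xi t * lX + lC (pv m j)) / (ev xi u * lX).
  rewrite /kap /kappa_of !eM -eu -et sE rmorphB fmorph_div (rmorphM s) -sE.
  by rewrite !(lsubst_tofrac _ ht).
have em : lsubst xi mu = ev xi (N1 0 1) / (ev xi u * lX).
  by rewrite /mu /mu_of !eM -eu sE fmorph_div -sE !(lsubst_tofrac _ ht).
rewrite -ek -em in b1; rewrite -em in b2.
set A0 := mx2 1 0 (lC (pv m j)) lX : 'M[L]_2.
pose U := mx2 1 0 (ev xi t) (ev xi u) : 'M[L]_2.
have eG : sub xi G = A0 *m U.
  rewrite /G (Gtilde_sub _ _ ht) mx2M eu et.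
  by apply: mx2_congr; ring.
have gU : GLreg U by apply: GLreg_low => //; apply: reg_ev.
have rH : mregular (sub xi H) by apply: hH1 => k _; apply: hqt.
have hZ := apparent_frame_regular eG gU (Xq_GL j hm) rH
  (@mreg_dXq _ _ hm _ htan j (ddir D (fun p => qv p j))) b1 b2.
rewrite -(dlog_q hm htan j) in hZ.
have e00 : lsubst xi (0 : K) = 0 by rewrite sE rmorph0.
have e3 (A X : 'M[K]_2) : sub xi (A + X) = sub xi A + sub xi X by rewrite sE map_mxD.
have eV : sub xi (mx2 0 0 kap mu) = mx2 0 0 (lsubst xi kap) (lsubst xi mu).
  by rewrite map_mx2; apply: (mx2_congr e00 e00).
have eY : sub xi Y = sub xi G *m sub xi H *m invmx (sub xi G) + mx2 0 0 (lsubst xi kap) (lsubst xi mu).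
  by rewrite -eV -(sub_conjV _ _ ht); apply: e3.
rewrite -eY in hZ.
have lx1 : lderiv xi = 1 by rewrite /xi lderivD lderivC lderivX add0r.
have eX : lcov (OmL_q E j m) (sub xi Y - dlog_at D (ddir D (fun p => qv p j)) (psi_q E j)
    (fun _ => 0) (fun _ => 0)) = mx2 0 0 (lsubst xi (Del 1 0)) (lsubst xi (Del 1 1)).
  rewrite (covB (@lderivD C)) (cov_q hm htan j hO) opprK.
  apply: etrans (congr1 (fun A => A + _) (pullback_cov _ _ ht)) _.
  rewrite /pullback lx1 !scale1r addrC; apply: etrans (esym (e3 _ _)) _.
  apply: etrans (congr1 (sub xi) DelE) _.
  by rewrite map_mx2; apply: (mx2_congr e00 e00).
have [_ _ _ /(_ m hm)[[_ happ _] _ _ _ _]] := hE.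
exact: (apparent_regular (happ j) hZ eX).
Qed.
Lemma potential_reg c : (forall k, pts k m <> c) -> mreg_at c Y.
Proof.
move=> hc; have ht : transc (lC c + lX) := transc_xfin c hF; have [s sE] := lsubst_morph ht.
apply: (mreg_atD hF).
  rewrite /mreg_at (sub_conjV _ _ ht); apply: mreg_conj.
    by apply: GLreg_Gtilde => j e; apply: (hc (inr j)).
  by apply: hH1 => k _ e; apply: (hc (inl k)).
have h0 : reg_at c (0 : K) by rewrite -tofrac0; apply: (reg_at_tofrac hF).
have hp p : reg_at c (tofrac p) by apply: (reg_at_tofrac hF).
have hq : reg_at c q1^-1.
  apply: (reg_at_inv hF); rewrite Q1_root; apply/existsP => -[j /eqP e].
  by apply: (hc (inr j)).
have eM a b : N1K a b = tofrac (N1 a b) by rewrite mxE.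
apply: mreg_at2 => //.
  rewrite /kap /kappa_of !eM; apply: (reg_atD hF) => //; apply: (reg_atN hF).
  by apply: (reg_atM hF _ hq); apply: (reg_atM hF); apply: hp.
by rewrite /mu /mu_of eM; apply: (reg_atM hF _ hq); apply: hp.
Qed.
Lemma Del_reg c : (forall k, pts k m <> c) -> mreg_at c Del.
Proof.
move=> hc; apply: (mreg_atD hF); first exact: (mkf_reg htan hO).
by apply: (mreg_at_cov hF); [apply: Omega_reg | apply: potential_reg].
Qed.
Lemma pullback_reg_at c (A : 'M[K]_2) a b :
  mregular (pullback (lC c + lX) A) -> reg_at c (A a b).
Proof.
have e : lderiv (lC c + lX) = 1 :> L by rewrite lderivD lderivC lderivX add0r.
by rewrite /pullback e scale1r => /(_ a b); rewrite mxE.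
Qed.
Lemma Del_tv k a b : reg_at (tv m k) (Del a b).
Proof.
apply: pullback_reg_at; have := Delta_loc (Some k).
by rewrite /= invmx1 mul1mx mulmx1.
Qed.
Lemma Del_inf : regular (lderiv lX^-1 * (lX ^+ n2 * lsubst lX^-1 (Del 1 0))) /\
  regular (lderiv lX^-1 * lsubst lX^-1 (Del 1 1)).
Proof.
have ht := transc_inf hF; have [s sE] := lsubst_morph ht.
have g0 : (tofrac 'X : K) ^+ n2 != 0 by rewrite expf_neq0 // tofrac_eq0 polyX_eq0.
have e : invmx (frame n2 (None : I)) *m Del *m frame n2 (None : I) =
    mx2 0 0 ((tofrac 'X ^+ n2)^-1 * Del 1 0) (Del 1 1).
  exact: (conj_diag_lower g0 DelE).
have h : mregular (pullback lX^-1 (mx2 0 0 ((tofrac 'X ^+ n2)^-1 * Del 1 0) (Del 1 1))).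
  by rewrite -e; apply: (Delta_loc None).
have eg : lsubst lX^-1 ((tofrac 'X ^+ n2)^-1 * Del 1 0) = lX ^+ n2 * lsubst lX^-1 (Del 1 0).
  rewrite sE rmorphM fmorphV -sE -tofracXn (lsubst_tofrac _ ht) rmorphXn /= evX.
  by rewrite -exprVn invrK.
by rewrite pullback_mx2 eg in h; have := h 1 0; have := h 1 1; rewrite !mx2E.
Qed.
Lemma exactly_dXinv : exactly (-2) (lderiv lX^-1 : L).
Proof.
rewrite (lderiv_Xinv C); have [h1 h2] := exactlyXz C (-2).
by split; [apply: vbN | rewrite lcoefN oppr_eq0].
Qed.
(** The entry h must be treated before g: it is a form coefficient without poles, while the
    condition at q_j concerns g + p_j h. *)
Lemma Del_eq0 : Del = 0.
Proof.
have [tinj qinj hqt _ _] := hm; have [hi0' hi1] := Del_inf.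
have e11 : Del 1 1 = 0.
  apply: (rational_form_eq0 hF) => [c|]; last first.
    by have := vb_cancel exactly_dXinv hi1.
  have [[k <-]|h] := pselect (exists k, pts k m = c).
    by case: k => [k|j]; [apply: Del_tv | case: (Delta_q j)].
  have /mreg_at_entry : mreg_at c Del by apply: Del_reg => k e; apply: h; exists k.
  exact.
have lz (xi : L) : transc xi -> lsubst xi (Del 1 1) = 0.
  by move=> ht; have [s sE] := lsubst_morph ht; rewrite e11 sE rmorph0.
(* Once h = 0, the vanishing of g + p_j h at q_j becomes that of g alone. *)
have hq j : vb 1 (lsubst (xfin (qv m j)) (Del 1 0)).
  have [_] := Delta_q j; rewrite (lz (xfin (qv m j))); last exact: transc_xfin.
  by rewrite mul0r addr0.
have e10 : Del 1 0 = 0.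
  apply: (rational_roots_eq0 hF qinj) => [c|j|]; [|exact: hq|].
    have [[k <-]|h] := pselect (exists k, pts k m = c).
      case: k => [k|j]; [exact: Del_tv | apply: vb_le (hq j) => //].
    have /mreg_at_entry : mreg_at c Del by apply: Del_reg => k e; apply: h; exists k.
    exact.
  have ex : exactly n2%:Z (lX ^+ n2 : L) by have := exactlyXn n2 exactlyX; rewrite natz.
  have := vb_cancel ex (vb_cancel exactly_dXinv hi0').
  (* The 2 comes from dx and n - 2 from the twist; the resulting order 1 - (n-3) at infinity means
     degree at most n - 4. *)
  by have ge3 := ntot_ge3; have -> : 0 - -2 - n2%:Z = 1 - n3%:Z by lia.
apply: etrans DelE _; rewrite e10 e11.
by apply: mx2P; rewrite mx2E mxE.
Qed.
Lemma potential_cov : cov (@rderiv C) Om Y = - dOm.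
Proof. by apply/eqP; rewrite -addr_eq0 addrC; apply/eqP; exact: Del_eq0. Qed.
Lemma potential_exists : exists2 Z : 'M[K]_2, cov (@rderiv C) (Omega m (nf E m)) Z = - dOm &
  forall c, (forall k, pts k m <> c) -> mreg_at c Z.
Proof. by exists Y; [apply: potential_cov | move=> c; apply: potential_reg]. Qed.
End Potential.

(** * Sum of the residues *)

Section Conversion.
Variables (m v : V) (D : @derivation_at V C m).
Hypothesis htan : tangent_at v D.

Lemma ldelta_tangent c (f : V -> L) : ldelta c v f m = ldelta_at D (ddir D c) f.
Proof.
congr lseries; apply: funext => k.
by rewrite !(tangent_dir htan).
Qed.
Lemma mdelta_tangent c (A : V -> 'M[L]_2) : mdelta c v A m = mdelta_at D (ddir D c) A.
Proof. by apply/matrixP => a b; rewrite !mxE ldelta_tangent. Qed.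
Lemma dlog_tangent c A (lp lm : V -> L) : dlog c v A lp lm m = dlog_at D (ddir D c) A lp lm.
Proof.
have e f : ldelta_int c v f m = ldint_at D (ddir D c) f.
  by rewrite /ldelta_int ldelta_tangent -(tangent_dir htan).
by rewrite /dlog mdelta_tangent !e.
Qed.
End Conversion.

Section ResidueSum.
Variables (m v1 v2 : pspace S).
Hypothesis hm : in_dom m.
Variables D1 D2 : @derivation_at V C m.
Hypotheses (htan1 : tangent_at v1 D1) (htan2 : tangent_at v2 D2).
Implicit Types (i : I) (j : 'I_n3).
Variables dOm1 dOm2 Y : 'M[K]_2.
Hypothesis hO1 : mkf D1 pts (Omega_nf E) dOm1.
Hypothesis hO2 : mkf D2 pts (Omega_nf E) dOm2.
Hypothesis hY : cov (@rderiv C) (Omega m (nf E m)) Y = - dOm1.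
Hypothesis hYr : forall c, (forall k, pts k m <> c) -> mreg_at c Y.
Local Notation f := (\tr (Y *m dOm2)).

(** The global [Y], pulled back and conjugated, solves the same local equation as [W1] and may
    replace it; the conjugation by the frame then disappears from the trace. *)
Lemma local_residue (xi : L) i W1 W2 : transc xi ->
  let Oml := pullback xi (conn_at n2 i (Omega m (nf E m))) in
  let d1 := pullback xi (conjf i dOm1) in
  let d2 := pullback xi (conjf i dOm2) in
  lcov Oml W1 = - d1 -> lcov Oml W2 = - d2 ->
  lres (\tr (d1 *m W2 - W1 *m d2)) = - (2%:R * lres (lderiv xi * lsubst xi f)).
Proof.
move=> ht Oml d1 d2 e1 e2; have u := frame_unit n2 i.
have eY : lcov Oml (sub xi (conjf i Y)) = - d1.
  rewrite /Oml conn_atE; apply: etrans (pullback_cov _ _ ht) _.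
  have h := cov_gauge (rderivD hF) (rderivM hF) (Omega m (nf E m)) Y u.
  apply: etrans (congr1 (pullback xi) h) _; rewrite hY mulmxN mulNmx; exact: pullbackN.
rewrite (res_wedge_potential e1 eY e2) /d2 (tr_sub_pullback _ _ ht).
exact: (congr1 (fun z => - (2%:R * lres (lderiv xi * lsubst xi z))) (tr_conjM Y dOm2 u)).
Qed.
Definition local_res i := lres (lderiv (xloc m i) * lsubst (xloc m i) f).

Lemma res_wedge_unram i : ~~ ra i ->
  res_wedge (Defs.center i) (OmL E i) (PhiXi E i) (lamder E i true) (lamder E i false) v1 v2 m =
  - (2%:R * local_res i).
Proof.
move=> ki; have ht := chart_transc (chart_xloc htan1 i) m.
have c1 := cov_unram hm htan1 hO1 ki; have c2 := cov_unram hm htan2 hO2 ki.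
have [_ d1] := delta_OmL htan1 i hO1; have [_ d2] := delta_OmL htan2 i hO2.
rewrite /res_wedge !(mdelta_tangent htan1) !(mdelta_tangent htan2).
rewrite (dlog_tangent htan1) (dlog_tangent htan2) d1 d2.
exact: (local_residue ht c1 c2).
Qed.
Lemma lres_double (a b : L) : lres (lC 2%:R * lX * lsquare a * lsquare b) = 2%:R * lres (a * b).
Proof.
rewrite -mulrA -rmorphM -mulrA /lres lC_coefM lX_coefM.
by rewrite -(lsquare_even (a * b) (-1)).
Qed.
Lemma res_wedge_ram i : ra i ->
  res_wedge (fun _ => 0) (OmL_ram E i) (psi_ram E i) (lamder_ram E i 1) (lamder_ram E i (-1)) v1 v2 m =
  - (2%:R * (2%:R * local_res i)).
Proof.
move=> ki; have hk := ra_kind ki; have ht := chart_transc (chart_xram htan1 hk) m.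
have c1 := cov_ram hm htan1 hO1 ki; have c2 := cov_ram hm htan2 hO2 ki.
have [_ d1] := delta_OmL_ram htan1 hO1 hk; have [_ d2] := delta_OmL_ram htan2 hO2 hk.
rewrite /res_wedge !(mdelta_tangent htan1) !(mdelta_tangent htan2).
rewrite (dlog_tangent htan1) (dlog_tangent htan2) !dir_cst d1 d2.
rewrite (local_residue ht c1 c2); congr (- (_ * _)).
by rewrite -lsquare_xloc -lsquare_lsubst lderiv_lsquare lres_double.
Qed.
Lemma res_wedge_q j :
  res_wedge (fun p => qv p j) (OmL_q E j) (psi_q E j) (fun _ => 0) (fun _ => 0) v1 v2 m =
  - (2%:R * res_at (qv m j) f).
Proof.
have ht : transc (xfin (qv m j)) by apply: transc_xfin.
have c1 := cov_q hm htan1 j hO1; have c2 := cov_q hm htan2 j hO2.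
have [_ d1] := delta_OmL_q htan1 j hO1; have [_ d2] := delta_OmL_q htan2 j hO2.
rewrite /res_wedge !(mdelta_tangent htan1) !(mdelta_tangent htan2).
rewrite (dlog_tangent htan1) (dlog_tangent htan2) d1 d2.
have e (dO : 'M[K]_2) : dO = invmx 1%:M *m dO *m 1%:M by rewrite invmx1 mul1mx mulmx1.
(* Any finite index will do: its frame is the identity, and [local_residue] makes no reference to
   where [xi] is centered. *)
have [k] : exists k : 'I_(nu S), true by exists (Ordinal (ltnW (nu_ge2 S))).
have := @local_residue (xfin (qv m j)) (Some k) _ _ ht.
rewrite -[frame n2 (Some k)]/(1%:M) -!e => h _.
have e1 : lderiv (xfin (qv m j)) = 1 by rewrite lderivD lderivC lderivX add0r.
by rewrite (h _ _ c1 c2) e1 mul1r.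
Qed.
Lemma pts_inj : injective (fun k => pts k m).
Proof.
have [h1 h2 h3 _ _] := hm; move=> [i|i] [j|j] /=.
- by move=> /h1 ->.
- by move=> e; case: (h3 i j).
- by move=> e; case: (h3 j i).
- by move=> /h2 ->.
Qed.
(** The rational form tr(Y dOm2) dx has poles at most at the t_i, at the q_j and at infinity. *)
Lemma residue_sum : \sum_(i : I) local_res i + \sum_(j < ntot S - 3) res_at (qv m j) f = 0.
Proof.
have := @residue_theorem C hF f [seq pts k m | k <- index_enum ('I_(nu S) + 'I_n3)%type].
rewrite big_map big_sumType /= big_option => h; rewrite -[RHS]h.
- rewrite -addrA addrC; congr (_ + _ + _); apply: eq_bigr => k _.
  by rewrite /local_res /res_at lderivD lderivC lderivX add0r mul1r.
- by rewrite map_inj_uniq ?index_enum_uniq //; apply: pts_inj.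
move=> c hc; have hc' k : pts k m <> c.
  by move=> e; move/negP: hc; apply; apply/mapP; exists k; rewrite ?mem_index_enum.
apply: (tr_reg_at hF); apply: (mreg_atM hF); first exact: hYr.
exact: (mkf_reg htan2 hO2 hc').
Qed.
Lemma omega_potential : omega_hat E v1 v2 m = 0.
Proof.
have -> : omega_hat E v1 v2 m =
    2^-1 * (\sum_(i : I | ~~ ra i) - (2%:R * local_res i))
    + 4^-1 * (\sum_(i : I | ra i) - (2%:R * (2%:R * local_res i)))
    + 2^-1 * (\sum_(j < ntot S - 3) - (2%:R * res_at (qv m j) f)).
  rewrite /omega_hat; congr (_ * _ + _ * _ + _ * _); apply: eq_bigr => i.
  - exact: res_wedge_unram.
  - exact: res_wedge_ram.
  - by move=> _; exact: res_wedge_q.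
(* The weights 1/2, 1/4, 1/2 meet the factors 2, 4, 2, so every point enters with the same
   coefficient - 1. *)
rewrite !sumrN -!mulr_sumr.
have := residue_sum; rewrite (bigID (fun i => ra i)) /=.
set A := \sum_(i | is_ra _) _; set B := \sum_(i | ~~ is_ra _) _; set Q := \sum_(j < _) _.
move=> h; have {h}-> : Q = - (A + B) by apply/eqP; rewrite -addr_eq0 addrC h.
by field.
Qed.
End ResidueSum.

(** * Isomonodromic directions *)

Section TimeDirection.
Variables (m v : pspace S).
Hypothesis hm : in_dom m.
Variable D : @derivation_at V C m.
Hypothesis htan : tangent_at v D.
Variable s : Defs.coord S.
Hypothesis hs : forall k, is_time k -> cval v k = (k == s)%:R.
Implicit Types (i : I) (e : bool).

Lemma ddir_cval k : is_time k -> ddir D (fun p => cval p k) = (k == s)%:R.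
Proof. by move=> hk; rewrite (tangent_dir htan) dir_cval hs. Qed.
Lemma ddir_tv (k : 'I_(nu S)) : (forall i : free_t S, val i = k -> ct i != s) ->
  ddir D (fun p => tv p k) = 0.
Proof.
move=> h; rewrite /tv; case: (nat_of_ord k == 0%N); first exact: dir_cst.
case: (nat_of_ord k == 1%N); first exact: dir_cst.
case: insubP => [i _ ei|_]; last exact: dir_cst.
by rewrite ddir_cval // (negPf (h i ei)).
Qed.
Lemma ddir_tv1 (i : free_t S) : ct i = s -> ddir D (fun p => tv p (val i)) = 1.
Proof.
move=> h; have /andP[h1 _] := valP i; rewrite /tv valK.
have -> : (nat_of_ord (val i) == 0%N) = false by lia.
have -> : (nat_of_ord (val i) == 1%N) = false by lia.
by rewrite ddir_cval // h eqxx.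
Qed.
Lemma ddir_thv i e l : (forall l' : 'I_(dim_un i), val l' = l -> cth l' e != s) ->
  ddir D (fun p => thv p i e l) = 0.
Proof.
move=> h; rewrite /thv; case: insubP => [l' _ el|_]; last exact: dir_cst.
by rewrite ddir_cval // (negPf (h l' el)).
Qed.
Lemma ddir_thv1 i e (l : 'I_(dim_un i)) : cth l e = s -> ddir D (fun p => thv p i e l) = 1.
Proof. by move=> h; rewrite /thv valK ddir_cval // h eqxx. Qed.
Lemma lamderE i e p k : in_dom p -> ~~ ra i -> k < 0 ->
  lamder E i e p k = if - pz i <= k then thv p i e (absz (k + pz i)%R) else 0.
Proof.
move=> hp ki k0; rewrite lsumE; case: (leP (- pz i) k) => // hk.
by rewrite opprK ths_thv //; lia.
Qed.
Lemma ddir_lamder i e k : ~~ ra i -> k < 0 -> ddir D (fun p => lamder E i e p k) =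
  if - pz i <= k then ddir D (fun p => thv p i e (absz (k + pz i)%R)) else 0.
Proof.
move=> ki k0; rewrite (@dir_near _ _ _ D _ (fun p => if - pz i <= k then thv p i e (absz (k + pz i)%R) else 0)).
  by case: (_ <= k) => //; apply: dir_cst.
by apply: (nearS _ (tangent_dom htan)) => p hp; apply: lamderE.
Qed.
(** In negative degrees only exponents with l < n_i occur, which are coordinates or constants. Those
    of higher order depend on the parameters in an unknown way but contribute regular terms. *)
Lemma ldint_lamder i e c k : ~~ ra i -> k < 0 ->
  ldint_at D c (lamder E i e) k =
  (if - pz i <= k - 1 then ddir D (fun p => thv p i e (absz (k - 1 + pz i)%R)) else 0)
    / k%:~R
  - c * (if - pz i <= k then thv m i e (absz (k + pz i)%R) else 0).
Proof.
move=> ki k0; rewrite (ldintE ch0 _ _ (good_lamder hm htan e ki)) lamderE //.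
by rewrite lt_eqF // ddir_lamder //; lia.
Qed.
Lemma ldint_fixed i e : ~~ ra i ->
  (forall l : 'I_(dim_un i), cth l e != s) ->
  regular (ldint_at D 0 (lamder E i e)).
Proof.
move=> ki h k k0; rewrite ldint_lamder // mul0r subr0.
by rewrite ddir_thv // if_same mul0r.
Qed.
Lemma mreg_fixed i : ~~ ra i -> (forall e (l : 'I_(dim_un i)), cth l e != s) ->
  dc D i = 0 ->
  mregular (dLam D E i).
Proof. by move=> ki h ->; apply: mvb2; try exact: vb0; apply: ldint_fixed. Qed.
(** Negative degrees involve only coordinates that the direction leaves fixed; degree 0 vanishes
    because the primitive has no constant term, which is the extra order that M_zeta demands. *)
Lemma ldint_ram i (z : C) : ra i -> (forall l : 'I_(dim_ra i), cthra l != s) ->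
  vb 1 (ldint_at D 0 (lamder_ram E i z)).
Proof.
move=> ki h k hk; rewrite (ldintE ch0 _ _ (good_lamder_ram hm htan z ki)) mul0r subr0.
have [//|k0] := eqVneq k 0; have n0 := pole_gt0 i.
rewrite (@dir_near _ _ _ D _ (fun p => if 1 - 2 * pz i <= k - 1
    then z ^+ (absz (k - 1 - (1 - 2 * pz i))%R) * thrav p i (absz (k - 1 - (1 - 2 * pz i))%R) else 0)).
  case: (_ <= k - 1); last by rewrite dir_cst mul0r.
  rewrite dirM ?dir_cst; [|exact: dble_cst|exact/(tangent_dble htan)/thrav_diff].
  rewrite mul0r add0r /thrav; case: insubP => [l' _ _|_]; last by rewrite dir_cst mulr0 mul0r.
  by rewrite ddir_cval // (negPf (h l')) mulr0 mul0r.
apply: (nearS _ (tangent_dom htan)) => p hp; rewrite lsumE.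
by case: (leP (1 - 2 * pz i) (k - 1)) => // hle; rewrite thras_thrav //; lia.
Qed.
Lemma kf_fixed (k : 'I_(nu S)) : ddir D (fun p => tv p k) = 0 ->
  kf D pts (fun p => lin pts (inl k) p ^+ pole (Some k)) 0.
Proof.
move=> e; have := kf_Xn (pole (Some k)) (kf_lin (dpts htan) (inl k)).
by rewrite [ddir D _]e polyC0 tofrac0 oppr0 mulr0.
Qed.
Lemma kf_Ppoly_fixed : (forall k, ddir D (fun p => tv p k) = 0) ->
  kf D pts (fun p => tofrac (Ppoly p)) (tofrac 0).
Proof.
move=> h; rewrite tofrac0.
apply: kf_near (kf_prod (index_enum 'I_(nu S)) (fun k => kf_fixed (h k))).
by apply: nearT => p; rewrite tofrac_Ppoly.
Qed.
(** Only one factor of P moves, and it is differentiated by the power rule with delta(x - t_i) = -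
    1. *)
Lemma kf_Ppoly_t (i : 'I_(nu S)) : ddir D (fun p => tv p i) = 1 ->
  (forall k, k != i -> ddir D (fun p => tv p k) = 0) ->
  kf D pts (fun p => tofrac (Ppoly p)) (tofrac (dPpoly i m)).
Proof.
move=> h1 h0.
have hQ : kf D pts (fun p => \prod_(k <- [seq k <- index_enum 'I_(nu S) | k != i])
    lin pts (inl k) p ^+ pole (Some k)) 0.
  elim: [seq _ <- _ | _] (filter_all (fun k => k != i) (index_enum 'I_(nu S))) => [|k r IH] /=.
    move=> _; apply: kf_near (kf_prod [::] (fun _ : unit => @kf0 _ _ _ D _ pts)).
    by apply: nearT => p; rewrite !big_nil.
  move=> /andP[ki /IH hr]; have := kfM (kf_fixed (h0 k ki)) hr; rewrite mul0r mulr0 addr0.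
  by apply: kf_near; apply: nearT => p; rewrite big_cons.
have := kfM (kf_Xn (pole (Some i)) (kf_lin (dpts htan) (inl i))) hQ.
rewrite mulr0 addr0 [ddir D _]h1 => h.
have eP p : lin pts (inl i) p ^+ pole (Some i) *
    \prod_(k <- [seq k <- index_enum 'I_(nu S) | k != i]) lin pts (inl k) p ^+ pole (Some k) =
    tofrac (Ppoly p) by rewrite tofrac_Ppoly (bigD1 i) //= big_filter.
have -> : tofrac (dPpoly i m) = (pole (Some i))%:R * lin pts (inl i) m ^+ (pole (Some i)).-1 *
    - tofrac 1%:P * \prod_(k <- [seq k <- index_enum 'I_(nu S) | k != i])
      lin pts (inl k) m ^+ pole (Some k).
  rewrite polyC1 tofrac1 mulrN1 mulNr mulr_natl big_filter /dPpoly tofracN tofracM tofracMn tofracXn.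
  congr (- (_ * _)); rewrite rmorph_prod; apply: eq_bigr => k _; exact: tofracXn.
exact: (kf_near (nearT _ eP) h).
Qed.
End TimeDirection.

Section IMD.
Implicit Types (i : I) (w : V) (s : Defs.coord S).

Lemma cth_eq i i' (l : 'I_(dim_un i)) (l' : 'I_(dim_un i')) e e' :
  cth l e = cth l' e' -> [/\ i = i', l = l' :> nat & e = e'].
Proof.
pose g (k : Defs.coord S) := if k is inr (inr (inl u)) then
  Some (tag u, nat_of_ord (tagged u).1, (tagged u).2) else None.
by move=> /(congr1 g) [] e1 e2 e3; split.
Qed.
(** Common to both kinds of time: the exponents vary, modulo regular terms, by [B] at [i0] and not
    at all elsewhere. The direction [w] is arbitrary because only the rational variation of Omega
    along it is needed. *)
Lemma omega_IMD m v w s i0 (B : 'M[L]_2) (dP : {poly C}) (D : @derivation_at V C m) :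
  in_dom m -> tangent_at v D -> is_IMD_at E s i0 B dP m v ->
  ~~ ra i0 -> mvb (- (pole i0)%:Z) B ->
  mregular (dLam D E i0 - B) ->
  (forall i e (l : 'I_(dim_un i)), i <> i0 -> cth l e != s) ->
  (forall i (l : 'I_(dim_ra i)), cthra l != s) ->
  (forall i, i <> i0 -> dc D i = 0) ->
  kf D pts (fun p => tofrac (Ppoly p)) (tofrac dP) ->
  omega_hat E v w m = 0.
Proof.
move=> hm htan [hs [Q2 [H [N0 [N1 [[hQ2s hQ2] [hH1 hH2 hH3] hN0 hN1 hev]]]]]] hi0 hB hL0.
move=> hth hthra hc hP; have [D2 htan2] := tangent_exists w hm.
have [dOm [hO _ _]] := mkf_Omega hm htan hP.
have [dP2 hP2] := hkf_Ppoly htan2; have [dOm2 [hO2 _ _]] := mkf_Omega hm htan2 hP2.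
have hL i : i <> i0 -> ~~ ra i ->
    mregular (dLam D E i).
  move=> ii0 ki; apply: (mreg_fixed hm htan hs ki); last exact: hc.
  by move=> e l; apply: hth.
have hLr i z : ra i -> vb 1 (ldint_at D 0 (lamder_ram E i z)).
  by move=> ki; apply: (ldint_ram hm htan hs).
have [Y hY hYr] := potential_exists hm htan hQ2s hQ2 hH1 hH2 hH3 hN0 hN1 hev hi0 hB hL0 hL hP hLr hO.
exact: (omega_potential hm htan htan2 hO hO2 hY hYr).
Qed.
(** The series X^(l+1-n_i)/(l+1-n_i) in [B_theta] is the primitive of the term of the exponent
    carrying theta_l, hence the variation of that exponent when theta_l moves at unit speed. *)
Lemma omega_IMD_theta i (l : 'I_(dim_un i)) e m v w : kind i = Un -> in_dom m ->
  is_IMD_at E (cth l e) i (B_theta i l e) 0 m v -> omega_hat E v w m = 0.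
Proof.
move=> ki hm hI; have hki : ~~ ra i by rewrite ki.
have [D htan] := tangent_exists v hm; have [hs _] := hI.
have hl : (l < (pole i).-1)%N by case: l hI hs => l hl _ _; move: hl; rewrite /= /dim_un ki.
have htv k : ddir D (fun p => tv p k) = 0 by apply: (ddir_tv htan hs).
have hc i' : ddir D (Defs.center i') = 0.
  by case: i' => [k|]; [apply: htv | apply: dir_cst].
have hb : vb (- pz i)
    (lC (l%:Z + 1 - pz i)%:~R^-1 * lX ^ (l%:Z + 1 - pz i) : L).
  by move=> k hk; rewrite lmono_coef; case: eqP => // h; lia.
apply: (omega_IMD w hm htan hI hki) => //.
- by rewrite /B_theta; case: (e); apply: mvb2.
- rewrite hc /B_theta.
  have h e' : regular (ldint_at D 0 (lamder E i e') -
      if e' == e then lC (l%:Z + 1 - pz i)%:~R^-1 * lX ^ (l%:Z + 1 - pz i) else 0).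
    move=> k k0; rewrite lcoefB (ldint_lamder hm htan) // mul0r subr0.
    have [ek|nk] := eqVneq k (l%:Z + 1 - pz i).
      rewrite ifT; last by lia.
      have -> : absz (k - 1 + pz i)%R = l by lia.
      have [->|ne] := eqVneq e' e.
        by rewrite (ddir_thv1 htan hs) // lmono_coef -ek eqxx div1r subrr.
      rewrite (ddir_thv htan hs) ?mul0r ?subrr // => l' _.
      by apply/eqP => /cth_eq[_ _ e1]; rewrite e1 eqxx in ne.
    have -> : (if e' == e then lC (l%:Z + 1 - pz i)%:~R^-1 * lX ^ (l%:Z + 1 - pz i)
        else 0) k = 0 :> C.
      by case: (e' == e) => //; rewrite lmono_coef (negPf nk).
    rewrite subr0; case: leP => hk; last by rewrite mul0r.
    rewrite (ddir_thv htan hs) ?mul0r // => l' el.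
    apply/eqP => /cth_eq[_ e1 _]; move/eqP: nk; apply.
    by have e2 : nat_of_ord l' = absz (k - 1 + pz i)%R := el; lia.
  have eD (x y b : L) : mx2 x 0 0 y - (if e then mx2 b 0 0 0 else mx2 0 0 0 b) =
      mx2 (x - if true == e then b else 0) 0 0 (y - if false == e then b else 0).
    by case: (e); rewrite mx2N mx2D !oppr0 !addr0.
  by rewrite eD; apply: mvb2 (h true) _ _ (h false); apply: vb0.
- by move=> i' e' l' ne; apply/eqP => /cth_eq[].
- exact: (kf_Ppoly_fixed htan htv).
Qed.
Lemma omega_IMD_t (i : free_t S) m v w : in_dom m ->
  is_IMD_at E (ct i) (Some (val i)) (B_t (Some (val i)) m) (dPpoly (val i) m) m v ->
  omega_hat E v w m = 0.
Proof.
move=> hm hI; have hki : ~~ is_ra (kind (Some (val i))) by have /andP[] := valP i.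
have [D htan] := tangent_exists v hm; have [hs _] := hI.
have h1 : ddir D (fun p => tv p (val i)) = 1 by apply: (ddir_tv1 htan hs).
have h0 k : k <> val i -> ddir D (fun p => tv p k) = 0.
  move=> ki; apply: (ddir_tv htan hs) => i' ei; apply/eqP => -[ii]; apply: ki.
  by rewrite -ei ii.
set n := pole (Some (val i)).
have hBt k e : k < 0 -> (\sum_(l < n) lX ^ (l%:Z - n%:Z) * lC (thv m (Some (val i)) e l)) k =
    if - n%:Z <= k then thv m (Some (val i)) e (absz (k + n%:Z)%R) else 0.
  move=> k0; rewrite lcoef_sum.
  rewrite (eq_bigr (fun l : 'I_n => if k == l%:Z - n%:Z then thv m (Some (val i)) e l else 0)); last first.
    by move=> l _; rewrite lXz_coefM lC_coef subr_eq0.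
  case: (leP (- n%:Z) k) => hk; last first.
    by apply: big1 => l _; rewrite ifF //; have := ltn_ord l; lia.
  have hl : (absz (k + n%:Z)%R < n)%N by lia.
  rewrite (bigD1 (Ordinal hl)) //= ifT; last by lia.
  rewrite big1 ?addr0 // => l ne; rewrite ifF //; apply/eqP => ek.
  by move/eqP: ne; apply; apply: val_inj => /=; lia.
have eB : B_t (Some (val i)) m = - mx2
    (\sum_(l < n) lX ^ (l%:Z - n%:Z) * lC (thv m (Some (val i)) true l)) 0 0
    (\sum_(l < n) lX ^ (l%:Z - n%:Z) * lC (thv m (Some (val i)) false l)).
  congr (- _); apply: mx2P; rewrite summxE mx2E; try apply: big1 => l _;
    try apply: eq_bigr => l _; by rewrite mxE mx2E ?mulr0.
apply: (omega_IMD w hm htan hI hki).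
- rewrite eB; apply: mvbN; apply: mvb2; try exact: vb0; apply: vb_sum => l _;
    by move=> k hk; rewrite lXz_coefM lC_coef ifF //; lia.
(* A center moving at unit speed changes the exponent by minus its derivative, and the polar part of
   this is [B_t]; the difference with [B_t] is therefore written as a sum. *)
- rewrite eB opprK [ddir D _]h1 mx2D !addr0.
  have h e : regular (ldint_at D 1 (lamder E (Some (val i)) e) +
      \sum_(l < n) lX ^ (l%:Z - n%:Z) * lC (thv m (Some (val i)) e l)).
    move=> k k0; rewrite lcoefD (ldint_lamder hm htan) // hBt // mul1r.
    by rewrite (ddir_thv htan hs) // if_same mul0r sub0r addNr.
  by apply: mvb2 (h true) _ _ (h false); apply: vb0.
- by move=> i' e l _; apply/eqP.
- by move=> i' l; apply/eqP.
- case=> [k|] ne; last exact: dir_cst.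
  by apply: h0 => e; apply: ne; rewrite e.
- by apply: (kf_Ppoly_t htan) => // k /eqP; apply: h0.
Qed.
End IMD.

End Concrete.

Theorem theorem4p10 (R : realType) (S : setting R) (D : solutions S)
  (hD : admissible D) :
  (forall (i : option 'I_(nu S)) (l : 'I_(dim_un i)) (e : bool)
     (delta_IMD delta : pspace S -> pspace S),
     kind i = Un -> is_IMD_theta D l e delta_IMD ->
     forall m : pspace S, in_dom m ->
       omega_hat D (delta_IMD m) (delta m) m = 0%R) /\
  (forall (i : free_t S) (delta_IMD delta : pspace S -> pspace S),
     is_IMD_t D i delta_IMD ->
     forall m : pspace S, in_dom m ->
       omega_hat D (delta_IMD m) (delta m) m = 0%R).
Proof.
split=> [i l e u w ki hu|i u w hu] m hm.
  exact: (omega_IMD_theta hD _ ki hm (hu m hm)).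
exact: (omega_IMD_t hD _ hm (hu m hm)).
Qed.
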